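(* Let $\beta>0$, let $m\ge2$ be an integer, and suppose $m\beta>1$. Let $X_{\beta,m\beta/2}$ denote the zero set of the Hua--Pickrell stochastic zeta function $\xi^{\beta,m\beta/2}$, equivalently the $\mathsf{HP}_{\beta,m\beta/2}$ point process. Then $$\mathbb E\sum_{x\in X_{\beta,m\beta/2}}\frac1{x^2}=\frac{m\beta}{4(m\beta-1)(2m+1)}.$$
   Context: For $\beta>0$, $\delta>-1/2$, $N\ge1$, the circular Jacobi ensemble $\mathsf{CJ}_{N,\beta,\delta}$ is the law of $(\theta_1,\ldots,\theta_N)\in[-\pi,\pi)^N$ with density proportional to $\prod_{j<k}|e^{i\theta_j}-e^{i\theta_k}|^\beta\prod_{j}|1-e^{i\theta_j}|^{2\delta}$. Let $X_N(z)=\prod_{j=1}^N(z-e^{i\theta_j})$ and $f_N(z)=e^{-iz/2}X_N(e^{iz/N})/X_N(1)$. As $N\to\infty$ the random entire functions $f_N$ converge in law, in the topology of locally uniform convergence on $\mathbb C$ (and almost surely under a suitable coupling), to a random entire function $\xi^{\beta,\delta}$, the Hua--Pickrell stochastic zeta function. Its zero set $X_{\beta,\delta}\subset\mathbb R\setminus\{0\}$ is the $\mathsf{HP}_{\beta,\delta}$ point process, and almost surely $$\xi^{\beta,\delta}(z)=\lim_{R\to\infty}\prod_{x\in X_{\beta,\delta},\,|x|<R}\Bigl(1-\frac zx\Bigr),\qquad \xi^{\beta,\delta}(0)=1.$$ The normalization is that of mean spacing $2\pi$ (the points are limits of $N\theta_j$). *)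

(* Defs.v *)
From HB Require Import structures.
From mathcomp Require Import all_boot all_order all_algebra.
From mathcomp Require Import complex.
From mathcomp Require Import all_classical all_reals all_analysis.

Set Implicit Arguments.
Unset Strict Implicit.
Unset Printing Implicit Defensive.

Import Order.TTheory GRing.Theory Num.Theory.
Import numFieldNormedType.Exports.

Local Open Scope classical_set_scope.
Local Open Scope complex_scope.
Local Open Scope ring_scope.

Section tuple_cons.
Context (R : realType) (n : nat).

Definition tcons (p : measurableTypeR R * n.-tuple (measurableTypeR R)) : n.+1.-tuple (measurableTypeR R) :=
  [tuple of p.1 :: p.2].

Definition tuncons (t : n.+1.-tuple (measurableTypeR R)) : measurableTypeR R * n.-tuple (measurableTypeR R) :=
  (thead t, [tuple of behead t]).

Lemma measurable_tcons : measurable_fun [set: measurableTypeR R * n.-tuple (measurableTypeR R)] tcons.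
Proof. exact: measurable_cons measurable_fst measurable_snd. Qed.

Lemma measurable_tuncons : measurable_fun [set: n.+1.-tuple (measurableTypeR R)] tuncons.
Proof.
apply: measurable_fun_pair; last exact: measurable_behead.
exact: measurable_tnth.
Qed.

Lemma tconsK : cancel tcons tuncons.
Proof. by case=> x t; congr pair; exact: val_inj. Qed.

Variable mu : {sigma_finite_measure set (n.-tuple (measurableTypeR R)) -> \bar R}.

Let leb : {sigma_finite_measure set (measurableTypeR R) -> \bar R} :=
  @lebesgue_measure R.

Definition lebesgue_cons : set (n.+1.-tuple (measurableTypeR R)) -> \bar R :=
  pushforward (leb \x mu)%E tcons.

Let lebesgue_cons0 : lebesgue_cons set0 = 0%E.
Proof. by rewrite /lebesgue_cons /pushforward preimage_set0 measure0. Qed.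

Let lebesgue_cons_ge0 A : (0 <= lebesgue_cons A)%E.
Proof. exact: (measure_ge0 (leb \x mu)%E). Qed.

Let lebesgue_cons_sigma_additive : semi_sigma_additive lebesgue_cons.
Proof.
move=> F mF tF mUF; rewrite /lebesgue_cons /pushforward preimage_bigcup.
have mtF k : measurable (tcons @^-1` F k).
  by rewrite -[X in measurable X]setTI; exact: measurable_tcons.
apply: measure_semi_sigma_additive => //.
- apply/trivIsetP => i j _ _ ij; rewrite -preimage_setI.
  by move/trivIsetP : tF => /(_ _ _ _ _ ij) ->//; rewrite preimage_set0.
- exact: bigcupT_measurable.
Qed.

HB.instance Definition _ := isMeasure.Build _ _ _ lebesgue_cons
  lebesgue_cons0 lebesgue_cons_ge0 lebesgue_cons_sigma_additive.

Let lebesgue_cons_sigma_finite : sigma_finite setT lebesgue_cons.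
Proof.
have /sigma_finiteP[F [TF ndF Foo]] := sigma_finiteT leb.
have /sigma_finiteP[G [TG ndG Goo]] := sigma_finiteT mu.
have mFG k : measurable (F k `*` G k).
  by have [? _] := Foo k; have [? _] := Goo k; exact: measurableX.
exists (fun k => tuncons @^-1` (F k `*` G k)).
  rewrite -preimage_bigcup; apply/esym/seteqP; split=> // t _ /=.
  have [i _ Fi] : (\bigcup_k F k) (tuncons t).1 by rewrite -TF.
  have [j _ Gj] : (\bigcup_k G k) (tuncons t).2 by rewrite -TG.
  exists (maxn i j) => //; split.
  - by move: Fi; exact/subsetPset/ndF/leq_maxl.
  - by move: Gj; exact/subsetPset/ndG/leq_maxr.
move=> k; split.
  by rewrite -[X in measurable X]setTI; exact: measurable_tuncons.
rewrite /lebesgue_cons /pushforward.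
have -> : tcons @^-1` (tuncons @^-1` (F k `*` G k)) = F k `*` G k.
  by apply/funext => p; rewrite /preimage /mkset tconsK.
have [mF Fk] := Foo k; have [mG Gk] := Goo k.
by rewrite product_measure1E// lte_mul_pinfty// ge0_fin_numE.
Qed.

HB.instance Definition _ :=
  Measure_isSigmaFinite.Build _ _ _ lebesgue_cons lebesgue_cons_sigma_finite.

End tuple_cons.

(* Lebesgue measure on R^n *)
Fixpoint lebesgue_tuple (R : realType) (n : nat) :
    {sigma_finite_measure set (n.-tuple (measurableTypeR R)) -> \bar R} :=
  if n is n'.+1 then lebesgue_cons (lebesgue_tuple R n')
  else dirac [tuple] : {sigma_finite_measure set (0.-tuple (measurableTypeR R)) -> \bar R}.

Section circular_jacobi.
Context {R : realType}.
Implicit Types (beta delta t : R) (z : R[i]).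

Definition cexp z : R[i] :=
  (expR (complex.Re z) * cos (complex.Im z))
  +i* (expR (complex.Re z) * sin (complex.Im z)).

Definition cis t : R[i] := cexp ('i * t%:C).

Definition cabs z : R := complex.Re `|z|.

Definition torus (N : nat) : set (N.-tuple (measurableTypeR R)) :=
  [set th | forall j : 'I_N, - pi <= (tnth th j : R) < pi].

Definition cj_weight N beta delta (th : N.-tuple (measurableTypeR R)) : R :=
  (\prod_(k < N) \prod_(j < N | (j < k)%N)
     cabs (cis (tnth th j) - cis (tnth th k)) `^ beta)
  * \prod_(j < N) cabs (1 - cis (tnth th j)) `^ (2 * delta).

(* expectation of G(theta_1, ..., theta_N) under CJ_{N, beta, delta} *)
Definition cj_expectation N beta delta (G : N.-tuple (measurableTypeR R) -> R) : R :=
  (\int[lebesgue_tuple R N]_(th in @torus N) (G th * cj_weight beta delta th))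
  / \int[lebesgue_tuple R N]_(th in @torus N) cj_weight beta delta th.

Definition char_poly_circ N (th : N.-tuple (measurableTypeR R)) z : R[i] :=
  \prod_(j < N) (z - cis (tnth th j)).

(* When some theta_j = 0, an event of probability 0, this is the constant 0. *)
Definition cj_fun N (th : N.-tuple (measurableTypeR R)) z : R[i] :=
  cexp (- ('i * z / 2)) * char_poly_circ th (cexp ('i * z / N%:R))
  / char_poly_circ th 1.

End circular_jacobi.

Section random_entire.
Context {R : realType}.

(* functions C -> C with the topology of locally uniform convergence *)
Definition cfun : Type := {family compact, R[i]^o -> R[i]^o}.

Definition entire : set cfun :=
  [set f | forall z : R[i]^o, derivable (f : R[i]^o -> R[i]^o) z 1].

Context {d : measure_display} {Omega : measurableType d}.
Variable P : probability Omega R.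
Implicit Types xi : Omega -> cfun.

(* The Borel sigma-algebra of the space of entire functions is generated by
   the evaluations f |-> f z. *)
Definition random_entire xi : Prop :=
  (forall w, entire (xi w)) /\
  (forall z : R[i],
     measurable_fun [set: Omega] (fun w => complex.Re (xi w z)) /\
     measurable_fun [set: Omega] (fun w => complex.Im (xi w z))).

Definition cj_cvg_in_law (beta delta : R) xi : Prop :=
  forall Phi : cfun -> R,
    {within entire, continuous Phi} ->
    (exists M : R, forall f, entire f -> `|Phi f| <= M) ->
    ((@cj_expectation R N beta delta (fun th => Phi (cj_fun th)))%:E
       @[N --> \oo] --> 'E_P[fun w => Phi (xi w)])%E.

Definition zeros (f : cfun) : set R := [set x | f x%:C = 0].

(* Hua--Pickrell stochastic zeta function.  Its law is determined by
   [hp_cvg_in_law]; the almost sure clauses are known properties of the limit.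
   By [hp_zeros], [zeros (xi w)] is almost surely the whole complex zero set. *)
Record hua_pickrell_zeta (beta delta : R) xi : Prop := {
  hp_random_entire : random_entire xi;
  hp_cvg_in_law : cj_cvg_in_law beta delta xi;
  hp_zeros : {ae P, forall w, forall z : R[i],
    xi w z = 0 -> exists2 x : R, x != 0 & z = x%:C};
  hp_at0 : {ae P, forall w, xi w 0 = 1};
  hp_product : {ae P, forall w, forall z : R[i],
    (\big[*%R/1]_(x \in zeros (xi w) `&` [set x | `|x| < r]) (1 - z / x%:C)
       : R[i]^o) @[r --> +oo%R] --> (xi w z : R[i]^o)}
}.

End random_entire.

(* Main.v *)
(** Write [q_j = |1 - e^(i theta_j)|^-2], [Q = sum_j q_j] and
    [T = sum_j cot (theta_j / 2)].  Integrating by parts against the weight of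
    the circular Jacobi ensemble along the vector fields
    [(a cot (theta_j / 2) + b T) psi], the interaction terms collapse by
    [(cot x - cot y) cot (x - y) = - (1 + cot x cot y)].  The choice
    [a = delta], [b = beta / 4] eliminates [T^2], and without the cutoff [psi]
    it reads
    [(2 delta - 1) (2 delta + beta / 2) E Q = delta beta N^2 / 4 + delta^2 N].
    For [psi] a function of [2 delta Q + beta T^2 / 8] the term with the
    derivative of [psi] is signed, which gives the upper bound on [E Q]; for
    [psi = s / (s + Q)] that term is estimated by a quantity which vanishes in
    the limits [N -> oo], [s / N^2 -> oo].

    The passage to the limit uses evaluations at [z = i y] only:
    [|f_N (i y)|^2 = prod_j (1 + 4 sinh (y / 2N)^2 q_j)] corresponds to
    [|xi (i y)|^2 = prod_x (1 + y^2 / x^2)], and both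
    [(|xi (i y)|^2 - 1) / y^2] and [(1 - |xi (i y)|^-2) / y^2] tend to
    [sum_x 1 / x^2] as [y -> 0]. *)

From mathcomp Require Import all_boot all_order all_algebra.
From mathcomp Require Import finmap complex ring lra.
From mathcomp Require Import all_classical all_reals all_analysis measurable_realfun.
Require Import Defs.

Set Implicit Arguments.
Unset Strict Implicit.
Unset Printing Implicit Defensive.

Import Order.TTheory GRing.Theory Num.Theory.
Import numFieldNormedType.Exports.

Local Open Scope classical_set_scope.
Local Open Scope ring_scope.

(** * Integration by parts on the torus *)

Section torus.
Context {R : realType}.
Local Notation leb := (@lebesgue_measure R).

(** The expectation of [Q] is explicit for every [N], but convergence in law only transports bounded
    continuous functionals, and mass could escape: [Q] has a finite second moment only for
    [2 delta > 3], while [2 delta > 1] is what is assumed. Fatou's lemma carries the upper bound to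
    the limit; the lower bound must be proved with the cutoff in place, at the scale [s = M N^2] and
    with constants free of [N]. The limits are taken in the order [N -> oo], [y -> 0], [M -> oo],
    [eta -> 0], where [eta] weighs a cross term between [T] and the derivative of [psi].

    The field [b T] is the same in all coordinates, an infinitesimal rotation that leaves the
    interaction unchanged. It therefore sees only the factor at [theta = 0] and supplies the second
    relation needed to remove [T^2].

    The fields are singular at [theta_j = 0], the logarithmic derivative of the weight also at
    collisions. Integration by parts is done with every gap shifted by [e > 0]; the cutoff bounds
    the resulting divergence uniformly in [e], so that dominated convergence restores [e = 0]. *)

Definition fcons n (u : R) (x : 'I_n -> R) (k : 'I_n.+1) : R :=
  if unlift ord0 k is Some j then x j else u.

Definition upd n (x : 'I_n -> R) (i : 'I_n) (t : R) (j : 'I_n) : R :=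
  if j == i then t else x j.

Lemma fcons0 n u (x : 'I_n -> R) : fcons u x ord0 = u.
Proof. by rewrite /fcons unlift_none. Qed.

Lemma fconsS n u (x : 'I_n -> R) j : fcons u x (lift ord0 j) = x j.
Proof. by rewrite /fcons liftK. Qed.

Lemma tnth_tcons n (p : measurableTypeR R * n.-tuple (measurableTypeR R)) :
  tnth (tcons p) = fcons p.1 (tnth p.2).
Proof.
apply/funext => k; case: (unliftP ord0 k) => [j ->|->].
  by rewrite fconsS tnthS.
by rewrite fcons0 tnth0.
Qed.

Lemma upd_fcons0 n u v (x : 'I_n -> R) : upd (fcons u x) ord0 v = fcons v x.
Proof.
apply/funext => k; rewrite /upd.
by case: (unliftP ord0 k) => [j ->|->]; rewrite ?fconsS ?fcons0.
Qed.

Lemma upd_fconsS n u v (x : 'I_n -> R) j :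
  upd (fcons u x) (lift ord0 j) v = fcons u (upd x j v).
Proof.
apply/funext => k; rewrite /upd.
case: (unliftP ord0 k) => [i ->|->]; rewrite ?fconsS ?fcons0 //.
Qed.

Lemma torusE n (th : n.-tuple (measurableTypeR R)) :
  torus th = (forall j : 'I_n, - pi <= (tnth th j : R) < pi).
Proof. by []. Qed.

Lemma torus_tcons n :
  @tcons R n @^-1` torus (N:=n.+1) = (`[- pi, pi[%classic : set R) `*` torus (N:=n).
Proof.
apply/seteqP; split => -[u t] /=.
  rewrite torusE tnth_tcons /= => h; split.
    by have := h ord0; rewrite fcons0 /= in_itv.
  by move=> j; have := h (lift ord0 j); rewrite fconsS.
move=> [hu ht]; rewrite torusE tnth_tcons => k.
case: (unliftP ord0 k) => [i ->|->]; rewrite ?fconsS ?fcons0 //.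
Qed.

Lemma measurable_torus n : measurable (torus (R:=R) (N:=n)).
Proof.
have -> : torus (R:=R) (N:=n) =
    \bigcap_(j in [set: 'I_n]) ((fun th => tnth th j : R) @^-1` `[- pi, pi[%classic).
  apply/seteqP; split => th /=.
    by move=> h j _ /=; rewrite in_itv; exact: h.
  by move=> h j; have := h j I; rewrite /= in_itv.
apply: fin_bigcap_measurable => [|j _]; first exact: finite_finset.
rewrite -[X in measurable X]setTI.
by apply: (@measurable_tnth _ (measurableTypeR R)) => //.
Qed.

Lemma torus_finite n : (lebesgue_tuple R n (torus (N:=n)) < +oo)%E.
Proof.
elim: n => [|n IH].
  rewrite /= diracE; exact: ltry.
rewrite [X in (X < _)%E](_ : _ = (leb \x lebesgue_tuple R n)%E (@tcons R n @^-1` torus (N:=n.+1))) //.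
rewrite torus_tcons product_measure1E //; last exact: measurable_torus.
rewrite lte_mul_pinfty //.
rewrite [X in X \is a fin_num](lebesgue_measure_itv `[(- pi)%R, pi%R[) /=.
by case: ifP.
Qed.

Lemma bounded_integrable_torus n (f : n.-tuple (measurableTypeR R) -> R) :
  measurable_fun setT f -> (exists C, forall th, torus th -> `|f th| <= C) ->
  (lebesgue_tuple R n).-integrable (torus (N:=n)) (EFin \o f).
Proof.
move=> mf [C fC]; apply: measurable_bounded_integrable.
- exact: measurable_torus.
- exact: torus_finite.
- exact: measurable_funTS.
- exists C; split; first exact: num_real.
  by move=> M CM th tth /=; rewrite (le_trans (fC _ tth)) // ltW.
Qed.

Lemma FTC_periodic (F f : R -> R) : continuous f ->
  (forall t : R, is_derive t 1 F (f t)) -> F pi = F (- pi) ->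
  (\int[leb]_(t in `[(- pi)%R, pi%R[) (f t)%:E = 0)%E.
Proof.
move=> cf dF FE.
rewrite integral_itv_bndo_bndc; last first.
  by apply/measurable_EFinP; apply: measurable_funTS; exact: continuous_measurable_fun.
have pp : (- pi < pi :> R) by have := pi_gt0 R; lra.
have cF : continuous F.
  move=> t; apply: differentiable_continuous; apply/derivable1_diffP.
  exact: (@ex_derive _ _ _ _ _ _ _ (dF t)).
rewrite (@continuous_FTC2 _ f F) //.
- by rewrite FE subee.
- exact: continuous_subspaceT.
- split.
  + by move=> x _; exact: (@ex_derive _ _ _ _ _ _ _ (dF x)).
  + apply: cvg_at_right_filter; exact: cF.
  + apply: cvg_at_left_filter; exact: cF.
- by move=> x _; rewrite derive1E; exact: (@derive_val _ _ _ _ _ _ _ (dF x)).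
Qed.

(** Fubini splits off coordinate 0. If [i] is that coordinate, the inner integral over it vanishes
    by periodicity; otherwise coordinate 0 is frozen and the induction hypothesis applies to the
    remaining ones. *)
Lemma integral_torus_derivative n (i : 'I_n) (F dF : ('I_n -> R) -> R) :
  measurable_fun setT (fun th : n.-tuple (measurableTypeR R) => dF (tnth th)) ->
  (exists C, forall x, `|dF x| <= C) ->
  (forall x, continuous (fun t => dF (upd x i t))) ->
  (forall x (t : R), is_derive t 1 (fun t => F (upd x i t)) (dF (upd x i t))) ->
  (forall x, F (upd x i pi) = F (upd x i (- pi))) ->
  (\int[lebesgue_tuple R n]_(th in torus (N:=n)) (dF (tnth th))%:E = 0)%E.
Proof.
elim: n i F dF => [[]//|n IH] i F dF mdF bdF cdF dFdF perF.
have itorus := bounded_integrable_torus mdF.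
have [C dFC] := bdF.
have {itorus} itorus : (lebesgue_tuple R n.+1).-integrable (torus (N:=n.+1))
    (EFin \o (fun th => dF (tnth th))) by apply: itorus; exists C.
rewrite [LHS](_ : _ = (\int[pushforward (leb \x lebesgue_tuple R n)%E (@tcons R n)]_(th in
   torus (N:=n.+1)) (dF (tnth th))%:E)%E) //.
have mtor : measurable ((@tcons R n) @^-1` (torus (N:=n.+1))).
  rewrite -[X in measurable X]setTI; apply: measurable_tcons => //.
  exact: measurable_torus.
have mg : measurable_fun setT (fun p => dF (tnth (@tcons R n p))).
  exact: (measurableT_comp mdF (@measurable_tcons R n)).
have ig : ((leb \x lebesgue_tuple R n)%E).-integrable (@tcons R n @^-1` torus (N:=n.+1))
   (EFin \o (fun p => dF (tnth (@tcons R n p)))).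
  apply: measurable_bounded_integrable => //.
  - exact: (torus_finite n.+1).
  - exact: measurable_funTS.
  - exists C; split; first exact: num_real.
    by move=> M CM p _ /=; rewrite (le_trans (dFC _)) // ltW.
rewrite integral_pushforward //=; first last.
- exact: measurable_torus.
- exact/measurable_EFinP.
- exact: measurable_tcons.
rewrite torus_tcons in ig mtor *.
rewrite integral_mkcond.
have ig' : ((leb \x lebesgue_tuple R n)%E).-integrable setT
   ((EFin \o (fun p => dF (tnth (@tcons R n p)))) \_ (`[- pi, pi[%classic `*` torus (N:=n))).
  by rewrite -integrable_mkcond.
have [i0|[j ij]] : i = ord0 \/ exists j, i = lift ord0 j.
  by case: (unliftP ord0 i) => [j ->|->]; [right; exists j|left].
- subst i.
  rewrite -(integral21_prod_meas1 ig').
  apply: integral0_eq => t _ /=; rewrite /fubini_G.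
  have [tt|ntt] := pselect (torus t); last first.
    apply: integral0_eq => u _; rewrite patchE; case: ifPn => //.
    by rewrite inE => -[].
  rewrite [LHS](_ : _ = (\int[leb]_(u in `[(- pi)%R, pi%R[) (dF (fcons u (tnth t)))%:E)%E); last first.
    rewrite [RHS]integral_mkcond; apply: eq_integral => u _.
    rewrite !patchE /= tnth_tcons /=; congr (if _ then _ else _).
    by apply/idP/idP; rewrite !inE /= => // -[].
  (* The entry 0 is a placeholder, overwritten by [upd x0 ord0 u]. *)
  pose x0 := fcons 0 (tnth t).
  apply: (@FTC_periodic (fun u => F (upd x0 ord0 u))).
  + have -> : (fun u => dF (fcons u (tnth t))) = (fun u => dF (upd x0 ord0 u)).
      by apply/funext => u; rewrite upd_fcons0.
    exact: cdF.
  + by move=> u; rewrite -(upd_fcons0 0); exact: dFdF.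
  + exact: perF.
- subst i.
  rewrite -(integral12_prod_meas1 ig').
  apply: integral0_eq => u _ /=; rewrite /fubini_F.
  have [tu|ntu] := pselect (`[- pi, pi[%classic u); last first.
    apply: integral0_eq => t _; rewrite patchE; case: ifPn => //.
    by rewrite inE => -[].
  rewrite [LHS](_ : _ = (\int[lebesgue_tuple R n]_(t in torus (N:=n)) (dF (fcons u (tnth t)))%:E)%E); last first.
    rewrite [RHS]integral_mkcond; apply: eq_integral => t _.
    rewrite !patchE /= tnth_tcons /=; congr (if _ then _ else _).
    by apply/idP/idP; rewrite !inE /= => // -[].
  apply: (IH j (F \o fcons u) (dF \o fcons u)) => /=.
  + have -> : (fun th : n.-tuple (measurableTypeR R) => dF (fcons u (tnth th))) =
      (fun th => dF (tnth (@tcons R n (u, th)))).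
      by apply/funext => th; rewrite tnth_tcons.
    apply: (measurableT_comp mg); exact: measurable_pair1.
  + by exists C.
  + move=> x; rewrite [X in continuous X](_ : _ =
      (fun t => dF (upd (fcons u x) (lift ord0 j) t))); first exact: cdF.
    by apply/funext => t; rewrite upd_fconsS.
  + move=> x t; rewrite -upd_fconsS.
    rewrite [X in is_derive _ _ X](_ : _ =
      (fun t => F (upd (fcons u x) (lift ord0 j) t))); first exact: dFdF.
    by apply/funext => s; rewrite upd_fconsS.
  + by move=> x; rewrite -!upd_fconsS.
Qed.

End torus.

(** * The regularized loop equation *)

Section one_variable.
Context {R : realType}.
Implicit Types (e t x y : R).

(* [gap2 t = |1 - e^(it)|^2].  For [e = 0], [kap] is [cot (t / 2)] and [chi]
   is [(1 + cot (t / 2) ^ 2) / 4], except at [t = 0] where both are 0 because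
   [0^-1 = 0]; [e > 0] makes them smooth. *)
Definition gap2 t : R := 2 - 2 * cos t.
Definition chi e t : R := (gap2 t + e)^-1.
Definition kap e t : R := 2 * sin t * chi e t.
Definition lam e t : R := ln (gap2 t + e).
Definition dkap e t : R := 2 * cos t * chi e t - kap e t ^+ 2.

Lemma gap2_ge0 t : 0 <= gap2 t.
Proof. by have := cos_le1 t; rewrite /gap2; lra. Qed.

Lemma gap2_le4 t : gap2 t <= 4.
Proof. by have := cos_geN1 t; rewrite /gap2; lra. Qed.

(** As [gap2 t = 4 sin (t / 2)^2], this is the double angle formula for the sine. *)
Lemma sin2_gap2 t : (2 * sin t) ^+ 2 = gap2 t * (4 - gap2 t).
Proof. by have := cos2Dsin2 t; rewrite /gap2; nra. Qed.

Lemma gap2De_gt0 e t : 0 < e -> 0 < gap2 t + e.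
Proof. by have := gap2_ge0 t; lra. Qed.

Lemma gap2N t : gap2 (- t) = gap2 t.
Proof. by rewrite /gap2 cosN. Qed.

Lemma chi_ge0 e t : 0 <= e -> 0 <= chi e t.
Proof. by move=> e0; rewrite invr_ge0 addr_ge0 // gap2_ge0. Qed.

Lemma gap2M_chi e t : gap2 t + e != 0 -> (gap2 t + e) * chi e t = 1.
Proof. by move=> h; rewrite mulfV. Qed.

(** Holds because [gap2 t * chi e t <= 1]. In the later estimates [kap] thus counts as a square root
    of [chi]. *)
Lemma sqr_kap_le e t : 0 <= e -> kap e t ^+ 2 <= 4 * chi e t.
Proof.
move=> e0; rewrite /kap exprMn sin2_gap2.
have [h|h] := eqVneq (gap2 t + e) 0.
  by rewrite /chi h invr0 expr0n /= !mulr0.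
have := gap2M_chi h; have := chi_ge0 t e0; have := gap2_ge0 t; have := gap2_le4 t.
move: (gap2 t) (chi e t) => v c v4 v0 c0 E.
have -> : v * (4 - v) * c ^+ 2 = (v * c) * (4 - v) * c by ring.
have vc : v * c <= 1 by nra.
have : 0 <= v * c by nra.
nra.
Qed.

Lemma abs_dkap_le e t : 0 <= e -> `|dkap e t| <= 6 * chi e t.
Proof.
move=> e0; have := sqr_kap_le t e0; have := sqr_ge0 (kap e t).
have := chi_ge0 t e0; have := cos_le1 t; have := cos_geN1 t.
rewrite /dkap ler_norml; nra.
Qed.

Lemma chi_le e t : 0 < e -> chi e t <= e^-1.
Proof.
move=> e0; rewrite lef_pV2 ?posrE ?gap2De_gt0 //.
by have := gap2_ge0 t; lra.
Qed.

Lemma abs_kap_le e t : 0 < e -> `|kap e t| <= 2 / e.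
Proof.
move=> e0; rewrite /kap normrM (ger0_norm (chi_ge0 _ (ltW e0))).
apply: ler_pM => //; first exact: chi_ge0 (ltW e0).
  by rewrite ler_norml; have := sin_le1 t; have := sin_geN1 t; lra.
exact: chi_le.
Qed.

Lemma abs_lam_le e t : 0 < e -> `|lam e t| <= `|ln e| + `|ln (4 + e)|.
Proof.
move=> e0.
have h1 : ln e <= lam e t.
  by rewrite /lam ler_ln ?posrE ?gap2De_gt0 //; have := gap2_ge0 t; lra.
have h2 : lam e t <= ln (4 + e).
  rewrite /lam ler_ln ?posrE ?gap2De_gt0 //; have := gap2_le4 t; lra.
have := ler_norm (ln (4 + e)); have := ler_norm (- ln e); rewrite normrN.
have := normr_ge0 (ln e); have := normr_ge0 (ln (4 + e)).
by rewrite ler_norml; lra.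
Qed.

Lemma gap2B x y : gap2 (x - y) = (sin x - sin y) ^+ 2 + (cos x - cos y) ^+ 2.
Proof.
rewrite /gap2 cosB; have := cos2Dsin2 x; have := cos2Dsin2 y; nra.
Qed.

(* Uniform in [e]: at [e = 0] the left-hand side is the square of
   [(cot (x / 2) - cot (y / 2)) cot ((x - y) / 2)], which has no singularity
   at [x = y]. *)
Lemma sqr_kap_pair_le e x y : 0 < e ->
  ((kap e x - kap e y) * kap e (x - y)) ^+ 2 <= 64 * (chi e x * chi e y).
Proof.
move=> e0.
have gx := gap2M_chi (lt0r_neq0 (gap2De_gt0 x e0)).
have gy := gap2M_chi (lt0r_neq0 (gap2De_gt0 y e0)).
have gd := gap2M_chi (lt0r_neq0 (gap2De_gt0 (x - y) e0)).
have cx := chi_ge0 x (ltW e0); have cy := chi_ge0 y (ltW e0).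
have cd := chi_ge0 (x - y) (ltW e0).
(* [A] is the numerator of [kap e x - kap e y] at [e = 0], and [e * B] its correction. *)
pose A := 2 * sin x * gap2 y - 2 * sin y * gap2 x.
pose B := 2 * sin x - 2 * sin y.
have kB : kap e x - kap e y = (A + e * B) * (chi e x * chi e y).
  transitivity (kap e x * ((gap2 y + e) * chi e y) - kap e y * ((gap2 x + e) * chi e x)).
    by rewrite gx gy !mulr1.
  by rewrite /kap /A /B; ring.
(* The square of [cot (x/2) - cot (y/2) = sin ((y-x)/2) / (sin (x/2) sin (y/2))] after clearing
   denominators. *)
have A2 : A ^+ 2 = 4 * gap2 (x - y) * (gap2 x * gap2 y).
  rewrite gap2B /A /gap2.
  have := cos2Dsin2 x; have := cos2Dsin2 y.
  move: (cos x) (sin x) (cos y) (sin y) => a b c d Ey Ex.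
  have Eb : b ^+ 2 = 1 - a ^+ 2 by lra.
  have Ed : d ^+ 2 = 1 - c ^+ 2 by lra.
  have -> : (2 * b * (2 - 2 * c) - 2 * d * (2 - 2 * a)) ^+ 2 =
    16 * (b ^+ 2 * (1 - c) ^+ 2 + d ^+ 2 * (1 - a) ^+ 2 - 2 * b * d * (1 - a) * (1 - c)) by ring.
  have -> : (b - d) ^+ 2 + (a - c) ^+ 2 =
     b ^+ 2 + d ^+ 2 - 2 * b * d + (a - c) ^+ 2 by ring.
  rewrite Eb Ed; ring.
have B2 : B ^+ 2 <= 4 * gap2 (x - y).
  rewrite gap2B /B; have := sqr_ge0 (cos x - cos y); nra.
have D2 := sin2_gap2 (x - y).
have v0 := gap2_ge0 (x - y); have v4 := gap2_le4 (x - y).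
have vx0 := gap2_ge0 x; have vy0 := gap2_ge0 y.
rewrite kB {1}/kap.
have -> : ((A + e * B) * (chi e x * chi e y) * (2 * sin (x - y) * chi e (x - y))) ^+ 2 =
  (A + e * B) ^+ 2 * (2 * sin (x - y)) ^+ 2 * (chi e x * chi e y * chi e (x - y)) ^+ 2 by ring.
rewrite D2.
move: (gap2 (x - y)) (gap2 x) (gap2 y) A2 B2 v0 v4 vx0 vy0 gx gy gd {kB D2} cx cy cd.
move: (chi e x) (chi e y) (chi e (x - y)) A B.
move=> p q r A B v a b A2 B2 v0 v4 a0 b0 gx gy gd p0 q0 r0.
(* The factor [v = gap2 (x - y)] is the point: with the [v] from [(2 sin (x - y))^2] it absorbs the
   [r^2] of [kap e (x - y) ^+ 2], since [v * r <= 1]. *)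
have AB : (A + e * B) ^+ 2 <= 8 * v * (a * b + e ^+ 2).
  have : 2 * e ^+ 2 * B ^+ 2 <= 8 * e ^+ 2 * v by have := sqr_ge0 e; nra.
  have := sqr_ge0 (A - e * B); nra.
have vr : v * r <= 1 by nra.
have vr0 : 0 <= v * r by nra.
have ap : a * p <= 1 by nra.
have ap0 : 0 <= a * p by nra.
have bq : b * q <= 1 by nra.
have bq0 : 0 <= b * q by nra.
have ep : e * p <= 1 by nra.
have eq : e * q <= 1 by nra.
have ep0 : 0 <= e * p by nra.
have eq0 : 0 <= e * q by nra.
have h0 : 0 <= (p * q * r) ^+ 2 by exact: sqr_ge0.
have h1 : (A + e * B) ^+ 2 * (v * (4 - v)) <= 32 * (a * b + e ^+ 2) * v ^+ 2.
  have hv : 0 <= v * (4 - v) by nra.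
  apply: (@le_trans _ _ (8 * v * (a * b + e ^+ 2) * (v * (4 - v)))).
    exact: ler_wpM2r.
  have : 0 <= (a * b + e ^+ 2) * v ^+ 3.
    by apply: mulr_ge0; [apply: addr_ge0; [exact: mulr_ge0|exact: sqr_ge0]|exact: exprn_ge0].
  rewrite -subr_ge0 => h; rewrite -subr_ge0.
  suff -> : 32 * (a * b + e ^+ 2) * v ^+ 2 - 8 * v * (a * b + e ^+ 2) * (v * (4 - v)) =
    8 * ((a * b + e ^+ 2) * v ^+ 3 - 0) by rewrite mulr_ge0.
  by ring.
apply: (le_trans (ler_wpM2r h0 h1)).
have -> : 32 * (a * b + e ^+ 2) * v ^+ 2 * (p * q * r) ^+ 2 =
   32 * (p * q) * (v * r) ^+ 2 * ((a * p) * (b * q) + (e * p) * (e * q)) by ring.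
have k1 : (v * r) ^+ 2 <= 1 by nra.
have k2 : (a * p) * (b * q) <= 1 by nra.
have k3 : (e * p) * (e * q) <= 1 by nra.
have k4 : 0 <= (a * p) * (b * q) + (e * p) * (e * q) by nra.
have pq : 0 <= p * q by nra.
have k5 : (v * r) ^+ 2 * ((a * p) * (b * q) + (e * p) * (e * q)) <= 2.
  have := sqr_ge0 (v * r); nra.
rewrite -mulrA; nra.
Qed.

Lemma sqr_kap0 t : gap2 t != 0 -> kap 0 t ^+ 2 = 4 * chi 0 t - 1.
Proof.
move=> v0; have := @gap2M_chi 0 t; rewrite addr0 => /(_ v0) E.
rewrite /kap exprMn sin2_gap2.
have -> : gap2 t * (4 - gap2 t) * chi 0 t ^+ 2 =
  4 * (gap2 t * chi 0 t) * chi 0 t - (gap2 t * chi 0 t) ^+ 2 by ring.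
by rewrite E; ring.
Qed.

Lemma dkap0 t : gap2 t != 0 -> dkap 0 t = - 2 * chi 0 t.
Proof.
move=> v0; have := @gap2M_chi 0 t; rewrite addr0 => /(_ v0) E.
rewrite /dkap sqr_kap0 //.
have -> : 2 * cos t = 2 - gap2 t by rewrite /gap2; ring.
by rewrite mulrBl E; ring.
Qed.

Lemma kap0_pair x y : gap2 x != 0 -> gap2 y != 0 -> gap2 (x - y) != 0 ->
  (kap 0 x - kap 0 y) * kap 0 (x - y) = - (1 + kap 0 x * kap 0 y).
Proof.
rewrite /kap /chi !addr0 /gap2 sinB cosB => vx vy vd.
have Ex := cos2Dsin2 x; have Ey := cos2Dsin2 y.
move: (cos x) (sin x) (cos y) (sin y) Ex Ey vx vy vd => a b c d Ex Ey vx vy vd.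
have Eb : b ^+ 2 = 1 - a ^+ 2 by lra.
have Ed : d ^+ 2 = 1 - c ^+ 2 by lra.
apply/eqP; rewrite -subr_eq0.
have -> : (2 * b / (2 - 2 * a) - 2 * d / (2 - 2 * c)) *
  (2 * (b * c - a * d) / (2 - 2 * (a * c + b * d))) -
  - (1 + 2 * b / (2 - 2 * a) * (2 * d / (2 - 2 * c))) =
  ((2 * b * (2 - 2 * c) - 2 * d * (2 - 2 * a)) * (2 * (b * c - a * d)) +
   ((2 - 2 * a) * (2 - 2 * c) + 4 * b * d) * (2 - 2 * (a * c + b * d)))
   / ((2 - 2 * a) * (2 - 2 * c) * (2 - 2 * (a * c + b * d))).
  by field; rewrite vx vy vd.
rewrite [X in X / _](_ : _ = 0) ?mul0r //.
transitivity (8 * (b ^+ 2 * (c - c ^+ 2) + d ^+ 2 * (a - a ^+ 2) - b ^+ 2 * d ^+ 2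
  + (1 - a) * (1 - c) * (1 - a * c))).
  ring.
rewrite Eb Ed; ring.
Qed.

End one_variable.

(** * Derivatives of the regularized one-variable functions *)

Section one_variable_derivatives.
Context {R : realType}.
Variables (e : R) (e0 : 0 < e).

Lemma is_derive_gap2 (t : R) : is_derive t 1 (@gap2 R) (2 * sin t).
Proof.
have h : is_derive t 1 (cst 2 - 2 \*: (@cos R)) (0 - 2 *: (- sin t)).
  exact: is_deriveB.
by apply: (is_derive_eq h); rewrite scalerN sub0r opprK.
Qed.

Lemma is_derive_gap2De (t : R) : is_derive t 1 (fun t => gap2 t + e) (2 * sin t).
Proof.
have h := is_derive_gap2 t.
have h2 : is_derive t 1 (@gap2 R + cst e) (2 * sin t + 0) by exact: is_deriveD.
by apply: (is_derive_eq h2); rewrite addr0.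
Qed.

Lemma is_derive_lam (t : R) : is_derive t 1 (lam e) (kap e t).
Proof.
have h := is_derive_gap2De t.
have h2 := is_derive1_ln (gap2De_gt0 t e0).
have := @is_derive1_comp R (@ln R) (fun t => gap2 t + e) t _ _ h2 h.
by move=> H; apply: (is_derive_eq H); rewrite /kap mulrC.
Qed.

Lemma is_derive_chi (t : R) : is_derive t 1 (chi e) (- (kap e t * chi e t)).
Proof.
have h := is_derive_gap2De t.
have := @is_deriveV R (fun t => gap2 t + e) t _ 1 (lt0r_neq0 (gap2De_gt0 t e0)) h.
move=> H; apply: (is_derive_eq H).
rewrite /kap /chi /GRing.scale /= -exprVn; ring.
Qed.

Lemma is_derive_kap (t : R) : is_derive t 1 (kap e) (dkap e t).
Proof.
have h := is_derive_chi t.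
have h2 : is_derive t 1 ((2 \*: (@sin R)) * chi e)
    ((2 \*: (@sin R)) t *: - (kap e t * chi e t) + chi e t *: (2 *: cos t)).
  exact: is_deriveM.
apply: (is_derive_eq h2); rewrite /= /dkap /kap /GRing.scale /=; ring.
Qed.

Lemma is_derive_continuous (f f' : R -> R) :
  (forall t : R, is_derive t 1 f (f' t)) -> continuous f.
Proof.
move=> df t; apply: differentiable_continuous; apply/derivable1_diffP.
exact: (@ex_derive _ _ _ _ _ _ _ (df t)).
Qed.

Lemma continuous_lam : continuous (lam e).
Proof. exact: is_derive_continuous is_derive_lam. Qed.

Lemma continuous_chi : continuous (chi e).
Proof. exact: is_derive_continuous is_derive_chi. Qed.

Lemma continuous_kap : continuous (kap e).
Proof. exact: is_derive_continuous is_derive_kap. Qed.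

Lemma continuous_dkap : continuous (dkap e).
Proof.
move=> t; apply: cvgB.
  apply: cvgM; last exact: continuous_chi.
  by apply: cvgM; [exact: cvg_cst|exact: continuous_cos].
by apply: (@cvgM _ _ _ _ (kap e) (kap e)); exact: continuous_kap.
Qed.

End one_variable_derivatives.

(** * Calculus along coordinate lines *)

Section coordinatewise.
Context {R : realType} {n : nat}.
Implicit Types (f g df dg : ('I_n -> R) -> R) (x : 'I_n -> R).

(** The regularity that [integral_torus_derivative] asks of a derivative, packaged so that it passes
    through sums, products, exponentials and inverses. *)
Record nice f : Prop := Nice {
  nice_measurable :
    measurable_fun setT (fun th : n.-tuple (measurableTypeR R) => f (tnth th));
  nice_bounded : exists C, forall x, `|f x| <= C;
  nice_continuous : forall x i, continuous (fun t => f (upd x i t)) }.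

Definition partial i f df :=
  forall x (t : R), is_derive t 1 (fun t => f (upd x i t)) (df (upd x i t)).

Lemma nice_cst c : nice (fun=> c).
Proof.
split; [exact: measurable_cst| |by move=> x i; exact: cst_continuous].
by exists `|c|.
Qed.

Lemma niceD f g : nice f -> nice g -> nice (fun x => f x + g x).
Proof.
move=> [mf [C fC] cf] [mg [D gD] cg]; split.
- exact: measurable_funD.
- by exists (C + D) => x; rewrite (le_trans (ler_normD _ _)) // lerD.
- by move=> x i t; apply: cvgD; [exact: cf|exact: cg].
Qed.

Lemma niceM f g : nice f -> nice g -> nice (fun x => f x * g x).
Proof.
move=> [mf [C fC] cf] [mg [D gD] cg]; split.
- exact: measurable_funM.
- by exists (C * D) => x; rewrite normrM ler_pM.
- by move=> x i t; apply: cvgM; [exact: cf|exact: cg].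
Qed.

Lemma nice_sum (I : Type) (r : seq I) (P : pred I) (F : I -> ('I_n -> R) -> R) :
  (forall j, nice (F j)) -> nice (fun x => \sum_(j <- r | P j) F j x).
Proof.
move=> nF; elim: r => [|j r IH].
  by rewrite (_ : (fun _ => _) = fun=> 0); [exact: nice_cst|apply/funext => x; rewrite big_nil].
case Pj: (P j).
  rewrite (_ : (fun _ => _) = fun x => F j x + \sum_(j <- r | P j) F j x).
    exact: niceD.
  by apply/funext => x; rewrite big_cons Pj.
rewrite (_ : (fun _ => _) = fun x => \sum_(j <- r | P j) F j x) //.
by apply/funext => x; rewrite big_cons Pj.
Qed.

Lemma nice_expR f : nice f -> nice (fun x => expR (f x)).
Proof.
move=> [mf [C fC] cf]; split.
- exact: (measurableT_comp (@measurable_expR R) mf).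
- exists (expR C) => x; rewrite ger0_norm ?expR_ge0 // ler_expR.
  by rewrite (le_trans (ler_norm _)).
- move=> x i t; apply: continuous_comp; first exact: cf.
  exact: continuous_expR.
Qed.

Lemma nice_inv f s : 0 < s -> (forall x, s <= f x) -> nice f -> nice (fun x => (f x)^-1).
Proof.
move=> s0 fs [mf [C fC] cf]; split.
(* As [f] is positive, its inverse is [expR (- ln f)], a composition of measurable functions. *)
- rewrite (_ : (fun _ => _) =
    fun th : n.-tuple (measurableTypeR R) => expR (- ln (f (tnth th)))).
    apply: (measurableT_comp (@measurable_expR R)).
    apply: measurableT_comp => //.
    exact: (measurableT_comp (@measurable_ln R) mf).
  apply/funext => th; rewrite expRN lnK // posrE.
  exact: lt_le_trans (fs _).
- exists s^-1 => x; rewrite ger0_norm ?invr_ge0; last first.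
    by rewrite (le_trans (ltW s0)).
  by rewrite lef_pV2 ?posrE // (lt_le_trans s0).
- move=> x i t; apply: cvgV; last exact: cf.
  by rewrite gt_eqF // (lt_le_trans s0).
Qed.

Lemma continuous_upd x i j : continuous (fun t => upd x i t j).
Proof.
rewrite /upd; case: eqP => _; last exact: cst_continuous.
by move=> t; exact: cvg_id.
Qed.

Lemma nice_coord (phi : R -> R) C j :
  continuous phi -> (forall t, `|phi t| <= C) -> nice (fun x => phi (x j)).
Proof.
move=> cphi bphi; split.
- apply: (measurableT_comp (continuous_measurable_fun cphi)).
  exact: (@measurable_tnth _ (measurableTypeR R)).
- by exists C.
- by move=> x i t; apply: continuous_comp; [exact: continuous_upd|exact: cphi].
Qed.

Lemma nice_coordB (phi : R -> R) C j k :
  continuous phi -> (forall t, `|phi t| <= C) -> nice (fun x => phi (x j - x k)).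
Proof.
move=> cphi bphi; split.
- apply: (measurableT_comp (continuous_measurable_fun cphi)).
  apply: (@measurable_funB _ _ _ _ (fun th : n.-tuple (measurableTypeR R) => tnth th j : R) (fun th => tnth th k : R));
  exact: (@measurable_tnth _ (measurableTypeR R)).
- by exists C.
- move=> x i t; apply: (@continuous_comp _ _ _ (fun t => upd x i t j - upd x i t k) phi).
    by apply: cvgB; exact: continuous_upd.
  exact: cphi.
Qed.

Lemma partialD i f df g dg : partial i f df -> partial i g dg ->
  partial i (fun x => f x + g x) (fun x => df x + dg x).
Proof. by move=> hf hg x t; have := hf x t; have := hg x t; move=> *; exact: is_deriveD. Qed.

Lemma partialM i f df g dg : partial i f df -> partial i g dg ->
  partial i (fun x => f x * g x) (fun x => f x * dg x + g x * df x).
Proof. by move=> hf hg x t; have := hf x t; have := hg x t; move=> *; exact: is_deriveM. Qed.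

Lemma partial_cst i c : partial i (fun=> c) (fun=> 0).
Proof. by move=> x t; exact: is_derive_cst. Qed.

Lemma partialZ i c f df : partial i f df -> partial i (fun x => c * f x) (fun x => c * df x).
Proof.
move=> hf x t; have h := partialM (partial_cst i c) hf x t.
by apply: (is_derive_eq h); rewrite mulr0 addr0.
Qed.

Lemma partial_sum i (I : Type) (r : seq I) (P : pred I) (F dF : I -> ('I_n -> R) -> R) :
  (forall j, partial i (F j) (dF j)) ->
  partial i (fun x => \sum_(j <- r | P j) F j x) (fun x => \sum_(j <- r | P j) dF j x).
Proof.
move=> nF; elim: r => [|j r IH].
  rewrite (_ : (fun _ => _) = fun=> 0); last by apply/funext => x; rewrite big_nil.
  rewrite (_ : (fun x => \sum_(j <- [::] | P j) dF j x) = fun=> 0); last by apply/funext => x; rewrite big_nil.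
  exact: partial_cst.
case Pj: (P j).
  rewrite (_ : (fun _ => _) = fun x => F j x + \sum_(j <- r | P j) F j x); last first.
    by apply/funext => x; rewrite big_cons Pj.
  rewrite [X in partial _ _ X](_ : _ = fun x => dF j x + \sum_(j <- r | P j) dF j x); last first.
    by apply/funext => x; rewrite big_cons Pj.
  exact: partialD.
rewrite (_ : (fun _ => _) = fun x => \sum_(j <- r | P j) F j x); last first.
  by apply/funext => x; rewrite big_cons Pj.
rewrite [X in partial _ _ X](_ : _ = fun x => \sum_(j <- r | P j) dF j x) //.
by apply/funext => x; rewrite big_cons Pj.
Qed.

Lemma partial_comp i (phi dphi : R -> R) f df :
  (forall x t, is_derive (f (upd x i t)) 1 phi (dphi (f (upd x i t)))) -> partial i f df ->
  partial i (fun x => phi (f x)) (fun x => dphi (f x) * df x).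
Proof.
move=> hphi hf x t; have h := hf x t; have h2 := hphi x t.
exact: (@is_derive1_comp R phi (fun t => f (upd x i t)) t _ _ h2 h).
Qed.

Lemma partial_id i j : partial i (fun x => x j) (fun=> (j == i)%:R).
Proof.
move=> x t; rewrite /upd; case: eqP => _; first exact: is_derive_id.
exact: is_derive_cst.
Qed.

Lemma partial_coord i j (phi dphi : R -> R) :
  (forall t : R, is_derive t 1 phi (dphi t)) ->
  partial i (fun x => phi (x j)) (fun x => dphi (x j) * (j == i)%:R).
Proof. by move=> h; apply: partial_comp => //; exact: partial_id. Qed.

Lemma partial_coordB i j k (phi dphi : R -> R) :
  (forall t : R, is_derive t 1 phi (dphi t)) ->
  partial i (fun x => phi (x j - x k)) (fun x => dphi (x j - x k) * ((j == i)%:R - (k == i)%:R)).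
Proof.
move=> h.
apply: (@partial_comp i phi dphi (fun x => x j - x k) (fun=> (j == i)%:R - (k == i)%:R)) => // x t.
have h1 := @partial_id i j x t; have h2 := @partial_id i k x t.
exact: is_deriveB.
Qed.

End coordinatewise.

(** * Integration by parts against the regularized weight *)

Section regularized_loop_equation.
Context {R : realType} {n : nat}.
Variables (beta delta a b al ga s : R).
Implicit Types (e : R) (x : 'I_n -> R).

(** For [e = 0], [sum_chi] is [Q] and [sum_kap] is [T]. *)
Definition sum_chi e x := \sum_(j < n) chi e (x j).
Definition sum_kap e x := \sum_(j < n) kap e (x j).
Definition energy e x :=
  beta / 2 * (\sum_(k < n) \sum_(j < n | (j < k)%N) lam e (x j - x k))
  + delta * \sum_(j < n) lam e (x j).
(** The cutoff is [psi = s / level], which tends to 1 as [s] grows. The pair [(al, ga)] will be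
    [(2 delta, beta / 8)] for the upper bound on [Q], [(1, 1)] for the bound on [T^2], and [(1, 0)]
    for the lower bound. *)
Definition level e x := s + (al * sum_chi e x + ga * (sum_kap e x * sum_kap e x)).
(** The second term does not depend on [i]: it rotates the whole configuration. *)
Definition field e x i := a * kap e (x i) + b * sum_kap e x.

(* [sum_i d_i (X_i W) / W] for the weight [W = expR energy] and the vector
   field [X_i = s / level * field_i]. *)
Definition divergence e x :=
  s / level e x * (\sum_(i < n) (a + b) * dkap e (x i))
  - s / level e x ^+ 2 * (\sum_(i < n) field e x i *
      (2 * ga * sum_kap e x * dkap e (x i) - al * (kap e (x i) * chi e (x i))))
  + s / level e x *
      (beta / 2 * (\sum_(k < n) \sum_(j < n | (j < k)%N)
         a * ((kap e (x j) - kap e (x k)) * kap e (x j - x k)))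
       + delta * \sum_(i < n) field e x i * kap e (x i)).

Lemma sum_mul_delta (f : 'I_n -> R) i : \sum_(j < n) f j * (j == i)%:R = f i.
Proof.
rewrite (bigD1 i) //= eqxx mulr1 big1 ?addr0 // => j /negPf ->.
by rewrite mulr0.
Qed.

Lemma sum_mul_deltaV (f : 'I_n -> R) i : \sum_(j < n) f j * (i == j)%:R = f i.
Proof. by rewrite -[RHS]sum_mul_delta; apply: eq_bigr => j _; rewrite eq_sym. Qed.

Hypotheses (s0 : 0 < s) (al0 : 0 <= al) (ga0 : 0 <= ga).

Lemma level_ge e x : 0 <= e -> s <= level e x.
Proof.
move=> e0; rewrite lerDl addr_ge0 // mulr_ge0 //.
  by apply: sumr_ge0 => j _; exact: chi_ge0.
by rewrite -expr2 sqr_ge0.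
Qed.

Section fixed_eps.
Variables (e : R) (e0 : 0 < e).

(** Formal partial derivatives in direction [i]. They keep the shape that [partialD], [partialM],
    [partialZ] and [partial_comp] produce, including zero terms and Kronecker symbols; [sum_dflux]
    does the simplification. *)
Let dsum_kap (i : 'I_n) x : R := \sum_(j < n) dkap e (x j) * (j == i)%:R.
Let dsum_chi (i : 'I_n) x : R := \sum_(j < n) - (kap e (x j) * chi e (x j)) * (j == i)%:R.
Let denergy (i : 'I_n) x : R :=
  beta / 2 * (\sum_(k < n) \sum_(j < n | (j < k)%N)
     kap e (x j - x k) * ((j == i)%:R - (k == i)%:R))
  + delta * \sum_(j < n) kap e (x j) * (j == i)%:R.
Let dlevel (i : 'I_n) x : R := 0 + (al * dsum_chi i x
   + ga * (sum_kap e x * dsum_kap i x + sum_kap e x * dsum_kap i x)).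
Let dfield (i : 'I_n) x : R := a * (dkap e (x i) * (i == i)%:R) + b * dsum_kap i x.
Let flux (i : 'I_n) x : R := expR (energy e x) * (s * (level e x)^-1 * field e x i).
Let dflux (i : 'I_n) x : R :=
  expR (energy e x) * (s * (level e x)^-1 * dfield i x
     + field e x i * (s * (- (level e x)^-2 * dlevel i x)))
  + (s * (level e x)^-1 * field e x i) * (expR (energy e x) * denergy i x).

Let partial_flux i : partial i (flux i) (dflux i).
Proof.
have pT : partial i (sum_kap e) (dsum_kap i).
  by apply: partial_sum => j; apply: partial_coord => t; exact: is_derive_kap.
have pQ : partial i (sum_chi e) (dsum_chi i).
  apply: partial_sum => j.
  apply: (@partial_coord _ _ i j (chi e) (fun t => - (kap e t * chi e t))) => t.
  exact: is_derive_chi.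
have pH : partial i (energy e) (denergy i).
  apply: partialD; apply: partialZ.
    apply: partial_sum => k; apply: partial_sum => j.
    by apply: partial_coordB => t; exact: is_derive_lam.
  by apply: partial_sum => j; apply: partial_coord => t; exact: is_derive_lam.
apply: partialM.
  by apply: (@partial_comp _ _ i expR expR (energy e) (denergy i)) => // x t; exact: is_derive_expR.
apply: partialM; last first.
  apply: partialD; apply: partialZ => //.
  by apply: partial_coord => t; exact: is_derive_kap.
apply: partialZ.
apply: (@partial_comp _ _ i (fun y => y^-1) (fun y => - y ^- 2)); last first.
  apply: partialD; first exact: partial_cst.
  by apply: partialD; apply: partialZ => //; exact: partialM.
move=> x t.
have h := @is_derive_id R R (level e (upd x i t)) 1.
have l0 : level e (upd x i t) != 0.
  by rewrite gt_eqF // (lt_le_trans s0) // level_ge // ltW.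
have := @is_deriveV R id (level e (upd x i t)) 1 1 l0 h.
by move=> H; apply: (is_derive_eq H); rewrite /GRing.scale /= mulr1.
Qed.

Let nice_kap j : nice (fun x : 'I_n -> R => kap e (x j)).
Proof.
by apply: nice_coord; [exact: continuous_kap|move=> t; exact: abs_kap_le].
Qed.

Let nice_lamB j k : nice (fun x : 'I_n -> R => lam e (x j - x k)).
Proof.
by apply: nice_coordB; [exact: continuous_lam|move=> t; exact: abs_lam_le].
Qed.

Let nice_lam j : nice (fun x : 'I_n -> R => lam e (x j)).
Proof.
by apply: nice_coord; [exact: continuous_lam|move=> t; exact: abs_lam_le].
Qed.

Let abs_chi_le t : `|chi e t| <= e^-1.
Proof. by rewrite ger0_norm ?chi_ge0 ?(ltW e0) // chi_le. Qed.

Let nice_chi j : nice (fun x : 'I_n -> R => chi e (x j)).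
Proof. exact: nice_coord (continuous_chi e0) abs_chi_le. Qed.

Let nice_dkap j : nice (fun x : 'I_n -> R => dkap e (x j)).
Proof.
apply: (@nice_coord _ _ _ (6 * e^-1)); first exact: continuous_dkap.
move=> t; rewrite (le_trans (abs_dkap_le _ (ltW e0))) // ler_wpM2l //.
exact: chi_le.
Qed.

Let nice_kapB j k : nice (fun x : 'I_n -> R => kap e (x j - x k)).
Proof.
by apply: nice_coordB; [exact: continuous_kap|move=> t; exact: abs_kap_le].
Qed.

Lemma nice_sum_kap : nice (sum_kap e).
Proof. exact: nice_sum nice_kap. Qed.

Lemma nice_energy : nice (energy e).
Proof.
apply: niceD; apply: niceM; try exact: nice_cst.
  by apply: nice_sum => k; apply: nice_sum => j.
exact: nice_sum.
Qed.

Lemma nice_level_inv : nice (fun x => (level e x)^-1).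
Proof.
apply: (nice_inv s0); first by move=> x; apply: level_ge; exact: ltW.
apply: niceD; first exact: nice_cst.
apply: niceD; apply: niceM; try exact: nice_cst.
  exact: nice_sum.
by apply: niceM; exact: nice_sum_kap.
Qed.

Lemma nice_field i : nice (fun x => field e x i).
Proof.
apply: niceD; apply: niceM => //; try exact: nice_cst.
exact: nice_sum_kap.
Qed.

Let nice_opp (f : ('I_n -> R) -> R) : nice f -> nice (fun x => - f x).
Proof.
move=> nf; rewrite (_ : (fun _ => _) = fun x => -1 * f x).
  by apply: niceM => //; exact: nice_cst.
by apply/funext => x; rewrite mulN1r.
Qed.

Let nice_dflux i : nice (dflux i).
Proof.
have nL := nice_level_inv.
have nL2 : nice (fun x => (level e x)^-2).
  rewrite (_ : (fun _ => _) = fun x => (level e x)^-1 * (level e x)^-1).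
    exact: niceM.
  by apply/funext => x; rewrite -exprVn expr2.
have nH := nice_expR nice_energy.
have nT := nice_sum_kap.
have nX := nice_field i.
have ndT : nice (dsum_kap i).
  by apply: nice_sum => j; apply: niceM => //; exact: nice_cst.
have nsL : nice (fun x => s * (level e x)^-1) by apply: niceM => //; exact: nice_cst.
apply: niceD.
  apply: niceM => //; apply: niceD.
    apply: niceM => //; apply: niceD; apply: niceM => //; try exact: nice_cst.
    by apply: niceM => //; exact: nice_cst.
  apply: niceM => //; apply: niceM; first exact: nice_cst.
  apply: niceM; first exact: nice_opp.
  apply: niceD; first exact: nice_cst.
  apply: niceD; apply: niceM; try exact: nice_cst.
    apply: nice_sum => j; apply: niceM; last exact: nice_cst.
    by apply: nice_opp; apply: niceM.
  by apply: niceD; apply: niceM.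
apply: niceM; first exact: niceM.
apply: niceM => //; apply: niceD; apply: niceM; try exact: nice_cst.
  apply: nice_sum => k; apply: nice_sum => j; apply: niceM => //.
  exact: nice_cst.
by apply: nice_sum => j; apply: niceM => //; exact: nice_cst.
Qed.

Let sum_dflux x : \sum_(i < n) dflux i x = expR (energy e x) * divergence e x.
Proof.
pose L := level e x.
transitivity (expR (energy e x) *
  (s / L * (\sum_(i < n) dfield i x) - s / L ^+ 2 * (\sum_(i < n) field e x i * dlevel i x)
   + s / L * (\sum_(i < n) field e x i * denergy i x))).
  rewrite !mulr_sumr -sumrN -!big_split /= mulr_sumr; apply: eq_bigr => i _.
  by rewrite /dflux -/L; ring.
rewrite /divergence -/L.
congr (_ * (_ * _ - _ * _ + _ * _)).
- apply: eq_bigr => i _; rewrite /dfield eqxx mulr1 /dsum_kap sum_mul_delta.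
  by rewrite -mulrDl.
- apply: eq_bigr => i _.
  rewrite /dlevel /dsum_kap /dsum_chi !(sum_mul_delta (fun j => dkap e (x j))).
  by rewrite (sum_mul_delta (fun j => - (kap e (x j) * chi e (x j)))); ring.
- transitivity (\sum_(i < n) (beta / 2 * (field e x i * (\sum_(k < n) \sum_(j < n | (j < k)%N)
     kap e (x j - x k) * ((j == i)%:R - (k == i)%:R)))
     + delta * (field e x i * kap e (x i)))).
    apply: eq_bigr => i _; rewrite /denergy (sum_mul_delta (fun j => kap e (x j))); ring.
  rewrite big_split /= -!mulr_sumr; congr (_ * _ + _).
  transitivity (\sum_(i < n) \sum_(k < n) \sum_(j < n | (j < k)%N)
    kap e (x j - x k) * (field e x i * ((j == i)%:R) - field e x i * ((k == i)%:R))).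
    apply: eq_bigr => i _; rewrite mulr_sumr; apply: eq_bigr => k _.
    by rewrite mulr_sumr; apply: eq_bigr => j _; ring.
  rewrite exchange_big /=; apply: eq_bigr => k _.
  rewrite exchange_big /=; apply: eq_bigr => j _.
  (* Each pair retains the difference of [field] at [j] and at [k], from which the rotation term
     [b * sum_kap] drops out. *)
  rewrite -mulr_sumr sumrB !sum_mul_deltaV /field; ring.
Qed.

Lemma nice_divergence : nice (fun x => expR (energy e x) * divergence e x).
Proof.
rewrite (_ : (fun _ => _) = fun x => \sum_(i < n) dflux i x).
  exact: nice_sum.
by apply/funext => x; rewrite sum_dflux.
Qed.

Let kap_pi_eq : kap e pi = kap e (- pi).
Proof. by rewrite /kap /chi gap2N sinN sinpi oppr0. Qed.

Let lam_pi_eq : lam e pi = lam e (- pi).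
Proof. by rewrite /lam gap2N. Qed.

Let chi_pi_eq : chi e pi = chi e (- pi).
Proof. by rewrite /chi gap2N. Qed.

Let lamB_pi_eq x i j k :
  lam e (upd x i pi j - upd x i pi k) = lam e (upd x i (- pi) j - upd x i (- pi) k).
Proof.
have gp t : gap2 (t + pi) = gap2 (t - pi).
  by rewrite /gap2 cosD cosB cospi sinpi !mulr0 subr0 addr0.
have gp' u : gap2 (pi - u) = gap2 (- pi - u).
  by rewrite -gap2N opprB -gp -gap2N opprD addrC.
rewrite /lam /upd; case: eqP => _; case: eqP => _ //.
- by rewrite !subrr.
- by rewrite gp'.
- by rewrite opprK gp.
Qed.

Let upd_pi_eq (phi : R -> R) x i j : phi pi = phi (- pi) ->
  phi (upd x i pi j) = phi (upd x i (- pi) j).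
Proof. by move=> h; rewrite /upd; case: eqP. Qed.

Let flux_pi_eq i x : flux i (upd x i pi) = flux i (upd x i (- pi)).
Proof.
have hT : sum_kap e (upd x i pi) = sum_kap e (upd x i (- pi)).
  by apply: eq_bigr => j _; exact: upd_pi_eq.
have hQ : sum_chi e (upd x i pi) = sum_chi e (upd x i (- pi)).
  by apply: eq_bigr => j _; exact: upd_pi_eq.
have hl1 : \sum_(j < n) lam e (upd x i pi j) = \sum_(j < n) lam e (upd x i (- pi) j).
  by apply: eq_bigr => j _; exact: upd_pi_eq.
have hl2 : \sum_(k < n) \sum_(j < n | (j < k)%N) lam e (upd x i pi j - upd x i pi k) =
    \sum_(k < n) \sum_(j < n | (j < k)%N) lam e (upd x i (- pi) j - upd x i (- pi) k).
  by apply: eq_bigr => k _; apply: eq_bigr => j _; exact: lamB_pi_eq.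
by rewrite /flux /field /level /energy hT hQ hl1 hl2 (upd_pi_eq x i i kap_pi_eq).
Qed.

Lemma integral_divergence :
  (\int[lebesgue_tuple R n]_(th in torus (N:=n))
     (expR (energy e (tnth th)) * divergence e (tnth th))%:E = 0)%E.
Proof.
under eq_integral do rewrite -sum_dflux -sumEFin.
rewrite integral_sum //; first last.
- move=> i; have [m [C bC] _] := nice_dflux i.
  by apply: bounded_integrable_torus => //; exists C.
- exact: measurable_torus.
apply: big1 => i _.
have [m bd cc] := nice_dflux i.
apply: (@integral_torus_derivative _ _ i (flux i) (dflux i)).
- exact: m.
- exact: bd.
- by move=> x; exact: cc.
- exact: partial_flux.
- exact: flux_pi_eq.
Qed.

End fixed_eps.
End regularized_loop_equation.

(** * The weight as the limit of its regularizations *)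

Section weight.
Context {R : realType}.
Local Open Scope complex_scope.

Lemma cisE (t : R) : cis t = cos t +i* sin t.
Proof.
rewrite /cis /cexp /=.
by rewrite !(mul0r, mulr0, mul1r, add0r, addr0, sub0r, subr0, oppr0, expR0).
Qed.

Lemma cabsE (z : R[i]) : cabs z = Num.sqrt (complex.Re z ^+ 2 + complex.Im z ^+ 2).
Proof. by case: z. Qed.

Lemma cabs_cisB (s t : R) : cabs (cis s - cis t) = Num.sqrt (gap2 (s - t)).
Proof. by rewrite cabsE !cisE /= gap2B addrC. Qed.

Lemma cabs_1B_cis (t : R) : cabs (1 - cis t) = Num.sqrt (gap2 t).
Proof.
rewrite cabsE cisE /= add0r sqrrN.
by congr Num.sqrt; rewrite /gap2; have := cos2Dsin2 t; lra.
Qed.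

Lemma powR_sqrt (v p : R) : 0 <= v -> Num.sqrt v `^ p = v `^ (p / 2).
Proof. by move=> v0; rewrite -powR12_sqrt // -powRrM mulrC. Qed.

Lemma cj_weightE N (beta delta : R) (th : N.-tuple (measurableTypeR R)) :
  cj_weight beta delta th =
  (\prod_(k < N) \prod_(j < N | (j < k)%N) gap2 (tnth th j - tnth th k) `^ (beta / 2))
  * \prod_(j < N) gap2 (tnth th j) `^ delta.
Proof.
rewrite /cj_weight; congr (_ * _).
  apply: eq_bigr => k _; apply: eq_bigr => j _.
  by rewrite cabs_cisB powR_sqrt // gap2_ge0.
apply: eq_bigr => j _; rewrite cabs_1B_cis powR_sqrt ?gap2_ge0 //.
by rewrite mulrC mulKf.
Qed.

Lemma cj_weight_ge0 N (beta delta : R) (th : N.-tuple (measurableTypeR R)) :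
  0 <= cj_weight beta delta th.
Proof.
rewrite cj_weightE mulr_ge0 //.
  by apply: prodr_ge0 => k _; apply: prodr_ge0 => j _; exact: powR_ge0.
by apply: prodr_ge0 => j _; exact: powR_ge0.
Qed.

(** The weight itself detects configurations in general position. Integrands can therefore be
    compared pointwise where it is nonzero, without a null set of collisions. *)
Lemma cj_weight_neq0 N (beta delta : R) (th : N.-tuple (measurableTypeR R)) :
  0 < beta -> 0 < delta -> cj_weight beta delta th != 0 ->
  (forall j, gap2 (tnth th j : R) != 0) /\
  (forall j k : 'I_N, (j < k)%N -> gap2 (tnth th j - tnth th k : R) != 0).
Proof.
move=> b0 d0; rewrite cj_weightE mulf_eq0 negb_or => /andP[/prodf_neq0 h1 /prodf_neq0 h2].
split.
  by move=> j; have := h2 j isT; rewrite powR_eq0 negb_and => /orP[//|]; rewrite negbK gt_eqF.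
move=> j k jk; have := h1 k isT => /prodf_neq0 /(_ j jk).
rewrite powR_eq0 negb_and => /orP[//|]; rewrite negbK gt_eqF //.
by rewrite divr_gt0.
Qed.

Lemma expR_energy n (beta delta e : R) (x : 'I_n -> R) : 0 < e ->
  expR (energy beta delta e x) =
  (\prod_(k < n) \prod_(j < n | (j < k)%N) (gap2 (x j - x k) + e) `^ (beta / 2))
  * \prod_(j < n) (gap2 (x j) + e) `^ delta.
Proof.
move=> e0; rewrite /energy expRD; congr (_ * _).
  rewrite mulr_sumr expR_sum; apply: eq_bigr => k _.
  rewrite mulr_sumr expR_sum; apply: eq_bigr => j _.
  by rewrite /powR gt_eqF // gap2De_gt0.
rewrite mulr_sumr expR_sum; apply: eq_bigr => j _.
by rewrite /powR gt_eqF // gap2De_gt0.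
Qed.

Lemma cvg_bigprod (I : Type) (r : seq I) (P : pred I) (f : nat -> I -> R) (l : I -> R) :
  (forall i, P i -> f ^~ i @ \oo --> l i) ->
  (fun k => \prod_(i <- r | P i) f k i) @ \oo --> \prod_(i <- r | P i) l i.
Proof.
move=> h; elim: r => [|i r IH].
  by under eq_fun do rewrite big_nil; rewrite big_nil; exact: cvg_cst.
under eq_fun do rewrite big_cons; rewrite big_cons.
by case Pi: (P i) => //; apply: cvgM => //; exact: h.
Qed.

Lemma cvg_bigsum (I : Type) (r : seq I) (P : pred I) (f : nat -> I -> R) (l : I -> R) :
  (forall i, P i -> f ^~ i @ \oo --> l i) ->
  (fun k => \sum_(i <- r | P i) f k i) @ \oo --> \sum_(i <- r | P i) l i.
Proof.
move=> h; elim: r => [|i r IH].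
  by under eq_fun do rewrite big_nil; rewrite big_nil; exact: cvg_cst.
under eq_fun do rewrite big_cons; rewrite big_cons.
by case Pi: (P i) => //; apply: cvgD => //; exact: h.
Qed.

Lemma cvgD_harmonic (v : R) : (fun k => v + harmonic k) @ \oo --> v.
Proof.
by rewrite -[X in _ --> X]addr0; apply: cvgD; [exact: cvg_cst|exact: cvg_harmonic].
Qed.

Lemma cvg_powR_harmonic (v p : R) : 0 <= v -> 0 < p ->
  (fun k => (v + harmonic k) `^ p) @ \oo --> v `^ p.
Proof.
move=> v0 p0; have [->|vn0] := eqVneq v 0.
  rewrite powR0 ?gt_eqF //.
  apply: (@cvg_comp _ _ _ (fun k => 0 + harmonic k) (fun a => a `^ p) \oo (0^'+)); last exact: powR_cvg0.
  move=> A /= nA; have h := @cvgD_harmonic 0 _ nA.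
  apply: (@filterS _ \oo _ _ _ _ h) => k; apply.
  by rewrite /= ltr_wpDl // invr_gt0.
have {v0 vn0} v0 : 0 < v by rewrite lt_neqAle eq_sym vn0.
have -> : (fun k => (v + harmonic k) `^ p) = (fun k => expR (p * ln (v + harmonic k))).
  by apply/funext => k; rewrite /powR gt_eqF // ltr_wpDr // harmonic_ge0.
rewrite /powR gt_eqF //.
apply: (@cvg_comp _ _ _ (fun k => p * ln (v + harmonic k)) expR \oo (nbhs (p * ln v))); last exact: continuous_expR.
apply: cvgM; first exact: cvg_cst.
by apply: (@cvg_comp _ _ _ (fun k => v + harmonic k) (@ln R) \oo (nbhs v)); [exact: cvgD_harmonic|exact: continuous_ln].
Qed.

Lemma cvg_expR_energy N (beta delta : R) (th : N.-tuple (measurableTypeR R)) :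
  0 < beta -> 0 < delta ->
  (fun k => expR (energy beta delta (harmonic k) (tnth th))) @ \oo --> cj_weight beta delta th.
Proof.
move=> b0 d0; rewrite cj_weightE.
under eq_fun do rewrite (expR_energy _ _ _ (harmonic_gt0 _)).
apply: cvgM.
  apply: cvg_bigprod => k _; apply: cvg_bigprod => j _.
  by apply: cvg_powR_harmonic; rewrite ?gap2_ge0 ?divr_gt0.
by apply: cvg_bigprod => j _; apply: cvg_powR_harmonic; rewrite ?gap2_ge0.
Qed.

Lemma expR_energy_le n (beta delta e : R) (x : 'I_n -> R) : 0 < e -> e <= 1 ->
  0 < beta -> 0 < delta ->
  expR (energy beta delta e x) <=
  expR (beta / 2 * (\sum_(k < n) \sum_(j < n | (j < k)%N) ln 5) + delta * \sum_(j < n) ln 5).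
Proof.
move=> e0 e1 b0 d0; rewrite ler_expR.
(* [gap2 <= 4] and [e <= 1]. *)
have h t : lam e t <= ln 5.
  rewrite ler_ln ?posrE ?gap2De_gt0 //; have := gap2_le4 t; lra.
apply: lerD; apply: ler_wpM2l; rewrite ?divr_ge0 ?(ltW b0) ?(ltW d0) //.
  by apply: ler_sum => k _; apply: ler_sum.
by apply: ler_sum.
Qed.

End weight.

(** * The loop equation *)

Lemma sum_lt_pairs (R : numDomainType) n (f : 'I_n -> 'I_n -> R) :
  (forall j k, f j k = f k j) ->
  \sum_(k < n) \sum_(j < n) f j k =
  2 * (\sum_(k < n) \sum_(j < n | (j < k)%N) f j k) + \sum_(k < n) f k k.
Proof.
move=> fC.
have h k : \sum_(j < n) f j k = \sum_(j < n | (j < k)%N) f j k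
    + (f k k + \sum_(j < n | (k < j)%N) f j k).
  rewrite (bigID (fun j : 'I_n => (j < k)%N)) /=; congr (_ + _).
  rewrite (bigD1 k) /= ?ltnn //; congr (_ + _); apply: eq_bigl => j.
  by rewrite -leqNgt ltn_neqAle andbC eq_sym.
under eq_bigr do rewrite h.
rewrite !big_split /=.
have -> : \sum_(k < n) \sum_(j < n | (k < j)%N) f j k =
    \sum_(k < n) \sum_(j < n | (j < k)%N) f j k.
  by rewrite (exchange_big_dep xpredT) //=; apply: eq_bigr => k _; apply: eq_bigr.
ring.
Qed.

Lemma ler_norm_sum_cst (R : numDomainType) n (P : pred 'I_n) (f : 'I_n -> R) c :
  0 <= c -> (forall i, `|f i| <= c) -> `|\sum_(i < n | P i) f i| <= n%:R * c.
Proof.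
move=> c0 fc; apply: (le_trans (ler_norm_sum _ _ _)).
apply: (@le_trans _ _ (\sum_(i < n | P i) c)); first by apply: ler_sum.
rewrite big_mkcond /= -[X in X%:R * _]card_ord mulr_natl -sumr_const.
by apply: ler_sum => i _; case: ifP.
Qed.

Section loop_equation.
Context {R : realType} {n : nat}.
Variables (beta delta a b al ga s : R).
Hypotheses (beta0 : 0 < beta) (delta0 : 0 < delta).
Hypotheses (s0 : 0 < s) (al0 : 0 < al) (ga0 : 0 <= ga).
Implicit Types (x : 'I_n -> R).

Local Notation div := (divergence beta delta a b al ga s).

(** A count of degrees in [r = sqrt (sum_chi e x)]: [kap] has degree 1, while [chi], [dkap] and, by
    [sqr_kap_pair_le], the pair terms have degree 2. The three sums of [divergence] have degrees 2,
    4 and 2, which the factors [s / level] and [s / level ^+ 2] compensate since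
    [level >= al * r ^+ 2]. All constants are free of [e]. *)
Lemma divergence_bounded : exists2 C : R, 0 <= C &
  forall (e : R) x, 0 < e -> `|div e x| <= C.
Proof.
pose K := 2 * (`|a| + `|b| * n%:R).
have K0 : 0 <= K by rewrite mulr_ge0 // addr_ge0 // mulr_ge0.
pose C1 := n%:R * (`|a + b| * 6).
pose C2 := n%:R * (K * (24 * ga * n%:R + 2 * al)).
pose C3 := `|beta / 2| * (n%:R * (n%:R * (8 * `|a|))) + `|delta| * (n%:R * (2 * K)).
have C10 : 0 <= C1 by rewrite !mulr_ge0.
have C20 : 0 <= C2 by rewrite !mulr_ge0 // addr_ge0 ?mulr_ge0 ?(ltW al0).
have C30 : 0 <= C3 by rewrite addr_ge0 // !mulr_ge0.
exists (s / al * C1 + s / al ^+ 2 * C2 + s / al * C3).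
  by rewrite !addr_ge0 // mulr_ge0 // divr_ge0 ?exprn_ge0 ?(ltW s0) ?(ltW al0).
move=> e x e0.
have Q0 : 0 <= sum_chi e x by apply: sumr_ge0 => j _; exact/chi_ge0/ltW.
pose r := Num.sqrt (sum_chi e x).
have r0 : 0 <= r by exact: sqrtr_ge0.
have r2 : r ^+ 2 = sum_chi e x by exact: sqr_sqrtr.
have hchi j : chi e (x j) <= r ^+ 2.
  rewrite r2 /sum_chi (bigD1 j) //= lerDl; apply: sumr_ge0 => i _.
  exact/chi_ge0/ltW.
have hchi0 j : 0 <= chi e (x j) by exact/chi_ge0/ltW.
have hkap j : `|kap e (x j)| <= 2 * r.
  rewrite -(@ler_pXn2r _ 2) ?nnegrE ?mulr_ge0 // real_normK ?num_real //.
  rewrite (le_trans (sqr_kap_le _ (ltW e0))) // exprMn.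
  by have := hchi j; lra.
have hT : `|sum_kap e x| <= n%:R * (2 * r).
  by apply: ler_norm_sum_cst => //; rewrite mulr_ge0.
have hdkap j : `|dkap e (x j)| <= 6 * r ^+ 2.
  by rewrite (le_trans (abs_dkap_le _ (ltW e0))) // ler_pM2l.
have hfield i : `|field a b e x i| <= K * r.
  rewrite (le_trans (ler_normD _ _)) // (normrM a) (normrM b).
  have -> : K * r = `|a| * (2 * r) + `|b| * (n%:R * (2 * r)) by rewrite /K; ring.
  by apply: lerD; rewrite ler_wpM2l // hkap.
have hpair j k : `|(kap e (x j) - kap e (x k)) * kap e (x j - x k)| <= 8 * r ^+ 2.
  rewrite -(@ler_pXn2r _ 2) ?nnegrE ?mulr_ge0 ?exprn_ge0 // real_normK ?num_real //.
  rewrite (le_trans (sqr_kap_pair_le _ _ e0)) //.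
  have -> : (8 * r ^+ 2) ^+ 2 = 64 * (r ^+ 2 * r ^+ 2) by ring.
  by rewrite ler_pM2l // ler_pM.
have L0 : 0 < level al ga s e x by rewrite (lt_le_trans s0) // level_ge // ltW.
have Lr : al * r ^+ 2 <= level al ga s e x.
  rewrite r2 /level; have : 0 <= ga * (sum_kap e x * sum_kap e x).
    by rewrite mulr_ge0 // -expr2 sqr_ge0.
  by move: s0; lra.
have u1 : s / level al ga s e x * r ^+ 2 <= s / al.
  by rewrite -mulrA ler_pM2l // ler_pdivrMl // ler_pdivlMr // mulrC.
have u0 : 0 <= s / level al ga s e x * r ^+ 2 by rewrite mulr_ge0 ?exprn_ge0 // divr_ge0 // ltW.
have w1 : s / level al ga s e x ^+ 2 * (r ^+ 2 * r ^+ 2) <= s / al ^+ 2.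
  rewrite -mulrA ler_pM2l // ler_pdivrMl ?exprn_gt0 // ler_pdivlMr ?exprn_gt0 //.
  have -> : r ^+ 2 * r ^+ 2 * al ^+ 2 = (al * r ^+ 2) ^+ 2 by ring.
  by rewrite ler_pXn2r // nnegrE ?mulr_ge0 ?exprn_ge0 // ltW.
have sL0 : 0 <= s / level al ga s e x by rewrite divr_ge0 // ltW.
have sL20 : 0 <= s / level al ga s e x ^+ 2 by rewrite divr_ge0 ?exprn_ge0 // ltW.
rewrite /divergence.
set A1 := \sum_(i < n) (a + b) * _; set A2 := \sum_(i < n) _ * (_ - _); set A3 := beta / 2 * _ + _.
have h1 : `|A1| <= C1 * r ^+ 2.
  have -> : C1 * r ^+ 2 = n%:R * (`|a + b| * (6 * r ^+ 2)) by rewrite /C1; ring.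
  apply: ler_norm_sum_cst; first by rewrite !mulr_ge0 ?exprn_ge0.
  by move=> i; rewrite (normrM (a + b)) ler_wpM2l.
have h2 : `|A2| <= C2 * (r ^+ 2 * r ^+ 2).
  have -> : C2 * (r ^+ 2 * r ^+ 2) =
     n%:R * (K * r * (2 * ga * (n%:R * (2 * r)) * (6 * r ^+ 2) + al * (2 * r * r ^+ 2))).
    by rewrite /C2; ring.
  apply: ler_norm_sum_cst.
    by rewrite !(mulr_ge0, addr_ge0) ?exprn_ge0 // ltW.
  move=> i; rewrite (normrM (field _ _ _ _ _)) ler_pM //.
  rewrite (le_trans (ler_normB _ _)) // lerD //.
    rewrite (normrM _ (dkap _ _)) (normrM _ (sum_kap _ _)) normrM (ger0_norm ga0) ger0_norm //.
    rewrite ler_pM // ?mulr_ge0 //.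
    by rewrite ler_wpM2l // mulr_ge0.
  rewrite (normrM al) (gtr0_norm al0) ler_pM2l // (normrM (kap _ _)) (ger0_norm (hchi0 i)).
  by rewrite ler_pM.
have h3 : `|A3| <= C3 * r ^+ 2.
  have -> : C3 * r ^+ 2 = `|beta / 2| * (n%:R * (n%:R * (`|a| * (8 * r ^+ 2))))
      + `|delta| * (n%:R * ((K * r) * (2 * r))) by rewrite /C3; ring.
  rewrite (le_trans (ler_normD _ _)) // (normrM (beta / 2)) (normrM delta) lerD //.
    rewrite ler_wpM2l //.
    apply: ler_norm_sum_cst; first by rewrite !mulr_ge0 ?exprn_ge0.
    move=> k; apply: ler_norm_sum_cst; first by rewrite !mulr_ge0 ?exprn_ge0.
    by move=> j; rewrite (normrM a) ler_wpM2l.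
  rewrite ler_wpM2l //; apply: ler_norm_sum_cst; first by rewrite !mulr_ge0.
  by move=> i; rewrite (normrM (field _ _ _ _ _)) ler_pM.
rewrite (le_trans (ler_normD _ _)) // lerD //; last first.
  rewrite normrM (ger0_norm sL0).
  apply: (le_trans (ler_wpM2l sL0 h3)).
  have -> : s / level al ga s e x * (C3 * r ^+ 2) = (s / level al ga s e x * r ^+ 2) * C3 by ring.
  exact: ler_wpM2r.
rewrite (le_trans (ler_normB _ _)) // lerD //.
  rewrite normrM (ger0_norm sL0).
  apply: (le_trans (ler_wpM2l sL0 h1)).
  have -> : s / level al ga s e x * (C1 * r ^+ 2) = (s / level al ga s e x * r ^+ 2) * C1 by ring.
  exact: ler_wpM2r.
rewrite normrM (ger0_norm sL20).
apply: (le_trans (ler_wpM2l sL20 h2)).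
have -> : s / level al ga s e x ^+ 2 * (C2 * (r ^+ 2 * r ^+ 2)) =
  (s / level al ga s e x ^+ 2 * (r ^+ 2 * r ^+ 2)) * C2 by ring.
exact: ler_wpM2r.
Qed.

Lemma cvg_divergence x : (forall j, gap2 (x j) != 0) ->
  (forall j k : 'I_n, (j < k)%N -> gap2 (x j - x k) != 0) ->
  (fun k => div (harmonic k) x) @ \oo --> div 0 x.
Proof.
move=> hx hxx.
have cchi t : gap2 t != 0 -> (fun k => chi (harmonic k) t) @ \oo --> chi 0 t.
  by move=> t0; apply: cvgV; rewrite ?addr0 //; exact: cvgD_harmonic.
have ckap t : gap2 t != 0 -> (fun k => kap (harmonic k) t) @ \oo --> kap 0 t.
  by move=> t0; apply: cvgM; [exact: cvg_cst|exact: cchi].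
have cdkap t : gap2 t != 0 -> (fun k => dkap (harmonic k) t) @ \oo --> dkap 0 t.
  move=> t0; apply: cvgB; first by apply: cvgM; [exact: cvg_cst|exact: cchi].
  rewrite expr2; under eq_fun do rewrite expr2.
  by apply: cvgM; exact: ckap.
have cT : (fun k => sum_kap (harmonic k) x) @ \oo --> sum_kap 0 x.
  by apply: cvg_bigsum => j _; exact: ckap.
have cX i : (fun k => field a b (harmonic k) x i) @ \oo --> field a b 0 x i.
  by apply: cvgD; apply: cvgM; try exact: cvg_cst; [exact: ckap|exact: cT].
have cL : (fun k => level al ga s (harmonic k) x) @ \oo --> level al ga s 0 x.
  apply: cvgD; first exact: cvg_cst.
  apply: cvgD; apply: cvgM; try exact: cvg_cst.
    by apply: cvg_bigsum => j _; exact: cchi.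
  exact: cvgM.
have L0 : level al ga s 0 x != 0.
  by rewrite gt_eqF // (lt_le_trans s0) // level_ge // ltW.
have csL : (fun k => s / level al ga s (harmonic k) x) @ \oo --> s / level al ga s 0 x.
  by apply: cvgM; [exact: cvg_cst|exact: cvgV].
apply: cvgD.
  apply: cvgB.
    apply: cvgM => //; apply: cvg_bigsum => i _.
    by apply: cvgM; [exact: cvg_cst|exact: cdkap].
  apply: cvgM.
    apply: cvgM; first exact: cvg_cst.
    apply: cvgV; first by rewrite expf_neq0.
    by rewrite expr2; under eq_fun do rewrite expr2; apply: cvgM.
  apply: cvg_bigsum => i _; apply: cvgM => //; apply: cvgB.
    apply: cvgM; last exact: cdkap.
    by apply: cvgM => //; exact: cvg_cst.
  apply: cvgM; first exact: cvg_cst.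
  by apply: cvgM; [exact: ckap|exact: cchi].
apply: cvgM => //; apply: cvgD; apply: cvgM; try exact: cvg_cst.
  apply: cvg_bigsum => k _; apply: cvg_bigsum => j jk.
  apply: cvgM; first exact: cvg_cst.
  apply: cvgM; last by apply: ckap; exact: hxx.
  by apply: cvgB; exact: ckap.
by apply: cvg_bigsum => i _; apply: cvgM => //; exact: ckap.
Qed.

Lemma divergence0E x : (forall j, gap2 (x j) != 0) ->
  (forall j k : 'I_n, (j < k)%N -> gap2 (x j - x k) != 0) ->
  div 0 x = s / level al ga s 0 x *
    (a * ((4 * delta - 2 + beta) * sum_chi 0 x - delta * n%:R
          - beta / 4 * (n%:R ^+ 2 + sum_kap 0 x ^+ 2))
     + b * (delta * sum_kap 0 x ^+ 2 - 2 * sum_chi 0 x))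
  + s / level al ga s 0 x ^+ 2 * \sum_(i < n)
      field a b 0 x i * (al * kap 0 (x i) + 4 * ga * sum_kap 0 x) * chi 0 (x i).
Proof.
move=> hx hxx; rewrite /divergence.
set L := level _ _ _ _ _.
have dk j : dkap 0 (x j) = - 2 * chi 0 (x j) by exact: dkap0.
have k2 : \sum_(i < n) kap 0 (x i) ^+ 2 = 4 * sum_chi 0 x - n%:R.
  under eq_bigr do rewrite sqr_kap0 //.
  by rewrite sumrB -mulr_sumr sumr_const card_ord.
have -> : \sum_(i < n) (a + b) * dkap 0 (x i) = - (2 * (a + b) * sum_chi 0 x).
  by rewrite /sum_chi mulr_sumr -sumrN; apply: eq_bigr => i _; rewrite dk; ring.
have -> : \sum_(i < n) field a b 0 x i *
      (2 * ga * sum_kap 0 x * dkap 0 (x i) - al * (kap 0 (x i) * chi 0 (x i))) =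
   - \sum_(i < n) field a b 0 x i * (al * kap 0 (x i) + 4 * ga * sum_kap 0 x) * chi 0 (x i).
  by rewrite -sumrN; apply: eq_bigr => i _; rewrite dk; ring.
(* By [kap0_pair] the pair terms are [- a (1 + kap_j kap_k)]. The full double sum of
   [1 + kap_j kap_k] is [n^2 + T^2], its diagonal is [4 Q], and the pairs [j < k] make up half of
   the difference. *)
have -> : \sum_(k < n) \sum_(j < n | (j < k)%N)
    a * ((kap 0 (x j) - kap 0 (x k)) * kap 0 (x j - x k)) =
    - a / 2 * (n%:R ^+ 2 + sum_kap 0 x ^+ 2 - 4 * sum_chi 0 x).
  transitivity (\sum_(k < n) \sum_(j < n | (j < k)%N) (- a) * (1 + kap 0 (x j) * kap 0 (x k))).
    apply: eq_bigr => k _; apply: eq_bigr => j jk.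
    by rewrite kap0_pair // ?hxx // mulrN mulNr.
  under eq_bigr do rewrite -mulr_sumr.
  rewrite -mulr_sumr.
  have fC j k : 1 + kap 0 (x j) * kap 0 (x k) = 1 + kap 0 (x k) * kap 0 (x j).
    by rewrite mulrC.
  have := sum_lt_pairs fC.
  have -> : \sum_(k < n) \sum_(j < n) (1 + kap 0 (x j) * kap 0 (x k)) =
      n%:R ^+ 2 + sum_kap 0 x ^+ 2.
    transitivity (\sum_(k < n) (n%:R + sum_kap 0 x * kap 0 (x k))).
      apply: eq_bigr => k _; rewrite big_split /= sumr_const card_ord.
      by rewrite -mulr_suml.
    by rewrite big_split /= -mulr_sumr sumr_const card_ord -[n%:R *+ n]mulr_natr -!expr2.
  rewrite big_split /= sumr_const card_ord.
  under [X in _ = _ + (_ + X)]eq_bigr do rewrite -expr2.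
  rewrite k2; move: (\sum_(k < n) _) => S h.
  have -> : S = (n%:R ^+ 2 + sum_kap 0 x ^+ 2 - 4 * sum_chi 0 x) / 2 by lra.
  by rewrite mulrA mulrAC.
have -> : \sum_(i < n) field a b 0 x i * kap 0 (x i) =
    a * (4 * sum_chi 0 x - n%:R) + b * sum_kap 0 x ^+ 2.
  rewrite -k2 mulr_sumr expr2 [X in _ = _ + b * (X * _)]/sum_kap.
  rewrite mulr_suml mulr_sumr -big_split; apply: eq_bigr => i _ /=.
  by rewrite /field; ring.
move: (\sum_(i < n) _) => S; field.
by rewrite gt_eqF // (lt_le_trans s0) // level_ge // ltW.
Qed.

(* Where the weight vanishes the regularized integrand tends to 0, since
   [divergence] is bounded uniformly in [e]; elsewhere all the gaps are
   positive and [divergence] itself converges. *)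
Lemma loop_equation :
  (lebesgue_tuple R n).-integrable (torus (N:=n))
    (fun th => (cj_weight beta delta th * div 0 (tnth th))%:E) /\
  (\int[lebesgue_tuple R n]_(th in torus (N:=n))
     (cj_weight beta delta th * div 0 (tnth th))%:E = 0)%E.
Proof.
have [C C0 hC] := divergence_bounded.
pose W k (th : n.-tuple (measurableTypeR R)) := expR (energy beta delta (harmonic k) (tnth th)).
pose M := expR (beta / 2 * (\sum_(k < n) \sum_(j < n | (j < k)%N) ln 5) + delta * \sum_(j < n) ln 5).
have hn k := @nice_divergence R n beta delta a b al ga s s0 (ltW al0) ga0 _ (harmonic_gt0 k).
have W0 k th : 0 <= W k th by exact: expR_ge0.
have WM k th : W k th <= M.
  apply: expR_energy_le => //; first exact: harmonic_gt0.
  by rewrite /= invf_le1 // ler1n.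
have cvgW th : (fun k => W k th * div (harmonic k) (tnth th)) @ \oo -->
    cj_weight beta delta th * div 0 (tnth th).
  have cW := @cvg_expR_energy R n beta delta th beta0 delta0.
  have [w0|/(cj_weight_neq0 beta0 delta0)[h1 h2]] := eqVneq (cj_weight beta delta th) 0.
    rewrite w0 mul0r; apply/norm_cvg0P.
    apply: (@squeeze_cvgr _ _ _ _ (fun=> 0) (fun k => W k th * C)); last 2 first.
      exact: cvg_cst.
      by rewrite -[X in _ --> X](mul0r C); apply: cvgM; [rewrite -w0|exact: cvg_cst].
    near=> k; rewrite normr_ge0 /= normrM ger0_norm ?expR_ge0 //.
    by rewrite ler_wpM2l ?expR_ge0 // hC // harmonic_gt0.
  by apply: cvgM => //; exact: cvg_divergence.
have mf k : measurable_fun (torus (N:=n))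
    (fun th : n.-tuple (measurableTypeR R) => (W k th * div (harmonic k) (tnth th))%:E).
  by apply/measurable_EFinP/measurable_funTS; case: (hn k).
have cvgE th : (fun k => (W k th * div (harmonic k) (tnth th))%:E) @ \oo -->
    (cj_weight beta delta th * div 0 (tnth th))%:E.
  by apply: cvg_EFin; [exact: nearW|exact: cvgW].
have mtor := @measurable_torus R n.
have bound k th : (`|(W k th * div (harmonic k) (tnth th))%:E| <= (M * C)%:E)%E.
  rewrite lee_fin normrM ger0_norm ?W0 // ler_pM ?W0 ?WM //.
  exact/hC/harmonic_gt0.
have ig : (lebesgue_tuple R n).-integrable (torus (N:=n)) (cst (M * C)%:E).
  by apply: (@bounded_integrable_torus _ _ (cst (M * C))) => //; exists `|M * C|.
have mlim : measurable_fun (torus (N:=n))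
    (fun th => (cj_weight beta delta th * div 0 (tnth th))%:E).
  apply: (emeasurable_fun_cvg
    (fun k th => (W k th * div (harmonic k) (tnth th))%:E)).
    exact: mf.
  by move=> th _; exact: cvgE.
have [idiv _] := @dominated_convergence _ _ _ (lebesgue_tuple R n) _ mtor
  (fun k th => (W k th * div (harmonic k) (tnth th))%:E)
  (fun th => (cj_weight beta delta th * div 0 (tnth th))%:E)
  (cst (M * C)%:E) mf
  mlim
  (aeW _ (fun th _ => cvgE th)) ig
  (aeW _ (fun th k _ => bound k th)).
rewrite [X in X @ \oo --> _](_ : _ = cst 0%E); last first.
  by apply/funext => k; exact: (integral_divergence beta delta a b s0 (ltW al0) ga0 (harmonic_gt0 k)).
by move=> h; split => //; apply: (cvg_unique _ h) => //; exact: cvg_cst.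
Unshelve. all: by end_near. Qed.

End loop_equation.

(** * Moment bounds for the circular Jacobi ensemble *)

Section fatou.
Local Open Scope ereal_scope.

Lemma limn_einf_le (R : realType) (u : (\bar R)^nat) c : (forall k, u k <= c) -> limn_einf u <= c.
Proof.
move=> uc; rewrite limn_einf_lim; apply: lime_le; first exact: is_cvg_einfs.
apply: nearW => k; rewrite (le_trans _ (uc k)) //.
by apply: ereal_inf_lbound; exists k => /=.
Qed.

(** Fatou's lemma in the form that removes a cutoff from a uniform upper bound. *)
Lemma integral_cvg_le d (T : measurableType d) (R : realType)
    (mu : {measure set T -> \bar R}) (D : set T) (f_ : nat -> T -> \bar R)
    (f : T -> \bar R) c : measurable D ->
  (forall k, measurable_fun D (f_ k)) -> (forall k x, D x -> 0 <= f_ k x) ->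
  (forall x, D x -> f_ ^~ x @ \oo --> f x) ->
  (forall k, \int[mu]_(x in D) f_ k x <= c) -> \int[mu]_(x in D) f x <= c.
Proof.
move=> mD mf f0 ff fc.
rewrite (eq_integral (fun x => limn_einf (f_ ^~ x))); last first.
  by move=> x /set_mem Dx; rewrite (cvg_limn_einf_sup (ff x Dx)).
apply: (le_trans (fatou _ mD mf f0)).
exact: limn_einf_le.
Qed.

End fatou.

Section cj_integral.
Context {R : realType} {n : nat}.
Variables (beta delta : R).
Hypotheses (beta0 : 0 < beta) (delta0 : 0 < delta).
Local Notation tuple := (n.-tuple (measurableTypeR R)).
Implicit Types (f g : tuple -> R) (th : tuple).

Definition cj_integrable f : Prop :=
  (lebesgue_tuple R n).-integrable (torus (N:=n)) (EFin \o (fun th => f th * cj_weight beta delta th)).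

(** Left unnormalized: the total mass [cj_integral (fun=> 1)] is carried along and divided out only
    in [cj_expectation]. *)
Definition cj_integral f : R :=
  \int[lebesgue_tuple R n]_(th in torus (N:=n)) (f th * cj_weight beta delta th).

Lemma measurable_coord (phi : R -> R) j : measurable_fun setT phi ->
  measurable_fun setT (fun th => phi (tnth th j)).
Proof.
by move=> mphi; apply: (measurableT_comp mphi); exact: (@measurable_tnth _ (measurableTypeR R)).
Qed.

Lemma measurable_coordB (phi : R -> R) j k : measurable_fun setT phi ->
  measurable_fun setT (fun th => phi (tnth th j - tnth th k)).
Proof.
move=> mphi; apply: (measurableT_comp mphi).
by apply: (@measurable_funB _ _ _ _ (fun th => tnth th j : R) (fun th => tnth th k : R));
  exact: (@measurable_tnth _ (measurableTypeR R)).
Qed.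

Lemma measurable_gap2 : measurable_fun setT (@gap2 R).
Proof.
apply: measurable_funB => //; apply: measurable_funM => //.
by apply: continuous_measurable_fun; exact: continuous_cos.
Qed.

Lemma measurable_chi0 : measurable_fun setT (@chi R 0).
Proof.
rewrite (_ : chi 0 = fun t => gap2 t `^ (-1)).
  exact: (measurableT_comp (measurable_powR _) measurable_gap2).
by apply/funext => t; rewrite powR_inv1 ?gap2_ge0 // /chi addr0.
Qed.

Lemma measurable_kap0 : measurable_fun setT (@kap R 0).
Proof.
apply: measurable_funM; last exact: measurable_chi0.
apply: measurable_funM => //.
by apply: continuous_measurable_fun; exact: continuous_sin.
Qed.

Lemma measurable_sum_chi : measurable_fun setT (fun th => sum_chi 0 (tnth th)).
Proof. by apply: measurable_sum => j; apply: measurable_coord; exact: measurable_chi0. Qed.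

Lemma measurable_sum_kap : measurable_fun setT (fun th => sum_kap 0 (tnth th)).
Proof. by apply: measurable_sum => j; apply: measurable_coord; exact: measurable_kap0. Qed.

Lemma measurable_cj_weight : measurable_fun setT (fun th => cj_weight beta delta th).
Proof.
under eq_fun do rewrite cj_weightE.
have mpow p : measurable_fun setT (fun t : R => gap2 t `^ p).
  exact: (measurableT_comp (measurable_powR _) measurable_gap2).
apply: measurable_funM.
  apply: measurable_prod => k _.
  under eq_fun do rewrite -big_filter.
  apply: measurable_prod => j _; exact: (@measurable_coordB (fun t => gap2 t `^ _)).
by apply: measurable_prod => j _; exact: (@measurable_coord (fun t => gap2 t `^ _)).
Qed.

Lemma cj_weight_bounded : exists2 M : R, 0 <= M & forall th, cj_weight beta delta th <= M.
Proof.
eexists; last first.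
  move=> th; have := @cvg_expR_energy R n beta delta th beta0 delta0.
  apply: (@closed_cvg _ _ _ _ _ (fun y => y <= _)); first exact: closed_le.
  apply: nearW => k; apply: expR_energy_le => //; first exact: harmonic_gt0.
  by rewrite /= invf_le1 // ler1n.
exact: expR_ge0.
Qed.

Lemma bounded_cj_integrable f : measurable_fun setT f ->
  (exists C, forall th, `|f th| <= C) -> cj_integrable f.
Proof.
move=> mf [C fC]; have [M M0 WM] := cj_weight_bounded.
apply: bounded_integrable_torus.
  by apply: measurable_funM => //; exact: measurable_cj_weight.
exists (C * M) => th _; rewrite normrM ler_pM // ger0_norm ?WM //.
exact: cj_weight_ge0.
Qed.

Lemma cj_integrableD f g : cj_integrable f -> cj_integrable g ->
  cj_integrable (fun th => f th + g th).
Proof.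
move=> hf hg; have := integrableD (@measurable_torus R n) hf hg.
by apply: eq_integrable; [exact: measurable_torus|move=> th _ /=; rewrite -EFinD mulrDl].
Qed.

Lemma cj_integrableZ c f : cj_integrable f -> cj_integrable (fun th => c * f th).
Proof.
move=> hf; have := integrableZl (@measurable_torus R n) c hf.
by apply: eq_integrable; [exact: measurable_torus|move=> th _ /=; rewrite -EFinM mulrA].
Qed.

Lemma cj_integralD f g : cj_integrable f -> cj_integrable g ->
  cj_integral (fun th => f th + g th) = cj_integral f + cj_integral g.
Proof.
move=> hf hg; rewrite /cj_integral -RintegralD //; last exact: measurable_torus.
by apply: eq_Rintegral => th _; rewrite mulrDl.
Qed.

Lemma cj_integralZ c f : cj_integrable f -> cj_integral (fun th => c * f th) = c * cj_integral f.
Proof.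
move=> hf; rewrite /cj_integral -RintegralZl //; last exact: measurable_torus.
by apply: eq_Rintegral => th _; rewrite mulrA.
Qed.

Lemma le_cj_integral f g : cj_integrable f -> cj_integrable g ->
  (forall th, cj_weight beta delta th != 0 -> f th <= g th) ->
  cj_integral f <= cj_integral g.
Proof.
move=> hf hg fg; apply: le_Rintegral => //; first exact: measurable_torus.
move=> th _; have [->|w0] := eqVneq (cj_weight beta delta th) 0.
  by rewrite !mulr0.
by rewrite ler_wpM2r ?cj_weight_ge0 // fg.
Qed.

Lemma cj_integral_ge0 f : (forall th, 0 <= f th) -> 0 <= cj_integral f.
Proof. by move=> f0; apply: Rintegral_ge0 => th _; rewrite mulr_ge0 ?cj_weight_ge0. Qed.

Lemma cj_integral_cvg_le (f_ : nat -> tuple -> R) f c :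
  (forall k, measurable_fun setT (f_ k)) -> (forall k th, 0 <= f_ k th) ->
  (forall k, cj_integrable (f_ k)) ->
  (forall th, f_ ^~ th @ \oo --> f th) ->
  (forall k, cj_integral (f_ k) <= c) ->
  cj_integrable f /\ cj_integral f <= c.
Proof.
move=> mf f0 iF ff fc.
have mtor := @measurable_torus R n.
have f00 th : 0 <= f th.
  rewrite -(cvg_lim _ (ff th)) //; apply: limr_ge; last exact: nearW.
  by apply/cvg_ex; exists (f th); exact: ff.
have mff : measurable_fun setT f.
  by apply: (measurable_fun_cvg mf) => th _; exact: ff.
have le : (\int[lebesgue_tuple R n]_(th in torus (N:=n)) (f th * cj_weight beta delta th)%:E <= c%:E)%E.
  apply: (@integral_cvg_le _ _ _ _ _ (fun k th => (f_ k th * cj_weight beta delta th)%:E)) => //.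
  - move=> k; apply/measurable_EFinP/measurable_funTS/measurable_funM => //.
    exact: measurable_cj_weight.
  - by move=> k th _; rewrite lee_fin mulr_ge0 ?cj_weight_ge0.
  - move=> th _; apply: cvg_EFin; first exact: nearW.
    by apply: cvgM; [exact: ff|exact: cvg_cst].
  - move=> k; have := fc k; rewrite -lee_fin /cj_integral /Rintegral fineK //.
    exact: integrable_fin_num (iF k).
have iff : cj_integrable f.
  apply/integrableP; split.
    apply/measurable_EFinP/measurable_funTS/measurable_funM => //.
    exact: measurable_cj_weight.
  apply: le_lt_trans (ltry c); apply: le_trans le.
  rewrite le_eqVlt; apply/orP; left; apply/eqP; apply: eq_integral => th _ /=.
  by rewrite ger0_norm // mulr_ge0 ?cj_weight_ge0.
split => //; rewrite -lee_fin /cj_integral /Rintegral fineK //.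
exact: integrable_fin_num iff.
Qed.

End cj_integral.

Section moments.
Context {R : realType} {n : nat}.
Variables (beta delta : R).
Hypotheses (beta0 : 0 < beta) (delta0 : 0 < delta).
Local Notation tuple := (n.-tuple (measurableTypeR R)).
Implicit Types (f g : tuple -> R) (th : tuple) (x : 'I_n -> R) (s : R).
Local Notation Q th := (sum_chi 0 (tnth th)).
Local Notation T th := (sum_kap 0 (tnth th)).
Local Notation integrable := (@cj_integrable R n beta delta).
Local Notation integral := (@cj_integral R n beta delta).

Lemma sum_chi0_ge0 x : 0 <= sum_chi 0 x.
Proof. by apply: sumr_ge0 => j _; exact: chi_ge0. Qed.

Lemma chi0_le_sum x i : chi 0 (x i) <= sum_chi 0 x.
Proof.
rewrite /sum_chi (bigD1 i) //= lerDl; apply: sumr_ge0 => j _.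
exact: chi_ge0.
Qed.

Lemma cj_integral_divergence a b al ga s : 0 < s -> 0 < al -> 0 <= ga ->
  let div th := divergence beta delta a b al ga s 0 (tnth th) in
  integrable div /\ integral div = 0.
Proof.
move=> s0 al0 ga0 /=.
have [iW W0] := @loop_equation R n beta delta a b al ga s beta0 delta0 s0 al0 ga0.
split.
  by move: iW; apply: eq_integrable; [exact: measurable_torus|move=> th _ /=; rewrite mulrC].
rewrite /cj_integral /Rintegral.
by under eq_integral do rewrite mulrC; rewrite W0.
Qed.

Lemma measurable_level0 al ga s :
  measurable_fun setT (fun th : tuple => level al ga s 0 (tnth th)).
Proof.
apply: measurable_funD => //; apply: measurable_funD; apply: measurable_funM => //.
  exact: measurable_sum_chi.
by apply: measurable_funM; exact: measurable_sum_kap.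
Qed.

Lemma measurable_inv_level0 al ga s : 0 < s -> 0 <= al -> 0 <= ga ->
  measurable_fun setT (fun th : tuple => (level al ga s 0 (tnth th))^-1).
Proof.
move=> s0 al0 ga0.
rewrite (_ : (fun _ => _) = fun th : tuple => level al ga s 0 (tnth th) `^ (-1)).
  exact: (measurableT_comp (measurable_powR _) (measurable_level0 _ _ _)).
apply/funext => th; rewrite powR_inv1 //.
by rewrite (le_trans (ltW s0)) // level_ge.
Qed.

Lemma cutoff_le1 al ga s x : 0 < s -> 0 <= al -> 0 <= ga ->
  0 <= s / level al ga s 0 x <= 1.
Proof.
move=> s0 al0 ga0; have L := @level_ge R n _ _ s al0 ga0 0 x (lexx _).
by rewrite divr_ge0 ?ler_pdivrMr ?mul1r ?(ltW s0) ?(le_trans (ltW s0)) ?(lt_le_trans s0).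
Qed.

Lemma cj_integrable_cutoff al ga s : 0 < s -> 0 <= al -> 0 <= ga ->
  integrable (fun th => s / level al ga s 0 (tnth th)).
Proof.
move=> s0 al0 ga0; apply: bounded_cj_integrable => //.
  by apply: measurable_funM => //; exact: measurable_inv_level0.
exists 1 => th; have /andP[h0 h1] := @cutoff_le1 al ga s (tnth th) s0 al0 ga0.
by rewrite ger0_norm.
Qed.

Lemma level_ge_sum al ga s x : 0 < s -> 0 <= ga ->
  al * sum_chi 0 x + ga * sum_kap 0 x ^+ 2 <= level al ga s 0 x.
Proof. by move=> s0 ga0; rewrite /level -expr2; lra. Qed.

Lemma cj_integrable_cutoff_chi al ga s : 0 < s -> 0 < al -> 0 <= ga ->
  integrable (fun th => s / level al ga s 0 (tnth th) * Q th).
Proof.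
move=> s0 al0 ga0; apply: bounded_cj_integrable => //.
  apply: measurable_funM; last exact: measurable_sum_chi.
  by apply: measurable_funM => //; apply: measurable_inv_level0 => //; exact: ltW.
exists (s / al) => th.
have /andP[h0 h1] := @cutoff_le1 al ga s (tnth th) s0 (ltW al0) ga0.
have q0 := sum_chi0_ge0 (tnth th).
rewrite (ger0_norm (mulr_ge0 h0 q0)) -mulrA ler_pM2l // ler_pdivrMl; last first.
  by apply: (lt_le_trans s0); apply: level_ge => //; exact: ltW.
rewrite ler_pdivlMr // mulrC; have := @level_ge_sum al ga s (tnth th) s0 ga0.
have : 0 <= ga * sum_kap 0 (tnth th) ^+ 2 by rewrite mulr_ge0 ?sqr_ge0.
lra.
Qed.

Lemma cj_integrable_cutoff_sqr_kap al ga s : 0 < s -> 0 <= al -> 0 < ga ->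
  integrable (fun th => s / level al ga s 0 (tnth th) * T th ^+ 2).
Proof.
move=> s0 al0 ga0; apply: bounded_cj_integrable => //.
  apply: measurable_funM; last first.
    by under eq_fun do rewrite expr2; apply: measurable_funM; exact: measurable_sum_kap.
  by apply: measurable_funM => //; apply: measurable_inv_level0 => //; exact: ltW.
exists (s / ga) => th.
have /andP[h0 h1] := @cutoff_le1 al ga s (tnth th) s0 al0 (ltW ga0).
have q0 := sum_chi0_ge0 (tnth th).
rewrite (ger0_norm (mulr_ge0 h0 (sqr_ge0 _))) -mulrA ler_pM2l // ler_pdivrMl; last first.
  by apply: (lt_le_trans s0); apply: level_ge => //; exact: ltW.
rewrite ler_pdivlMr // mulrC; have := @level_ge_sum al ga s (tnth th) s0 (ltW ga0).
have : 0 <= al * sum_chi 0 (tnth th) by rewrite mulr_ge0.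
lra.
Qed.

Section psi.
Variables (s : R) (s0 : 0 < s).
Let psi th := s / (s + Q th).

Let psi01 th : 0 <= psi th <= 1.
Proof.
have q0 := sum_chi0_ge0 (tnth th).
rewrite /psi divr_ge0 ?addr_ge0 ?(ltW s0) //= ler_pdivrMr ?ltr_pwDl // mul1r.
by rewrite lerDl.
Qed.

Let measurable_psi : measurable_fun setT psi.
Proof.
rewrite (_ : psi = fun th => s / level 1 0 s 0 (tnth th)).
  by apply: measurable_funM => //; exact: measurable_inv_level0.
by apply/funext => th; rewrite /psi /level; congr (_ / _); ring.
Qed.

Let cj_integrable_comp_psi (h : R -> R) C : continuous h ->
  (forall p, 0 <= p <= 1 -> `|h p| <= C) -> integrable (fun th => h (psi th)).
Proof.
move=> ch hC; apply: bounded_cj_integrable => //.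
  exact: (measurableT_comp (continuous_measurable_fun ch) measurable_psi).
by exists C => th; exact: hC.
Qed.

Lemma cj_integrable_psi : integrable (fun th => s / (s + Q th)).
Proof.
apply: (@cj_integrable_comp_psi id 1); first by move=> p; exact: cvg_id.
by move=> p /andP[p0 p1]; rewrite ger0_norm.
Qed.

Lemma cj_integrable_1B_psi : integrable (fun th => s * (1 - s / (s + Q th))).
Proof.
apply: (@cj_integrable_comp_psi (fun p => s * (1 - p)) s).
  by move=> p; apply: cvgM; [exact: cvg_cst|apply: cvgB; [exact: cvg_cst|exact: cvg_id]].
move=> p /andP[p0 p1]; rewrite ger0_norm; last by rewrite mulr_ge0 ?subr_ge0 // ltW.
by rewrite ler_piMr ?(ltW s0) // gerBl.
Qed.

Lemma cj_integrable_sqr_1B_psi : integrable (fun th => s * (1 - s / (s + Q th)) ^+ 2).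
Proof.
apply: (@cj_integrable_comp_psi (fun p => s * (1 - p) ^+ 2) s).
  move=> p; apply: cvgM; first exact: cvg_cst.
  rewrite expr2; under eq_fun do rewrite expr2.
  by apply: cvgM; apply: cvgB; try exact: cvg_cst; exact: cvg_id.
move=> p /andP[p0 p1]; rewrite ger0_norm; last by rewrite mulr_ge0 ?sqr_ge0 // ltW.
by rewrite ler_piMr ?(ltW s0) // exprn_ile1 ?subr_ge0 // gerBl.
Qed.

End psi.

(** Without cutoff the loop equation reads [rate * E Q = target]. The positivity of [rate] is where
    [2 delta > 1] enters. *)
Definition rate : R := (2 * delta - 1) * (2 * delta + beta / 2).
Definition target : R := delta ^+ 2 * n%:R + delta * beta * n%:R ^+ 2 / 4.

Lemma target_ge0 : 0 <= target.
Proof. by rewrite addr_ge0 // !mulr_ge0 ?exprn_ge0 ?(ltW beta0) ?(ltW delta0). Qed.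

Lemma cvg_cutoff al ga x : 0 <= al -> 0 <= ga ->
  (fun k : nat => k.+1%:R / level al ga k.+1%:R 0 x) @ \oo --> (1 : R).
Proof.
move=> al0 ga0; pose c := al * sum_chi 0 x + ga * (sum_kap 0 x * sum_kap 0 x).
have c0 : 0 <= c.
  by rewrite addr_ge0 // mulr_ge0 // -?expr2 ?sqr_ge0 // sum_chi0_ge0.
have -> : (fun k : nat => k.+1%:R / level al ga k.+1%:R 0 x) =
    (fun k => (1 + harmonic k * c)^-1).
  apply/funext => k; rewrite /level -/c /=.
  have k0 : k.+1%:R != 0 :> R by rewrite pnatr_eq0.
  have -> : 1 + k.+1%:R^-1 * c = (k.+1%:R + c) / k.+1%:R.
    by rewrite mulrDl divff // mulrC.
  by rewrite invf_div.
rewrite -[X in _ --> X]invr1; apply: cvgV; first exact: oner_neq0.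
rewrite -[X in _ --> X]addr0; apply: cvgD; first exact: cvg_cst.
by rewrite -[X in _ --> X](mul0r c); apply: cvgM; [exact: cvg_harmonic|exact: cvg_cst].
Qed.

(* With the multipliers [delta] and [beta / 4] the terms in
   [s / level * sum_kap ^ 2] cancel. *)
Lemma divergence0_main al ga s x : (forall j, gap2 (x j) != 0) ->
  (forall j k : 'I_n, (j < k)%N -> gap2 (x j - x k) != 0) ->
  0 < s -> 0 < al -> 0 <= ga ->
  divergence beta delta delta (beta / 4) al ga s 0 x =
  s / level al ga s 0 x * (rate * sum_chi 0 x - target)
  + s / level al ga s 0 x ^+ 2 * \sum_(i < n)
      field delta (beta / 4) 0 x i * (al * kap 0 (x i) + 4 * ga * sum_kap 0 x) * chi 0 (x i).
Proof.
move=> h1 h2 s0 al0 ga0; rewrite divergence0E //; congr (_ * _ + _).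
by rewrite /rate /target; field.
Qed.

Section second_moment.
Hypothesis delta_gt : 1 < 2 * delta.

Lemma rate_gt0 : 0 < rate.
Proof. by rewrite mulr_gt0 //; move: beta0 delta0 delta_gt; lra. Qed.

(* The level function [2 delta Q + (beta / 8) T ^ 2] has the field itself as
   half its gradient, up to the factors [chi], so that the error term has a
   sign. *)
Lemma moment_sum_chi_cutoff s : 0 < s ->
  rate * integral (fun th => s / level (2 * delta) (beta / 8) s 0 (tnth th) * Q th)
  <= target * integral (fun=> 1).
Proof.
move=> s0.
have al0 : 0 < 2 * delta by rewrite mulr_gt0.
have ga0 : 0 <= beta / 8 by rewrite divr_ge0 // ltW.
have [iD D0] := @cj_integral_divergence delta (beta / 4) _ _ _ s0 al0 ga0.
pose psi th := s / level (2 * delta) (beta / 8) s 0 (tnth th).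
have ipsi : integrable psi by apply: cj_integrable_cutoff => //; exact: ltW.
have ipQ : integrable (fun th => psi th * Q th) by exact: cj_integrable_cutoff_chi.
have i1 : integrable (fun th => rate * (psi th * Q th)) by exact: cj_integrableZ.
have i2 : integrable (fun th => - target * psi th) by exact: cj_integrableZ.
have ic : integrable (fun=> 1).
  by apply: bounded_cj_integrable; [| |exact: measurable_cst|exists 1 => th; rewrite normr1].
have : integral (fun th => rate * (psi th * Q th) + - target * psi th) <= 0.
  rewrite -[X in _ <= X]D0; apply: le_cj_integral; [exact: (cj_integrableD i1 i2)|exact: iD|].
  move=> th /(cj_weight_neq0 beta0 delta0)[h1 h2].
  rewrite (divergence0_main h1 h2 s0 al0 ga0) -/(psi th).
  have -> : rate * (psi th * Q th) + - target * psi th = psi th * (rate * Q th - target) by ring.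
  rewrite lerDl mulr_ge0 //.
    rewrite divr_ge0 ?(ltW s0) // exprn_ge0 //.
    by rewrite (le_trans (ltW s0)) // level_ge // ltW.
  apply: sumr_ge0 => i _; rewrite mulr_ge0 ?chi_ge0 //.
  have -> : 2 * delta * kap 0 (tnth th i) + 4 * (beta / 8) * T th =
    2 * field delta (beta / 4) 0 (tnth th) i by rewrite /field; field.
  have := sqr_ge0 (field delta (beta / 4) 0 (tnth th) i); nra.
rewrite cj_integralD // (cj_integralZ rate ipQ) (cj_integralZ (- target) ipsi).
have hpsi : integral psi <= integral (fun=> 1).
  apply: le_cj_integral => // th _.
  by have /andP[_ ->] := @cutoff_le1 _ _ s (tnth th) s0 (ltW al0) ga0.
have := ler_wpM2l target_ge0 hpsi.
change (target * integral psi <= target * integral (fun=> 1) ->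
  rate * integral (fun th => psi th * Q th) + - target * integral psi <= 0 ->
  rate * integral (fun th => psi th * Q th) <= target * integral (fun=> 1)).
lra.
Qed.

(** Fatou along the cutoffs [s = 1, 2, ...], which yields the integrability of [Q] together with the
    bound. *)
Lemma moment_sum_chi : integrable (fun th => Q th) /\
  rate * integral (fun th => Q th) <= target * integral (fun=> 1).
Proof.
have al0 : 0 < 2 * delta by rewrite mulr_gt0.
have ga0 : 0 <= beta / 8 by rewrite divr_ge0 // ltW.
have r0 := rate_gt0.
rewrite -ler_pdivlMl //.
apply: (@cj_integral_cvg_le R n beta delta
  (fun k th => k.+1%:R / level (2 * delta) (beta / 8) k.+1%:R 0 (tnth th) * Q th)).
- move=> k; apply: measurable_funM; last exact: measurable_sum_chi.
  by apply: measurable_funM => //; apply: measurable_inv_level0 => //; exact: ltW.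
- move=> k th; rewrite mulr_ge0 ?sum_chi0_ge0 //.
  by have /andP[] := @cutoff_le1 (2 * delta) (beta / 8) k.+1%:R (tnth th) (ltr0Sn _ k) (ltW al0) ga0.
- by move=> k; exact: cj_integrable_cutoff_chi.
- move=> th; rewrite -[X in _ --> X]mul1r; apply: cvgM; last exact: cvg_cst.
  by apply: cvg_cutoff => //; exact: ltW.
- by move=> k; rewrite ler_pdivlMl // moment_sum_chi_cutoff.
Qed.

(** Uses the pure rotation field [T], that is [a = 0] and [b = 1]: the interaction disappears and
    the main term is [psi (delta T^2 - 2 Q)]. The constant 8 is this 2 plus the 6 that bounds the
    error term. The resulting order [N^2] for [T^2] is what makes the [eta] term of
    [moment_cutoff_lower] small. *)
Lemma moment_sqr_kap_cutoff s : 0 < s ->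
  delta * integral (fun th => s / level 1 1 s 0 (tnth th) * T th ^+ 2)
  <= 8 * integral (fun th => Q th).
Proof.
move=> s0; have [iQ _] := moment_sum_chi.
have [iD D0] := @cj_integral_divergence 0 1 1 1 s s0 ltr01 ler01.
pose psi th := s / level 1 1 s 0 (tnth th).
have ipT : integrable (fun th => psi th * T th ^+ 2) by exact: cj_integrable_cutoff_sqr_kap.
have i1 : integrable (fun th => delta * (psi th * T th ^+ 2)) by exact: cj_integrableZ.
have i2 : integrable (fun th => - 8 * Q th) by exact: cj_integrableZ.
have : integral (fun th => delta * (psi th * T th ^+ 2) + - 8 * Q th) <= 0.
  rewrite -[X in _ <= X]D0; apply: le_cj_integral; [exact: (cj_integrableD i1 i2)|exact: iD|].
  move=> th /(cj_weight_neq0 beta0 delta0)[h1 h2].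
  rewrite divergence0E // -/(psi th) mul0r add0r mul1r.
  have /andP[p0 p1] := @cutoff_le1 1 1 s (tnth th) s0 ler01 ler01.
  have q0 := sum_chi0_ge0 (tnth th).
  set S := \sum_(i < n) _.
  have L0 : 0 < level 1 1 s 0 (tnth th) by apply: (lt_le_trans s0); exact: level_ge.
  (* The part [4 T^2] of [S] has the good sign, and [- T kap_i <= T^2 / 2 + 2 Q], which is well
     within 6 times the level; the constant is not optimized. *)
  have hS : - S <= 6 * level 1 1 s 0 (tnth th) * Q th.
    rewrite -sumrN [X in _ <= X]mulr_sumr; apply: ler_sum => i _.
    rewrite -mulNr ler_wpM2r ?chi_ge0 // /field mul0r add0r !mul1r.
    have := @level_ge_sum 1 1 s (tnth th) s0 ler01; rewrite !mul1r.
    have := sqr_kap_le (tnth th i) (lexx 0); have := chi0_le_sum (tnth th) i.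
    have := sqr_ge0 (T th + kap 0 (tnth th i)); have := sqr_ge0 (T th).
    nra.
  have hS2 : s / level 1 1 s 0 (tnth th) ^+ 2 * - S <= 6 * (psi th * Q th).
    have -> : 6 * (psi th * Q th) = s / level 1 1 s 0 (tnth th) ^+ 2 *
        (6 * level 1 1 s 0 (tnth th) * Q th).
      by rewrite /psi; field; rewrite gt_eqF.
    by rewrite ler_wpM2l // divr_ge0 ?exprn_ge0 ?(ltW s0) // ltW.
  rewrite mulrN in hS2.
  have : psi th * Q th <= Q th by rewrite ler_piMl.
  rewrite /psi in hS2 *; lra.
rewrite cj_integralD // (cj_integralZ delta ipT) (cj_integralZ (- 8) iQ).
change (delta * integral (fun th => psi th * T th ^+ 2) + - 8 * integral (fun th => Q th) <= 0 ->
  delta * integral (fun th => psi th * T th ^+ 2) <= 8 * integral (fun th => Q th)).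
lra.
Qed.

Lemma moment_sqr_kap : integrable (fun th => T th ^+ 2) /\
  delta * integral (fun th => T th ^+ 2) <= 8 * integral (fun th => Q th).
Proof.
rewrite -ler_pdivlMl //.
apply: (@cj_integral_cvg_le R n beta delta
  (fun k th => k.+1%:R / level 1 1 k.+1%:R 0 (tnth th) * T th ^+ 2)).
- move=> k; apply: measurable_funM; last first.
    by under eq_fun do rewrite expr2; apply: measurable_funM; exact: measurable_sum_kap.
  by apply: measurable_funM => //; exact: measurable_inv_level0.
- move=> k th; rewrite mulr_ge0 ?sqr_ge0 //.
  by have /andP[] := @cutoff_le1 1 1 k.+1%:R (tnth th) (ltr0Sn _ k) ler01 ler01.
- by move=> k; exact: cj_integrable_cutoff_sqr_kap.
- move=> th; rewrite -[X in _ --> X]mul1r; apply: cvgM; last exact: cvg_cst.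
  exact: cvg_cutoff.
- by move=> k; rewrite ler_pdivlMl // moment_sqr_kap_cutoff.
Qed.

(* Here [s (1 - psi) = psi Q] and [s (1 - psi)^2 = s Q^2 / (s + Q)^2]; the
   latter controls the term coming from the derivative of [psi]. *)
Lemma moment_cutoff_lower s eta : 0 < s -> 0 < eta ->
  let psi th := s / (s + Q th) in
  target * integral psi <= rate * integral (fun th => s * (1 - psi th))
    + (4 * delta + beta / (4 * eta)) * integral (fun th => s * (1 - psi th) ^+ 2)
    + beta / 4 * eta * integral (fun th => T th ^+ 2).
Proof.
move=> s0 eta0 /=; set psi := (fun th => s / (s + Q th)).
have [iT _] := moment_sqr_kap.
have [iD D0] := @cj_integral_divergence delta (beta / 4) 1 0 s s0 ltr01 (lexx _).
have LE th : level 1 0 s 0 (tnth th) = s + Q th by rewrite /level; ring.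
have psiE th : psi th = s / level 1 0 s 0 (tnth th) by rewrite LE.
have psi01 th : 0 <= psi th <= 1 by rewrite psiE cutoff_le1.
have ipsi : integrable psi by exact: cj_integrable_psi.
have ip1 : integrable (fun th => s * (1 - psi th)) by exact: cj_integrable_1B_psi.
have ip2 : integrable (fun th => s * (1 - psi th) ^+ 2) by exact: cj_integrable_sqr_1B_psi.
set c2 := 4 * delta + beta / (4 * eta); set c3 := beta / 4 * eta.
have j1 : integrable (fun th => rate * (s * (1 - psi th))) by exact: cj_integrableZ.
have j2 : integrable (fun th => c2 * (s * (1 - psi th) ^+ 2)) by exact: cj_integrableZ.
have j3 : integrable (fun th => c3 * T th ^+ 2) by exact: cj_integrableZ.
have j4 : integrable (fun th => - target * psi th) by exact: cj_integrableZ.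
have j12 := cj_integrableD j1 j2.
have j123 := cj_integrableD j12 j3.
have j1234 := cj_integrableD j123 j4.
have : 0 <= integral (fun th => rate * (s * (1 - psi th)) + c2 * (s * (1 - psi th) ^+ 2)
     + c3 * T th ^+ 2 + - target * psi th).
  rewrite -[X in X <= _]D0; apply: le_cj_integral => //.
  move=> th /(cj_weight_neq0 beta0 delta0)[h1 h2].
  rewrite (divergence0_main h1 h2 s0 ltr01 (lexx _)) -psiE.
  have q0 := sum_chi0_ge0 (tnth th).
  have L0 : 0 < s + Q th by rewrite ltr_pwDl.
  have E1 : s * (1 - psi th) = psi th * Q th by rewrite /psi; field; rewrite gt_eqF.
  have E2 : s * (1 - psi th) ^+ 2 = s / (s + Q th) ^+ 2 * Q th ^+ 2.
    by rewrite /psi; field; rewrite gt_eqF.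
  rewrite E2 E1 LE.
  pose Y := \sum_(i < n) kap 0 (tnth th i) * chi 0 (tnth th i).
  (* The [delta] part of the error is at most [4 delta Q^2]; the [beta / 4] part is the cross term
     [T Y], which has no sign. *)
  have hX : \sum_(i < n) field delta (beta / 4) 0 (tnth th) i *
       (1 * kap 0 (tnth th i) + 4 * 0 * T th) * chi 0 (tnth th i) <=
       4 * delta * Q th ^+ 2 + beta / 4 * (T th * Y).
    have -> : 4 * delta * Q th ^+ 2 + beta / 4 * (T th * Y) =
      \sum_(i < n) (4 * delta * Q th * chi 0 (tnth th i)
         + beta / 4 * T th * (kap 0 (tnth th i) * chi 0 (tnth th i))).
      by rewrite big_split /= -!mulr_sumr -/(Y) /sum_chi; ring.
    apply: ler_sum => i _; rewrite /field mulr0 mul0r addr0 mul1r.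
    rewrite -mulrA mulrDl; apply: lerD; last by rewrite mulrA lexx.
    have -> : delta * kap 0 (tnth th i) * (kap 0 (tnth th i) * chi 0 (tnth th i)) =
       delta * kap 0 (tnth th i) ^+ 2 * chi 0 (tnth th i) by ring.
    rewrite ler_wpM2r ?chi_ge0 // (_ : 4 * delta * Q th = delta * (4 * Q th)); last by ring.
    rewrite ler_pM2l //.
    have := sqr_kap_le (tnth th i) (lexx 0); have := chi0_le_sum (tnth th) i; lra.
  pose r := Num.sqrt (Q th).
  have r0 : 0 <= r by exact: sqrtr_ge0.
  have r2 : r ^+ 2 = Q th by exact: sqr_sqrtr.
  have hY : `|Y| <= 2 * r * Q th.
    rewrite (le_trans (ler_norm_sum _ _ _)) // /Y [X in _ <= X]mulr_sumr.
    apply: ler_sum => i _; rewrite (normrM (kap _ _)) (ger0_norm (chi_ge0 _ (lexx _))).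
    rewrite ler_wpM2r ?chi_ge0 //.
    rewrite -(@ler_pXn2r _ 2) ?nnegrE ?mulr_ge0 // real_normK ?num_real // (exprMn _ 2 r) r2.
    have := sqr_kap_le (tnth th i) (lexx 0); have := chi0_le_sum (tnth th) i; lra.
  have Y2 : Y ^+ 2 <= 4 * Q th ^+ 3.
    rewrite -real_normK ?num_real //.
    apply: (@le_trans _ _ ((2 * r * Q th) ^+ 2)).
      by rewrite ler_pXn2r // nnegrE ?mulr_ge0.
    have -> : (2 * r * Q th) ^+ 2 = 4 * (r ^+ 2 * Q th ^+ 2) by ring.
    by rewrite r2 -exprS.
  set w := s / (s + Q th) ^+ 2 in hX *.
  have w0 : 0 <= w by rewrite divr_ge0 ?exprn_ge0 ?(ltW s0) // ltW.
  have wQ : w * Q th <= 1.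
    rewrite /w mulrAC ler_pdivrMr ?exprn_gt0 // mul1r; nra.
  (* Young's inequality: the square gives [w T Y <= eta T^2 + w^2 Y^2 / (4 eta)], and
     [w^2 Y^2 <= 4 w Q^2] because [Y^2 <= 4 Q^3] and [w Q <= 1]. The two terms account for
     [beta / 4 * eta] and [beta / (4 * eta)] in the statement. *)
  have hTY : w * (T th * Y) <= eta * T th ^+ 2 + w * Q th ^+ 2 / eta.
    have h : 0 <= (2 * eta * T th - w * Y) ^+ 2 by exact: sqr_ge0.
    have h4 : w ^+ 2 * Y ^+ 2 <= 4 * (w * Q th ^+ 2).
      apply: (@le_trans _ _ (w ^+ 2 * (4 * Q th ^+ 3))); first by rewrite ler_wpM2l ?exprn_ge0.
      have -> : w ^+ 2 * (4 * Q th ^+ 3) = 4 * (w * Q th ^+ 2) * (w * Q th) by ring.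
      by rewrite ler_piMr // mulr_ge0 // (mulr_ge0 w0) // sqr_ge0.
    have -> : eta * T th ^+ 2 + w * Q th ^+ 2 / eta =
      (eta ^+ 2 * T th ^+ 2 + w * Q th ^+ 2) / eta by field; rewrite gt_eqF.
    rewrite ler_pdivlMr //.
    have : (2 * eta * T th - w * Y) ^+ 2 = 4 * eta ^+ 2 * T th ^+ 2 + w ^+ 2 * Y ^+ 2
      - 4 * (w * (T th * Y) * eta) by ring.
    lra.
  have hwX := ler_wpM2l w0 hX.
  have hb : beta / 4 * (w * (T th * Y)) <= beta / 4 * (eta * T th ^+ 2 + w * Q th ^+ 2 / eta).
    by rewrite ler_wpM2l // divr_ge0 // ltW.
  rewrite /c2 /c3.
  have -> : (4 * delta + beta / (4 * eta)) * (w * Q th ^+ 2) =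
     4 * delta * (w * Q th ^+ 2) + beta / 4 * (w * Q th ^+ 2 / eta).
    by field; rewrite gt_eqF.
  lra.
rewrite (cj_integralD j123 j4) (cj_integralD j12 j3) (cj_integralD j1 j2).
rewrite (cj_integralZ rate ip1) (cj_integralZ c2 ip2) (cj_integralZ c3 iT) (cj_integralZ (- target) ipsi).
lra.
Qed.

End second_moment.
End moments.

(** * Evaluation on the imaginary axis *)

Lemma prod_1D_ge (R : realDomainType) (I : Type) (r : seq I) (a : I -> R) :
  (forall i, 0 <= a i) -> 1 + \sum_(i <- r) a i <= \prod_(i <- r) (1 + a i).
Proof.
move=> a0; elim: r => [|i r IH]; first by rewrite !big_nil addr0.
rewrite !big_cons; have := a0 i; have : 0 <= \sum_(i <- r) a i by apply: sumr_ge0.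
nra.
Qed.

(** A division-free form of [1 - 1 / prod <= sum], which bounds a truncated functional of the
    product by a multiple of [Q]. *)
Lemma prod_1D_subr1_le (R : realDomainType) (I : Type) (r : seq I) (a : I -> R) :
  (forall i, 0 <= a i) ->
  \prod_(i <- r) (1 + a i) - 1 <= (\prod_(i <- r) (1 + a i)) * \sum_(i <- r) a i.
Proof.
move=> a0; elim: r => [|i r IH]; first by rewrite !big_nil subrr mulr0.
rewrite !big_cons; have := prod_1D_ge r a0; have := a0 i.
have : 0 <= \sum_(i <- r) a i by apply: sumr_ge0.
move: IH; move: (\prod_(i <- r) _) (\sum_(i <- r) _) (a i) => P S b.
move=> h S0 b0 P1; have P0 : 0 <= P by lra.
have : 0 <= P * b * S by rewrite !mulr_ge0.
have : 0 <= P * b * b by rewrite !mulr_ge0.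
nra.
Qed.

Section complex_modulus.
Context {R : realType}.
Local Open Scope complex_scope.

(** Real valued and multiplicative, whereas the norm of [R[i]] takes its values in [R[i]]. *)
Definition sqrabs (z : R[i]) : R := complex.Re z ^+ 2 + complex.Im z ^+ 2.

Lemma sqrabsM z w : sqrabs (z * w) = sqrabs z * sqrabs w.
Proof. by case: z w => [a b] [c d]; rewrite /sqrabs /=; ring. Qed.

Lemma sqrabs1 : sqrabs 1 = 1.
Proof. by rewrite /sqrabs /= expr1n expr0n addr0. Qed.

Lemma sqrabs_real t : sqrabs t%:C = t ^+ 2.
Proof. by rewrite /sqrabs /= expr0n addr0. Qed.

Lemma sqrabs_eq0 z : (sqrabs z == 0) = (z == 0).
Proof.
case: z => a b; rewrite /sqrabs /= paddr_eq0 ?sqr_ge0 // !sqrf_eq0.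
by rewrite eq_complex.
Qed.

Lemma sqrabsV z : sqrabs z^-1 = (sqrabs z)^-1.
Proof.
have [->|z0] := eqVneq z 0.
  by rewrite invr0 /sqrabs /= expr0n addr0 invr0.
apply: (mulfI (_ : sqrabs z != 0)); first by rewrite sqrabs_eq0.
by rewrite -sqrabsM !divff ?sqrabs1 // sqrabs_eq0.
Qed.

Lemma sqrabs_prod (I : Type) (r : seq I) (P : pred I) (f : I -> R[i]) :
  sqrabs (\prod_(i <- r | P i) f i) = \prod_(i <- r | P i) sqrabs (f i).
Proof. exact: (big_morph _ sqrabsM sqrabs1). Qed.

Lemma abs_Re_lt (z : R[i]) (e : R) : `|z| < e%:C -> `|complex.Re z| < e.
Proof.
case: z => a b; rewrite ltcR; apply: le_lt_trans => /=.
by rewrite -sqrtr_sqr ler_wsqrtr // lerDl sqr_ge0.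
Qed.

Lemma abs_Im_lt (z : R[i]) (e : R) : `|z| < e%:C -> `|complex.Im z| < e.
Proof.
case: z => a b; rewrite ltcR; apply: le_lt_trans => /=.
by rewrite -sqrtr_sqr ler_wsqrtr // lerDr sqr_ge0.
Qed.

Lemma cvg_sqrabs (T : Type) (F : set_system T) {FF : Filter F} (f : T -> R[i]^o)
    (l : R[i]^o) : f @ F --> l -> (fun x => sqrabs (f x)) @ F --> sqrabs l.
Proof.
move=> /cvgrPdist_lt fl.
have cRe : (fun x => complex.Re (f x)) @ F --> complex.Re l.
  apply/cvgrPdist_lt => e e0; have e0' : 0 < e%:C :> R[i] by rewrite ltcR.
  have := fl _ e0'; apply: filterS => x /abs_Re_lt.
  by case: l {fl} => a b; case: (f x).
have cIm : (fun x => complex.Im (f x)) @ F --> complex.Im l.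
  apply/cvgrPdist_lt => e e0; have e0' : 0 < e%:C :> R[i] by rewrite ltcR.
  have := fl _ e0'; apply: filterS => x /abs_Im_lt.
  by case: l {fl cRe} => a b; case: (f x).
rewrite /sqrabs; apply: cvgD; rewrite expr2; under eq_fun do rewrite expr2; exact: cvgM.
Qed.

(** Convergence on compact sets implies pointwise convergence. *)
Lemma eval_cfun_continuous (z : R[i]) : continuous (fun f : @cfun R => f z : R[i]^o).
Proof.
move=> f E nE.
have := @proj_continuous _ _ (z : R[i]^o) f E nE.
exact: (@pointwise_cvg_compact_family _ _ (nbhs f) f _ (fun A nA => nA)).
Qed.

Lemma cexp_real (t : R) : cexp t%:C = (expR t)%:C.
Proof. by rewrite /cexp /= cos0 sin0 mulr1 mulr0. Qed.

Lemma mul_i_imag (y : R) : 'i%R * ('i%R * y%:C) = - y%:C.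
Proof. by rewrite mulrA -expr2 sqrCi mulN1r. Qed.

Lemma sqrabs_real_B_cis (a t : R) : sqrabs (a%:C - cis t) = (1 - a) ^+ 2 + a * gap2 t.
Proof.
rewrite cisE /sqrabs /= /gap2 add0r sqrrN; have := cos2Dsin2 t; nra.
Qed.

Lemma sqrabs_1_B_cis (t : R) : sqrabs (1 - cis t) = gap2 t.
Proof. by rewrite -[1]/(1%:C) sqrabs_real_B_cis subrr expr0n /= add0r mul1r. Qed.

(* [4 sinh(u/2)^2] *)
Definition eps2 (u : R) : R := expR u + expR (- u) - 2.

Lemma sqrabs_cj_fun N (th : N.+1.-tuple (measurableTypeR R)) (y : R) :
  (forall j, gap2 (tnth th j : R) != 0) ->
  sqrabs (cj_fun th ('i%R * y%:C)) =
  \prod_(j < N.+1) (1 + eps2 (y / N.+1%:R) * chi 0 (tnth th j)).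
Proof.
move=> hth; set u := y / N.+1%:R.
have E1 : - ('i%R * ('i%R * y%:C) / 2) = (y / 2)%:C.
  by rewrite mul_i_imag mulNr opprK rmorphM fmorphV rmorph_nat.
have E2 : 'i%R * ('i%R * y%:C) / N.+1%:R = (- u)%:C.
  by rewrite mul_i_imag mulNr rmorphN rmorphM fmorphV rmorph_nat.
rewrite /cj_fun E1 E2 !cexp_real !sqrabsM sqrabsV sqrabs_real.
rewrite /char_poly_circ !sqrabs_prod.
(* The prefactor is spread over the points, one [e^u] each, and [e^u ((1 - e^-u)^2 + e^-u gap2) =
   eps2 u + gap2]. *)
have -> : expR (y / 2) ^+ 2 = \prod_(j < N.+1) expR u.
  rewrite prodr_const card_ord -!expRM_natl.
  by congr expR; rewrite /u [LHS]mulrC [RHS]mulrC !divfK // pnatr_eq0.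
rewrite -prodfV -!big_split /=; apply: eq_bigr => j _.
rewrite sqrabs_real_B_cis sqrabs_1_B_cis /chi addr0 /eps2 expRN.
by field; rewrite hth gt_eqF // expR_gt0.
Qed.

Lemma eps2_ge (u : R) : 0 <= u -> u ^+ 2 <= eps2 u.
Proof.
move=> u0; pose a := expR (u / 2); pose b := expR (- (u / 2)).
have ab : a * b = 1 by rewrite -expRD subrr expR0.
have -> : eps2 u = (a - b) ^+ 2.
  have Ea : expR u = a * a by rewrite -expRD -splitr.
  have Eb : expR (- u) = b * b by rewrite -expRD -opprD -splitr.
  have -> : (a - b) ^+ 2 = a * a + b * b - 2 * (a * b) by ring.
  by rewrite ab mulr1 /eps2 Ea Eb.
rewrite ler_pXn2r ?nnegrE ?subr_ge0 //; last first.
  by rewrite ler_expR; lra.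
(* What remains is [sinh v >= v] at [v = u / 2]: [h] vanishes at 0 and its derivative is
   nonnegative. *)
pose h (v : R) := expR v - expR (- v) - 2 * v.
pose dh (v : R) := expR v + expR (- v) - 2.
have hdh (v : R) : is_derive v 1 h (dh v).
  have d0 : is_derive v 1 (-%R : R -> R) (- 1) by exact: is_deriveNid.
  have d1 := @is_derive1_comp R expR -%R v _ _ (is_derive_expR (- v)) d0.
  have d2 : is_derive v 1 (2 \*: (id : R -> R)) (2 *: 1) by exact: is_deriveZ.
  have d3 := is_deriveB (is_deriveB (is_derive_expR v) d1) d2.
  by apply: (is_derive_eq d3); rewrite /dh /GRing.scale /= mulrN1 opprK mulr1.
have dh0 v : 0 <= dh v.
  rewrite /dh; have := @expR_ge1Dx R v; have := @expR_ge1Dx R (- v); lra.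
have u20 : 0 <= u / 2 by lra.
have [c _ E] := MVT_segment u20 (fun v _ => hdh v)
  (continuous_subspaceT (is_derive_continuous hdh)).
have h0 : h 0 = 0 by rewrite /h oppr0 subrr mulr0 subr0.
have : 0 <= h (u / 2) by move: E; rewrite h0 !subr0 => ->; exact: mulr_ge0.
by rewrite /h -/a -/b; lra.
Qed.

Lemma eps2_le (u : R) : 0 <= u -> eps2 u <= expR u * u ^+ 2.
Proof.
move=> u0; have h1 := expR_ge1Dx (- u); have a0 := expR_gt0 u.
have b1 : expR (- u) <= 1 by rewrite -expR0 ler_expR; lra.
have ab : expR u * expR (- u) = 1 by rewrite -expRD subrr expR0.
have -> : eps2 u = expR u * (1 - expR (- u)) ^+ 2.
  rewrite /eps2; move: (expR u) (expR (- u)) ab => a b ab.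
  have -> : a * (1 - b) ^+ 2 = a - 2 * (a * b) + (a * b) * b by ring.
  by rewrite ab; ring.
rewrite ler_pM2l // ler_pXn2r ?nnegrE ?subr_ge0 //; lra.
Qed.

End complex_modulus.

(** * Bounded test functions of the squared modulus *)

Section cutoff.
Context {R : realType}.

Implicit Types c g : R.

(* Only [g >= 1] matters; the maximum makes [cutoff c] continuous and bounded
   on the whole line. *)
Definition cutoff (c g : R) : R := c / (c + (Num.max 1 g - 1)).

Lemma cutoff_den_gt0 c g : 0 < c -> 0 < c + (Num.max 1 g - 1).
Proof. by move=> c0; have : 1 <= Num.max 1 g; [rewrite le_max lexx|lra]. Qed.

Lemma cutoff_itv c g : 0 < c -> 0 <= cutoff c g <= 1.
Proof.
move=> c0; have d0 := cutoff_den_gt0 g c0.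
rewrite /cutoff divr_ge0 ?(ltW c0) ?(ltW d0) // ler_pdivrMr // mul1r lerDl subr_ge0.
by rewrite le_max lexx.
Qed.

Lemma continuous_cutoff c : 0 < c -> continuous (cutoff c).
Proof.
move=> c0 g; apply: cvgM; first exact: cvg_cst.
apply: cvgV; first by rewrite gt_eqF // cutoff_den_gt0.
apply: cvgD; first exact: cvg_cst.
apply: cvgB; last exact: cvg_cst.
by apply: continuous_max; [exact: cst_continuous|exact: cvg_id].
Qed.

End cutoff.

Section balance.
Context {R : realType}.
Implicit Types a b c p : R.

(** The integrand of [moment_cutoff_lower] without its [T^2] term, divided by [N^2], with [p] in the
    role of [psi]. For nonnegative coefficients it decreases in [p] on the unit interval. *)
Definition balance a b c p : R := a * (1 - p) + b * (1 - p) ^+ 2 - c * p.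

Lemma continuous_balance a b c : continuous (balance a b c).
Proof.
move=> p; have cp : (fun p : R => 1 - p) @ p --> 1 - p.
  by apply: cvgB; [exact: cvg_cst|exact: cvg_id].
apply: cvgB; last by apply: cvgM; [exact: cvg_cst|exact: cvg_id].
apply: cvgD; first by apply: cvgM => //; exact: cvg_cst.
apply: cvgM; first exact: cvg_cst.
by rewrite expr2; under eq_fun do rewrite expr2; exact: cvgM.
Qed.

Lemma abs_balance_le a b c p : 0 <= a -> 0 <= b -> 0 <= c -> 0 <= p <= 1 ->
  `|balance a b c p| <= a + b + c.
Proof.
move=> a0 b0 c0 /andP[p0 p1]; rewrite /balance ler_norml.
have q1 : (1 - p) ^+ 2 <= 1 by rewrite exprn_ile1 ?subr_ge0 // gerBl.
have /andP[? ?] : 0 <= a * (1 - p) <= a by rewrite mulr_ge0 ?subr_ge0 //= ler_piMr // gerBl.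
have /andP[? ?] : 0 <= b * (1 - p) ^+ 2 <= b by rewrite mulr_ge0 ?sqr_ge0 //= ler_piMr.
have /andP[? ?] : 0 <= c * p <= c by rewrite mulr_ge0 //= ler_piMr.
by apply/andP; split; lra.
Qed.

End balance.

(** * Estimates for the rescaled characteristic polynomial at finite [N] *)

Section finite_ensemble_bounds.
Context {R : realType} {n : nat}.
Variables (beta delta : R).
Hypotheses (beta0 : 0 < beta) (delta_gt : 1 < 2 * delta).
Let delta0 : 0 < delta. Proof. by move: delta_gt; lra. Qed.
Local Notation N := (n.+1%:R : R).
Local Notation tuple := (n.+1.-tuple (measurableTypeR R)).
Local Notation Q th := (sum_chi 0 (tnth th)).
Local Notation integrable := (@cj_integrable R n.+1 beta delta).
Local Notation integral := (@cj_integral R n.+1 beta delta).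
Variables (y : R) (y0 : 0 < y).
Local Notation z := ('i%R * y%:C%C).
Local Notation rate := (rate beta delta).
Local Notation target := (@target R n.+1 beta delta).

Let gain (th : tuple) := \prod_(j < n.+1) (1 + eps2 (y / N) * chi 0 (tnth th j)).

Let u0 : 0 <= y / N. Proof. by rewrite divr_ge0 // ltW. Qed.

Let eps0 : 0 <= eps2 (y / N).
Proof. by apply: le_trans (eps2_ge u0); exact: sqr_ge0. Qed.

Let gain_ge (th : tuple) : 1 + eps2 (y / N) * Q th <= gain th.
Proof.
rewrite mulr_sumr; apply: prod_1D_ge => j.
by rewrite mulr_ge0 // chi_ge0.
Qed.

Let gain_ge1 (th : tuple) : 1 <= gain th.
Proof. by apply: le_trans (gain_ge th); rewrite lerDl mulr_ge0 // sum_chi0_ge0. Qed.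

Let max_gain (th : tuple) : Num.max 1 (gain th) = gain th.
Proof. exact/max_idPr. Qed.

Let gainE (th : tuple) : cj_weight beta delta th != 0 -> sqrabs (cj_fun th z) = gain th.
Proof. by move=> /(cj_weight_neq0 beta0 delta0)[h _]; exact: sqrabs_cj_fun. Qed.

Let measurable_cutoff_gain c : 0 < c -> measurable_fun setT (fun th => cutoff c (gain th)).
Proof.
move=> c0; apply: (measurableT_comp (continuous_measurable_fun (continuous_cutoff c0))).
apply: measurable_prod => j _; apply: measurable_funD => //.
apply: measurable_funM => //.
by apply: (@measurable_coord _ _ (chi 0)); exact: measurable_chi0.
Qed.

Let integrable_cutoff (h : R -> R) C c : 0 < c -> continuous h ->
  (forall p, 0 <= p <= 1 -> `|h p| <= C) -> integrable (fun th => h (cutoff c (gain th))).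
Proof.
move=> c0 ch hC; apply: bounded_cj_integrable => //.
  exact: (measurableT_comp (continuous_measurable_fun ch) (measurable_cutoff_gain c0)).
by exists C => th; rewrite hC // cutoff_itv.
Qed.

Let expectationE (h : R -> R) c :
  cj_expectation beta delta (fun th : tuple => h (cutoff c (sqrabs (cj_fun th z)))) =
  integral (fun th => h (cutoff c (gain th))) / integral (fun=> 1).
Proof.
rewrite /cj_expectation /cj_integral; congr (_ / _).
  apply: eq_Rintegral => th _.
  have [->|w0] := eqVneq (cj_weight beta delta th) 0; first by rewrite !mulr0.
  by rewrite gainE.
by apply: eq_Rintegral => th _; rewrite mul1r.
Qed.

Let Z_ge0 : 0 <= integral (fun=> 1).
Proof. exact: cj_integral_ge0. Qed.

(* If the normalization vanishes, the left-hand side is [A / 0 = 0]. *)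
Let expectation_le (A c : R) : 0 <= c -> A <= c * integral (fun=> 1) -> A / integral (fun=> 1) <= c.
Proof.
move=> c0 Ac; have [->|Z0] := eqVneq (integral (fun=> 1)) 0; first by rewrite invr0 mulr0.
by rewrite ler_pdivrMr // lt_neqAle eq_sym Z0 Z_ge0.
Qed.

(** For [g >= 1], [cutoff 1 g] is [1 / g], and [1 - 1 / gain <= eps2 (y / N) * Q]. *)
Lemma cj_expectation_upper :
  cj_expectation beta delta (fun th : tuple => 1 - cutoff 1 (sqrabs (cj_fun th z)))
  <= eps2 (y / N) * (target / rate).
Proof.
have [iQ hQ] := @moment_sum_chi R n.+1 beta delta beta0 delta0 delta_gt.
have r0 := rate_gt0 beta0 delta0 delta_gt.
rewrite (expectationE (fun p => 1 - p)); apply: expectation_le.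
  by rewrite mulr_ge0 // divr_ge0 ?(ltW r0) // target_ge0.
have ch : continuous (fun p : R => 1 - p).
  by move=> p; apply: cvgB; [exact: cvg_cst|exact: cvg_id].
apply: (@le_trans _ _ (integral (fun th => eps2 (y / N) * Q th))).
  apply: le_cj_integral.
  - apply: (@integrable_cutoff (fun p => 1 - p) 1 1 ltr01 ch) => p /andP[p0 p1].
    by rewrite ger0_norm ?subr_ge0 // gerBl.
  - exact: cj_integrableZ.
  - move=> th _; rewrite /cutoff max_gain [1 + (gain th - 1)]addrC subrK mul1r.
    have g0 : 0 < gain th by rewrite (lt_le_trans ltr01).
    have := @prod_1D_subr1_le R _ (index_enum 'I_n.+1) (fun j => eps2 (y / N) * chi 0 (tnth th j)).
    rewrite -/(gain th) -mulr_sumr => h.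
    have : gain th - 1 <= gain th * (eps2 (y / N) * Q th).
      by apply: h => j; rewrite mulr_ge0 // chi_ge0.
    by rewrite -ler_pdivrMl // mulrBr mulr1 mulVf ?gt_eqF.
rewrite cj_integralZ // -mulrA ler_wpM2l //.
by rewrite mulrAC ler_pdivlMr // mulrC.
Qed.

Section lower.
Variables (M eta : R) (M0 : 0 < M) (eta0 : 0 < eta).
Let c2 := 4 * delta + beta / (4 * eta).
Let D := delta ^+ 2 + delta * beta / 4.

(** Apply [moment_cutoff_lower] at [s = M N^2] and divide by [N^2]. Its [psi] is not a function of
    the characteristic polynomial; it is replaced by the cutoff [p <= psi] of [gain], in the
    direction allowed by the monotonicity of [balance]. *)
Lemma cj_expectation_lower :
  - (2 * beta * D / (delta * rate) * eta) <=
  cj_expectation beta delta (fun th : tuple =>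
    balance (rate * M) (c2 * M) (delta * beta / 4)
      (cutoff (M * y ^+ 2) (sqrabs (cj_fun th z)))).
Proof.
have [iQ hQ] := @moment_sum_chi R n.+1 beta delta beta0 delta0 delta_gt.
have [iT hT] := @moment_sqr_kap R n.+1 beta delta beta0 delta0 delta_gt.
have r0 := rate_gt0 beta0 delta0 delta_gt.
have N0 : 0 < N by [].
have s0 : 0 < M * N ^+ 2 by rewrite mulr_gt0 // exprn_gt0.
have c0 : 0 < M * y ^+ 2 by rewrite mulr_gt0 // exprn_gt0.
have := @moment_cutoff_lower R n.+1 beta delta beta0 delta0 delta_gt _ eta s0 eta0.
have [s sE] : {s : R | s = M * N ^+ 2} by exists (M * N ^+ 2).
move: s0; rewrite -sE => s0 /=; rewrite -/c2.
set psi := (fun th => s / (s + Q th)) => main.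
pose h := balance (rate * M) (c2 * M) (delta * beta / 4).
rewrite (expectationE h) lerNl -mulNr.
have c20 : 0 <= c2 by rewrite addr_ge0 ?mulr_ge0 ?invr_ge0 ?mulr_ge0 // ltW.
have D0 : 0 <= D by rewrite addr_ge0 ?mulr_ge0 ?sqr_ge0 // ltW.
apply: expectation_le.
  exact: (mulr_ge0 (divr_ge0 (mulr_ge0 (mulr_ge0 (ler0n R 2) (ltW beta0)) D0)
    (mulr_ge0 (ltW delta0) (ltW r0))) (ltW eta0)).
pose p th := cutoff (M * y ^+ 2) (gain th).
have p01 th : 0 <= p th <= 1 by exact: cutoff_itv.
have rM : 0 <= rate * M by exact: mulr_ge0 (ltW r0) (ltW M0).
have cM : 0 <= c2 * M by exact: mulr_ge0 c20 (ltW M0).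
have db : 0 <= delta * beta / 4.
  exact: divr_ge0 (mulr_ge0 (ltW delta0) (ltW beta0)) (ler0n R 4).
have ihp : integrable (fun th => h (p th)).
  have hC q : 0 <= q <= 1 -> `|h q| <= rate * M + c2 * M + delta * beta / 4.
    exact: abs_balance_le.
  exact: (@integrable_cutoff h _ _ c0 (@continuous_balance _ _ _ _) hC).
(* With [c = M y^2 = s (y / N)^2], [psi] equals [c / (c + (y / N)^2 Q)], and
   [gain - 1 >= (y / N)^2 Q]. *)
have ppsi th : p th <= psi th.
  rewrite /p /psi /cutoff max_gain.
  have q0 := sum_chi0_ge0 (tnth th).
  have g0 := gain_ge1 th.
  have d1 : 0 < M * y ^+ 2 + (gain th - 1) by lra.
  rewrite ler_pdivrMr // mulrAC ler_pdivlMr; last by rewrite ltr_pwDl.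
  have hg : M * y ^+ 2 * Q th <= s * (gain th - 1).
    apply: (@le_trans _ _ (s * ((y / N) ^+ 2 * Q th))).
      rewrite sE; have -> : M * N ^+ 2 * ((y / N) ^+ 2 * Q th) = M * y ^+ 2 * Q th * (N / N) ^+ 2 by ring.
      by rewrite divff ?gt_eqF // expr1n mulr1.
    rewrite ler_pM2l //; apply: (@le_trans _ _ (eps2 (y / N) * Q th)).
      by rewrite ler_wpM2r // eps2_ge.
    by have := gain_ge th; lra.
  have -> : M * y ^+ 2 * (s + Q th) = s * (M * y ^+ 2) + M * y ^+ 2 * Q th by ring.
  by rewrite mulrDr lerD2l.
have psi01 th : 0 <= psi th <= 1.
  have q0 := sum_chi0_ge0 (tnth th).
  rewrite /psi divr_ge0 ?addr_ge0 ?(ltW s0) //= ler_pdivrMr ?ltr_pwDl // mul1r.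
  by rewrite lerDl.
have ipsi : integrable psi by exact: cj_integrable_psi.
have ip1 : integrable (fun th => s * (1 - psi th)) by exact: cj_integrable_1B_psi.
have ip2 : integrable (fun th => s * (1 - psi th) ^+ 2) by exact: cj_integrable_sqr_1B_psi.
have j1 : integrable (fun th => rate * (s * (1 - psi th))) by exact: cj_integrableZ.
have j2 : integrable (fun th => c2 * (s * (1 - psi th) ^+ 2)) by exact: cj_integrableZ.
have j4 : integrable (fun th => - target * psi th) by exact: cj_integrableZ.
have j12 := cj_integrableD j1 j2.
have j124 := cj_integrableD j12 j4.
have low : rate * integral (fun th => s * (1 - psi th))
   + c2 * integral (fun th => s * (1 - psi th) ^+ 2) + - target * integral psi <=
   N ^+ 2 * integral (fun th => h (p th)).
  rewrite -(cj_integralZ rate ip1) -(cj_integralZ c2 ip2) -(cj_integralZ (- target) ipsi).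
  rewrite -(cj_integralD j1 j2) -(cj_integralD j12 j4) -(cj_integralZ (N ^+ 2) ihp).
  apply: le_cj_integral => //; first exact: cj_integrableZ.
  move=> th _.
  have -> : N ^+ 2 * h (p th) = rate * (s * (1 - p th)) + c2 * (s * (1 - p th) ^+ 2)
     + - (delta * beta * N ^+ 2 / 4) * p th by rewrite /h /balance sE; field.
  have /andP[p0 p1] := p01 th; have /andP[q0 q1] := psi01 th; have pq := ppsi th.
  have t1 : rate * (s * (1 - psi th)) <= rate * (s * (1 - p th)).
    by rewrite ler_pM2l // ler_pM2l // lerB.
  have t2 : c2 * (s * (1 - psi th) ^+ 2) <= c2 * (s * (1 - p th) ^+ 2).
    rewrite ler_wpM2l // ler_pM2l // ler_pXn2r ?nnegrE ?subr_ge0 //.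
    by rewrite lerB.
  have t3 : delta * beta * N ^+ 2 / 4 * p th <= target * psi th.
    apply: ler_pM => //.
      by rewrite !mulr_ge0 ?exprn_ge0 ?invr_ge0 // ltW.
    by rewrite /target lerDr mulr_ge0 // sqr_ge0.
  by rewrite !mulNr; lra.
(* Chains [delta E T^2 <= 8 E Q], [rate E Q <= target] and [target <= D N^2]; the constant is
   [beta / 4 * 8 = 2 beta] times [D / (delta rate)]. *)
have hTZ : beta / 4 * eta * integral (fun th => sum_kap 0 (tnth th) ^+ 2) <=
   N ^+ 2 * (2 * beta * D / (delta * rate) * eta * integral (fun=> 1)).
  have tD : target <= D * N ^+ 2.
    rewrite /target /D.
    have N1 : 1 <= N by rewrite ler1n.
    have : delta ^+ 2 * N <= delta ^+ 2 * N ^+ 2.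
      by rewrite ler_wpM2l ?sqr_ge0 // expr2 ler_peMr // ltW.
    by lra.
  have -> : N ^+ 2 * (2 * beta * D / (delta * rate) * eta * integral (fun=> 1)) =
    beta / 4 * eta * (8 / (delta * rate) * (D * N ^+ 2 * integral (fun=> 1))).
    by field; rewrite !gt_eqF.
  rewrite ler_wpM2l //; first by rewrite !mulr_ge0 ?invr_ge0 // ltW.
  have -> : 8 / (delta * rate) * (D * N ^+ 2 * integral (fun=> 1)) =
    8 * (D * N ^+ 2 * integral (fun=> 1) / rate) / delta by field; rewrite !gt_eqF.
  rewrite ler_pdivlMr // mulrC; apply: (le_trans hT).
  rewrite ler_pM2l // ler_pdivlMr // mulrC; apply: (le_trans hQ).
  by rewrite ler_wpM2r.
have N20 : 0 < N ^+ 2 by rewrite exprn_gt0.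
by rewrite -(ler_pM2l N20) mulrN; lra.
Qed.

End lower.
End finite_ensemble_bounds.

(** * The limit in law *)

Section law_limit.
Context {R : realType} {d : measure_display} {Omega : measurableType d}.
Variables (P : probability Omega R) (beta delta : R) (xi : Omega -> @cfun R).
Hypotheses (rxi : random_entire xi) (lxi : cj_cvg_in_law P beta delta xi).
Implicit Types (c y : R) (h : R -> R).

Lemma measurable_sqrabs_xi (z : R[i]) : measurable_fun setT (fun w => sqrabs (xi w z)).
Proof.
have [_ /(_ z)[mRe mIm]] := rxi.
by rewrite /sqrabs; apply: measurable_funD; apply: measurable_funX.
Qed.

Lemma measurable_cutoff_xi c (z : R[i]) h : 0 < c -> continuous h ->
  measurable_fun setT (fun w => h (cutoff c (sqrabs (xi w z)))).
Proof.
move=> c0 ch; apply: (measurableT_comp (continuous_measurable_fun ch)).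
apply: (measurableT_comp (continuous_measurable_fun (continuous_cutoff c0))).
exact: measurable_sqrabs_xi.
Qed.

Lemma bounded_integrable_prob (f : Omega -> R) C : measurable_fun setT f ->
  (forall w, `|f w| <= C) -> P.-integrable setT (EFin \o f).
Proof.
move=> mf fC; apply: measurable_bounded_integrable => //.
  by rewrite [X in (X < _)%E]probability_setT ltry.
exists C; split; first exact: num_real.
by move=> M CM w _ /=; rewrite (le_trans (fC _)) // ltW.
Qed.

Lemma integrable_cutoff_xi h C c (z : R[i]) : 0 < c -> continuous h ->
  (forall p, 0 <= p <= 1 -> `|h p| <= C) ->
  P.-integrable setT (EFin \o (fun w => h (cutoff c (sqrabs (xi w z))))).
Proof.
move=> c0 ch hC; apply: (@bounded_integrable_prob _ C).
  exact: measurable_cutoff_xi.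
by move=> w; rewrite hC // cutoff_itv.
Qed.

Lemma cj_expectation_cvg h C c (z : R[i]) : 0 < c -> continuous h ->
  (forall p, 0 <= p <= 1 -> `|h p| <= C) ->
  (fun n => @cj_expectation R n.+1 beta delta
     (fun th => h (cutoff c (sqrabs (cj_fun th z))))) @ \oo -->
  \int[P]_w h (cutoff c (sqrabs (xi w z))).
Proof.
move=> c0 ch hC.
pose Phi (f : @cfun R) := h (cutoff c (sqrabs (f z))).
have cPhi : {within entire (R:=R), continuous Phi}.
  apply: continuous_subspaceT => f.
  have cs : (fun f : @cfun R => sqrabs (f z)) @ f --> sqrabs (f z).
    have h0 := @eval_cfun_continuous R z f.
    by apply: (@cvg_sqrabs R _ (nbhs f) _ (fun f : @cfun R => f z)); exact h0.
  have cc : (fun f : @cfun R => cutoff c (sqrabs (f z))) @ f --> cutoff c (sqrabs (f z)).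
    by apply: (cvg_comp _ _ cs); exact: continuous_cutoff.
  by apply: (cvg_comp _ _ cc); exact: ch.
have bPhi : exists M : R, forall f, entire f -> `|Phi f| <= M.
  by exists C => f _; rewrite hC // cutoff_itv.
have := lxi cPhi bPhi.
rewrite unlock => hE.
have fE : (\int[P]_w (Phi (xi w))%:E)%E =
    (\int[P]_w h (cutoff c (sqrabs (xi w z))))%:E.
  rewrite /Rintegral fineK //.
  exact: integrable_fin_num (integrable_cutoff_xi z c0 ch hC).
rewrite fE in hE.
have h1 : (fun n => @cj_expectation R n beta delta (fun th => Phi (cj_fun th)))
    @ \oo --> \int[P]_w h (cutoff c (sqrabs (xi w z))) by exact: fine_cvg hE.
(* Drops the term [N = 0]. *)
by move: h1; rewrite -cvg_shiftS.
Qed.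

Hypotheses (beta0 : 0 < beta) (delta_gt : 1 < 2 * delta).
Let delta0 : 0 < delta. Proof. by move: delta_gt; lra. Qed.
Local Notation rate := (rate beta delta).
Local Notation z y := ('i%R * y%:C%C).

Lemma ler_cvgr (u v : R^nat) (a b : R) : u @ \oo --> a -> v @ \oo --> b ->
  (forall n, u n <= v n) -> a <= b.
Proof.
move=> ua vb uv; rewrite -(cvg_lim _ ua) // -(cvg_lim _ vb) //.
apply: ler_lim; [by apply/cvg_ex; exists a|by apply/cvg_ex; exists b|exact: nearW].
Qed.

Lemma law_upper y : 0 < y ->
  \int[P]_w (1 - cutoff 1 (sqrabs (xi w (z y)))) <= y ^+ 2 * (delta * beta / 4 / rate).
Proof.
move=> y0.
have r0 := rate_gt0 beta0 delta0 delta_gt.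
have ch : continuous (fun p : R => 1 - p).
  by move=> p; apply: cvgB; [exact: cvg_cst|exact: cvg_id].
have hcvg : (fun n => @cj_expectation R n.+1 beta delta
     (fun th => 1 - cutoff 1 (sqrabs (cj_fun th (z y))))) @ \oo -->
  \int[P]_w (1 - cutoff 1 (sqrabs (xi w (z y)))).
  apply: (@cj_expectation_cvg (fun p => 1 - p) 1 1 (z y) ltr01 ch) => p /andP[p0 p1].
  by rewrite ger0_norm ?subr_ge0 // gerBl.
(* Comes from [eps2 u <= e^u u^2] at [u = y / N]: the [N^2] cancels against [target], leaving
   [delta^2 / N + delta beta / 4]. *)
pose v n := expR (y * harmonic n) * (y ^+ 2 * ((delta ^+ 2 * harmonic n + delta * beta / 4) / rate)).
apply: (ler_cvgr (v := v) hcvg).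
  rewrite -[X in _ --> X]mul1r; apply: cvgM.
    rewrite -[X in _ --> X]expR0.
    apply: (@cvg_comp _ _ _ (fun n => y * harmonic n) expR \oo (nbhs 0)); last exact: continuous_expR.
    have : (fun n => y * harmonic n) @ \oo --> y * 0.
      by apply: cvgM; [exact: cvg_cst|exact: cvg_harmonic].
    by rewrite mulr0.
  apply: cvgM; first exact: cvg_cst.
  apply: cvgM; last exact: cvg_cst.
  rewrite -[X in _ --> X]add0r; apply: cvgD; last exact: cvg_cst.
  by rewrite -[X in _ --> X](mulr0 (delta ^+ 2)); apply: cvgM; [exact: cvg_cst|exact: cvg_harmonic].
move=> n; apply: (le_trans (cj_expectation_upper beta0 delta_gt y0)).
have u0 : 0 <= y / n.+1%:R by rewrite divr_ge0 // ltW.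
apply: (@le_trans _ _ (expR (y / n.+1%:R) * (y / n.+1%:R) ^+ 2 * (@target R n.+1 beta delta / rate))).
  rewrite ler_wpM2r ?eps2_le //.
  by rewrite divr_ge0 ?(ltW r0) // target_ge0.
rewrite /v /= -mulrA ler_pM2l ?expR_gt0 // /target.
have n0 : n.+1%:R != 0 :> R by rewrite pnatr_eq0.
rewrite le_eqVlt; apply/orP; left; apply/eqP.
move: n.+1%:R n0 => N N0; field; rewrite N0 gt_eqF //.
Qed.

Lemma law_lower y M eta : 0 < y -> 0 < M -> 0 < eta ->
  - (2 * beta * (delta ^+ 2 + delta * beta / 4) / (delta * rate) * eta) <=
  \int[P]_w balance (rate * M) ((4 * delta + beta / (4 * eta)) * M) (delta * beta / 4)
    (cutoff (M * y ^+ 2) (sqrabs (xi w (z y)))).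
Proof.
move=> y0 M0 eta0.
have r0 := rate_gt0 beta0 delta0 delta_gt.
set c2 := 4 * delta + beta / (4 * eta).
have c20 : 0 <= c2 by rewrite addr_ge0 ?mulr_ge0 ?invr_ge0 ?mulr_ge0 // ltW.
pose h := balance (rate * M) (c2 * M) (delta * beta / 4).
have c0 : 0 < M * y ^+ 2 by rewrite mulr_gt0 // exprn_gt0.
have rM : 0 <= rate * M by exact: mulr_ge0 (ltW r0) (ltW M0).
have cM : 0 <= c2 * M by exact: mulr_ge0 c20 (ltW M0).
have db : 0 <= delta * beta / 4.
  exact: divr_ge0 (mulr_ge0 (ltW delta0) (ltW beta0)) (ler0n R 4).
have hcvg : (fun n => @cj_expectation R n.+1 beta delta
     (fun th => h (cutoff (M * y ^+ 2) (sqrabs (cj_fun th (z y)))))) @ \oo -->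
  \int[P]_w h (cutoff (M * y ^+ 2) (sqrabs (xi w (z y)))).
  have hC q : 0 <= q <= 1 -> `|h q| <= rate * M + c2 * M + delta * beta / 4.
    exact: abs_balance_le.
  exact: (@cj_expectation_cvg h _ _ (z y) c0 (@continuous_balance _ _ _ _) hC).
apply: (@ler_cvgr (fun=> _) _ _ _ _ hcvg); first exact: cvg_cst.
by move=> n; exact: cj_expectation_lower.
Qed.

End law_limit.

(** * The zeros of the limit *)

Section zeta_product.
Context {R : realType}.
Local Open Scope complex_scope.
Variable f : @cfun R.
Hypothesis f0 : f 0 = 1.
Local Notation A r := (zeros f `&` [set x | `|x| < r]).
Hypothesis fprod : forall z : R[i],
  (\big[*%R/1]_(x \in A r) (1 - z / x%:C) : R[i]^o) @[r --> +oo%R] --> (f z : R[i]^o).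

Lemma sqrabs_1B_imag (y x : R) : sqrabs (1 - 'i%R * y%:C / x%:C) = 1 + y ^+ 2 * (1 / x ^+ 2).
Proof.
have -> : 'i%R * y%:C / x%:C = 0 +i* (y / x).
  rewrite -mulrA -fmorphV -rmorphM -complexiE /=.
  apply/eqP; rewrite eq_complex /= !(mul0r, mul1r, mulr0, subr0, addr0). by rewrite add0r !eqxx.
by rewrite /sqrabs /= subr0 sub0r sqrrN expr1n exprMn exprVn div1r.
Qed.

(* The finitely supported product over an infinite set is 1 by convention,
   so infinitely many zeros in a disc would make [f] constantly 1. *)
Lemma finite_zeros r : finite_set (A r).
Proof.
apply: contrapT => inf.
have nz x : zeros f x -> x != 0.
  by move=> zx; apply/eqP => x0; move: zx; rewrite x0 /zeros /= f0 => /eqP; rewrite oner_eq0.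
have [x [zx xr]] : exists x, A r x.
  apply: contrapT => /forallNP h; apply: inf.
  by rewrite (_ : A r = set0) //; apply/seteqP; split => // x /h.
have h1 : (fun s : R => \big[*%R/1]_(x0 \in A s) (1 - x%:C / x0%:C) : R[i]^o) @ +oo%R --> (1 : R[i]^o).
  apply: (@cvg_trans _ ((fun=> (1 : R[i]^o)) @ (+oo%R : set_system R))); last exact: cvg_cst.
  apply: near_eq_cvg; near=> s.
  rewrite no_finite_support ?big_nil //.
  apply: (@sub_infinite_set _ (A r)) => [t [zt tr]|//]; split.
    split => //=; apply: (lt_le_trans tr).
    by near: s; apply: nbhs_pinfty_ge; exact: num_real.
  rewrite /= => /eqP; rewrite -subr_eq0 addrC addKr oppr_eq0 mulf_eq0 invr_eq0.
  by rewrite !eq_complex /= eqxx !andbT !(negbTE (nz _ _)).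
have E : f x%:C = 1 :> R[i]^o.
  exact (@cvg_unique (R[i]^o) (@norm_hausdorff _ (R[i]^o)) _ _ _ _ (@fprod x%:C) h1).
by move: zx; rewrite /zeros /= E => /eqP; rewrite oner_eq0.
Unshelve. all: by end_near. Qed.

Let partial_sum (r : R) : R := \sum_(x <- fset_set (A r)) 1 / x ^+ 2.

Lemma cvg_prod_1D (y : R) :
  (fun r : R => \prod_(x <- fset_set (A r)) (1 + y ^+ 2 * (1 / x ^+ 2))) @ +oo%R -->
  sqrabs (f ('i%R * y%:C)).
Proof.
have E : (fun r : R => sqrabs (\big[*%R/1]_(x \in A r) (1 - 'i%R * y%:C / x%:C))) =
    (fun r => \prod_(x <- fset_set (A r)) (1 + y ^+ 2 * (1 / x ^+ 2))).
  apply/funext => r; rewrite fsbig_finite; last exact: finite_zeros.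
  by rewrite sqrabs_prod; apply: eq_bigr => x _; rewrite sqrabs_1B_imag.
by rewrite -E; exact: cvg_sqrabs (@fprod ('i%R * y%:C)).
Qed.

Let inv_sqr_ge0 (x : R) : 0 <= 1 / x ^+ 2.
Proof. by rewrite divr_ge0 // sqr_ge0. Qed.

Let partial_sumE r : (partial_sum r)%:E = (\sum_(x \in A r) (1 / x ^+ 2)%:E)%E.
Proof. by rewrite fsbig_finite ?sumEFin //; exact: finite_zeros. Qed.

Lemma fsum_le_partial_sum (X : set R) : fsets (zeros f) X ->
  exists r0 : R, forall r, r0 <= r ->
    (\sum_(x \in X) (1 / x ^+ 2)%:E <= (partial_sum r)%:E)%E.
Proof.
(* A radius larger than the modulus of each point of the finite set [X]. *)
move=> [finX Xz]; exists (1 + \sum_(x <- fset_set X) `|x|) => r rX.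
rewrite partial_sumE; apply: lee_fsum_nneg_subset => //; first exact: finite_zeros.
  move=> x; rewrite !inE => Xx; split; first exact: Xz.
  rewrite /=; apply: lt_le_trans rX.
  rewrite (big_fsetD1 x) /=; last by rewrite in_fset_set // inE.
  have : 0 <= \sum_(i <- (fset_set X `\ x)%fset) `|i| by apply: sumr_ge0.
  lra.
by move=> x _; rewrite lee_fin.
Qed.

Lemma partial_sum_le (y r : R) : y ^+ 2 * partial_sum r <= sqrabs (f ('i%R * y%:C)) - 1.
Proof.
have c := @cvg_prod_1D y.
rewrite lerBrDl -(cvg_lim _ c) //.
apply: limr_ge; first by apply/cvg_ex; exists (sqrabs (f ('i%R * y%:C))).
near=> s; apply: (@le_trans _ _ (1 + y ^+ 2 * partial_sum s)).
  rewrite lerD2l ler_wpM2l ?sqr_ge0 // -lee_fin !partial_sumE.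
  apply: lee_fsum_nneg_subset => //; try exact: finite_zeros.
    move=> x; rewrite !inE => -[zx xr]; split => //=.
    by apply: (lt_le_trans xr); near: s; apply: nbhs_pinfty_ge; exact: num_real.
  by move=> x _; rewrite lee_fin.
rewrite mulr_sumr; apply: prod_1D_ge => x.
by rewrite mulr_ge0 ?sqr_ge0.
Unshelve. all: by end_near. Qed.

(** Both bounds pass to the limit from [1 + sum a <= prod (1 + a) <= exp (sum a)] over the zeros in
    a disc. The lower one, at [y = 1], already shows that the sum is finite. *)
Lemma zeta_esum : exists s : R, [/\ 0 <= s,
  (\esum_(x in zeros f) (1 / x ^+ 2)%:E = s%:E)%E &
  forall y : R, 1 + y ^+ 2 * s <= sqrabs (f ('i%R * y%:C)) <= expR (y ^+ 2 * s)].
Proof.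
set S := esum _ _.
have S0 : (0 <= S)%E by apply: esum_ge0 => x _; rewrite lee_fin.
have Sle (y : R) : 0 < y -> (S <= ((sqrabs (f ('i%R * y%:C)) - 1) / y ^+ 2)%:E)%E.
  move=> y0; apply: ub_ereal_sup => _ [X fX <-].
  have [r0 h] := fsum_le_partial_sum fX.
  apply: (le_trans (h r0 (lexx _))).
  rewrite lee_fin ler_pdivlMr ?exprn_gt0 // mulrC.
  exact: partial_sum_le.
have Sfin : S \is a fin_num.
  by rewrite ge0_fin_numE // (le_lt_trans (Sle 1 ltr01)) // ltry.
exists (fine S); split; [exact: fine_ge0|by rewrite fineK|].
move=> y; apply/andP; split.
  have [->|y0] := eqVneq y 0.
    by rewrite mulr0 f0 sqrabs1 expr0n mul0r addr0.
  have y2 : 0 < y ^+ 2 by rewrite exprn_even_gt0.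
  rewrite -lerBrDl mulrC -ler_pdivlMr // -lee_fin fineK //.
  apply: ub_ereal_sup => _ [X fX <-].
  have [r0 h] := fsum_le_partial_sum fX.
  apply: (le_trans (h r0 (lexx _))).
  rewrite lee_fin ler_pdivlMr // mulrC.
  exact: partial_sum_le.
have c := @cvg_prod_1D y.
rewrite -(cvg_lim _ c) //.
apply: limr_le; first by apply/cvg_ex; exists (sqrabs (f ('i%R * y%:C))).
apply: nearW => r; apply: (@le_trans _ _ (expR (y ^+ 2 * partial_sum r))).
  rewrite mulr_sumr expR_sum; apply: ler_prod => x _.
  apply/andP; split; last exact: expR_ge1Dx.
  exact: (addr_ge0 ler01 (mulr_ge0 (sqr_ge0 y) (inv_sqr_ge0 x))).
rewrite ler_expR ler_wpM2l ?sqr_ge0 // -lee_fin fineK // partial_sumE.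
apply: ereal_sup_ubound; exists (A r) => //; split; first exact: finite_zeros.
by move=> x [].
Qed.

End zeta_product.

Section null_set.
Local Open Scope ereal_scope.
Import HBNNSimple.

(* No measurability of [f] is needed, the integral of a nonnegative function
   being a supremum over simple functions below it. *)
Lemma ge0_integral_setC_null d (T : measurableType d) (R : realType)
    (mu : {measure set T -> \bar R}) (N : set T) (f : T -> \bar R) :
  measurable N -> mu N = 0 -> (forall x, 0 <= f x) ->
  \int[mu]_x f x = \int[mu]_(x in ~` N) f x.
Proof.
move=> mN N0 f0; have mNC : measurable (~` N) by exact: measurableC.
rewrite [RHS]integral_mkcond !ge0_integralTE //; last first.
  by move=> x; rewrite patchE; case: ifP.
apply/eqP; rewrite eq_le; apply/andP; split.
  apply: ub_ereal_sup => _ [h hf <-].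
  rewrite -integralT_nnsfun.
  rewrite (ge0_negligible_integral mN) //; last 2 first.
  - by apply/measurable_EFinP.
  - by move=> x _; rewrite lee_fin.
  rewrite setTD integral_mkcond.
  apply: ereal_sup_ubound; exists (proj_nnsfun h mNC).
    move=> x /=; rewrite mindicE patchE; case: ifPn => xN.
      by rewrite mulr1.
    by rewrite mulr0.
  rewrite -integralT_nnsfun; apply: eq_integral => x _ /=.
  by rewrite mindicE patchE; case: ifPn => xN; rewrite ?mulr1 ?mulr0.
apply: le_ereal_sup => _ [h hf <-]; exists h => // x.
by apply: (le_trans (hf x)); rewrite patchE; case: ifP.
Qed.

End null_set.

Lemma cvg_Rintegral_dominated d (T : measurableType d) (R : realType)
    (mu : {measure set T -> \bar R}) (D : set T) (f_ : nat -> T -> R) (f g : T -> R) :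
  measurable D -> (forall k, measurable_fun D (f_ k)) ->
  (forall x, D x -> f_ ^~ x @ \oo --> f x) ->
  mu.-integrable D (EFin \o g) -> (forall k x, D x -> `|f_ k x| <= g x) ->
  mu.-integrable D (EFin \o f) /\
  (fun k => \int[mu]_(x in D) f_ k x) @ \oo --> \int[mu]_(x in D) f x.
Proof.
move=> mD mf ff ig fg.
have mlim : measurable_fun D f by exact: (measurable_fun_cvg mf).
have ffE x : D x -> (fun k => (f_ k x)%:E) @ \oo --> (f x)%:E.
  by move=> Dx; apply: cvg_EFin; [exact: nearW|exact: ff].
have mfE k : measurable_fun D (fun x => (f_ k x)%:E) by exact/measurable_EFinP.
have mlimE : measurable_fun D (EFin \o f) by exact/measurable_EFinP.
have fgE x k : D x -> (`|(f_ k x)%:E| <= (g x)%:E)%E by move=> Dx; rewrite lee_fin fg.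
have [i1 _ c1] := @dominated_convergence _ _ _ mu _ mD _ _ _ mfE mlimE (aeW _ ffE) ig (aeW _ fgE).
split=> //; apply: (@fine_cvg _ _ _ _ (fun k => \int[mu]_(x in D) (f_ k x)%:E)%E).
by rewrite fineK; [exact: c1|exact: integrable_fin_num i1].
Qed.

(** * The expectation of the sum of inverse squares *)

Section assembly.
Context {R : realType} {d : measure_display} {Omega : measurableType d}.
Variables (P : probability Omega R) (beta delta : R) (xi : Omega -> @cfun R).
Hypotheses (beta0 : 0 < beta) (delta_gt : 1 < 2 * delta).
Hypothesis hp : hua_pickrell_zeta P beta delta xi.
Let delta0 : 0 < delta. Proof. by move: delta_gt; lra. Qed.
Let r0 := rate_gt0 beta0 delta0 delta_gt.
Local Notation rate := (rate beta delta).
Local Notation z y := ('i%R * y%:C%C).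
Local Notation G y w := (sqrabs (xi w (z y))).

Variables (N : set Omega) (mN : measurable N) (N0 : P N = 0%E) (sigma : Omega -> R).
Hypothesis sigma0 : forall w, (~` N) w -> 0 <= sigma w.
Hypothesis G_sigma : forall w, (~` N) w -> forall y,
  1 + y ^+ 2 * sigma w <= G y w <= expR (y ^+ 2 * sigma w).

Let D := ~` N.
Let mD : measurable D. Proof. exact: measurableC. Qed.

Let maxG w y : D w -> Num.max 1 (G y w) = G y w.
Proof.
move=> Dw; apply/max_idPr; have /andP[h _] := G_sigma Dw y.
by apply: le_trans h; rewrite lerDl mulr_ge0 ?sqr_ge0 // sigma0.
Qed.

Let cvg_h2 : (fun k => harmonic k ^+ 2 : R) @ \oo --> (0 : R).
Proof.
have : (fun k => harmonic k * harmonic k : R) @ \oo --> (0 * 0 : R).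
  by apply: cvgM; exact: cvg_harmonic.
by rewrite mul0r.
Qed.

Let cvg_exp w : (fun k => expR (harmonic k ^+ 2 * sigma w)) @ \oo --> (1 : R).
Proof.
have h : (fun k => harmonic k ^+ 2 * sigma w) @ \oo --> 0 * sigma w.
  by apply: cvgM; [exact: cvg_h2|exact: cvg_cst].
rewrite mul0r in h; rewrite -[X in _ --> X]expR0.
by apply: (cvg_comp _ _ h); exact: continuous_expR.
Qed.

Let cvg_quotient w : D w ->
  (fun k => (G (harmonic k) w - 1) / harmonic k ^+ 2) @ \oo --> sigma w.
Proof.
move=> Dw; have s0 := sigma0 Dw.
apply: (@squeeze_cvgr _ _ _ _ (fun=> sigma w)
  (fun k => sigma w * expR (harmonic k ^+ 2 * sigma w))).
- near=> k; have h0 : 0 < (harmonic k ^+ 2 : R) by rewrite exprn_gt0 // harmonic_gt0.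
  have /andP[h1 h2] := G_sigma Dw (harmonic k).
  rewrite ler_pdivlMr // ler_pdivrMr //; apply/andP; split; first by lra.
  set x := harmonic k ^+ 2 * sigma w in h1 h2 *.
  (* [1 - x <= e^-x] gives [e^x - 1 <= x e^x], hence the upper function of the squeeze. *)
  have h3 := expR_ge1Dx (- x); have h4 := expR_gt0 x.
  have E : expR x * expR (- x) = 1 by rewrite -expRD subrr expR0.
  have -> : sigma w * expR x * harmonic k ^+ 2 = expR x * x by rewrite /x; ring.
  have : expR x * (1 + - x) <= expR x * expR (- x) by rewrite ler_pM2l.
  by rewrite E; lra.
- exact: cvg_cst.
- rewrite -[X in _ --> X]mulr1; apply: cvgM; first exact: cvg_cst.
  exact: cvg_exp.
Unshelve. all: by end_near. Qed.

Let cvg_G w : D w -> (fun k => G (harmonic k) w) @ \oo --> (1 : R).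
Proof.
move=> Dw.
have h : (fun k => 1 + (G (harmonic k) w - 1) / harmonic k ^+ 2 * harmonic k ^+ 2)
    @ \oo --> 1 + sigma w * 0.
  apply: cvgD; first exact: cvg_cst.
  by apply: cvgM; [exact: cvg_quotient|exact: cvg_h2].
rewrite mulr0 addr0 in h; apply: cvg_trans h; apply: near_eq_cvg; near=> k.
rewrite divfK ?gt_eqF ?exprn_gt0 // ?harmonic_gt0 //; ring.
Unshelve. all: by end_near. Qed.

(** The sum over the zeros becomes measurable off [N] as a limit of evaluations of [xi]. *)
Lemma measurable_sigma : measurable_fun D sigma.
Proof.
apply: (@measurable_fun_cvg _ _ _ D (fun k w => (G (harmonic k) w - 1) / harmonic k ^+ 2)).
  move=> k; apply: measurable_funM => //; apply: measurable_funB => //.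
  by apply: measurable_funTS; exact: (measurable_sqrabs_xi (hp_random_entire hp)).
exact: cvg_quotient.
Qed.

(** Fatou along [y = 1 / (k + 1)]: the functions [(1 - 1 / G) / y^2] are nonnegative, tend to
    [sigma], and [law_upper] bounds their expectations by a constant. *)
Lemma integral_sigma_le :
  (\int[P]_(w in D) (sigma w)%:E <= (delta * beta / 4 / rate)%:E)%E.
Proof.
have ch : continuous (fun p : R => 1 - p).
  by move=> p; apply: cvgB; [exact: cvg_cst|exact: cvg_id].
pose f (k : nat) (w : Omega) : R := (1 - cutoff 1 (G (harmonic k) w)) / harmonic k ^+ 2.
have mf k : measurable_fun setT (f k).
  apply: measurable_funM => //.
  exact: (measurable_cutoff_xi (hp_random_entire hp) (z (harmonic k)) ltr01 ch).
have f0 k w : 0 <= f k w.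
  rewrite divr_ge0 ?sqr_ge0 // subr_ge0.
  by have /andP[] := @cutoff_itv R 1 (G (harmonic k) w) ltr01.
apply: (@integral_cvg_le _ _ _ P D (fun k w => (f k w)%:E)) => //.
- by move=> k; apply/measurable_EFinP/measurable_funTS.
- by move=> k w _; rewrite lee_fin.
- move=> w Dw; suff H : (fun k => f k w) @ \oo --> sigma w.
    by apply: cvg_EFin; [exact: nearW|exact: H].
  have h : (fun k => (G (harmonic k) w - 1) / harmonic k ^+ 2 * (G (harmonic k) w)^-1)
      @ \oo --> sigma w * 1^-1.
    by apply: cvgM; [exact: cvg_quotient|apply: cvgV => //; exact: cvg_G].
  rewrite invr1 mulr1 in h; apply: cvg_trans h; apply: near_eq_cvg; near=> k.
  rewrite /f /cutoff maxG // [1 + (_ - 1)]addrC subrK.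
  have g0 : 0 < G (harmonic k) w.
    have /andP[h1 _] := G_sigma Dw (harmonic k); apply: lt_le_trans h1.
    by rewrite ltr_pwDl // mulr_ge0 ?sqr_ge0 // sigma0.
  have h0 : harmonic k != 0 :> R by rewrite gt_eqF // harmonic_gt0.
  have g1 : G (harmonic k) w != 0 by rewrite gt_eqF.
  move: (G (harmonic k) w) g1 => g g1; move: (harmonic k : R) h0 => h' h0.
  by field; rewrite h0 g1.
- move=> k; apply: (@le_trans _ _ (\int[P]_w (f k w)%:E)%E).
    by apply: ge0_subset_integral => //; [exact/measurable_EFinP|move=> w _; rewrite lee_fin].
  have h0 : 0 < (harmonic k : R) by exact: harmonic_gt0.
  have h20 : 0 < (harmonic k ^+ 2 : R) by rewrite exprn_gt0.
  have bnd p : 0 <= p <= 1 -> `|1 - p| <= (1 : R).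
    by move=> /andP[p0 p1]; rewrite ger0_norm ?subr_ge0 // gerBl.
  have ic := @integrable_cutoff_xi R d Omega P xi (hp_random_entire hp)
    (fun p => 1 - p) 1 1 (z (harmonic k)) ltr01 ch bnd.
  have hu := law_upper (hp_random_entire hp) (hp_cvg_in_law hp) beta0 delta_gt h0.
  have : (\int[P]_w (1 - cutoff 1 (G (harmonic k) w))) / harmonic k ^+ 2 <=
      delta * beta / 4 / rate by rewrite ler_pdivrMr // [X in _ <= X]mulrC.
  rewrite -lee_fin; apply: le_trans; rewrite le_eqVlt; apply/orP; left; apply/eqP.
  rewrite [X in _ = X%:E]mulrC EFinM /Rintegral fineK; last exact: integrable_fin_num ic.
  rewrite -integralZl //; apply: eq_integral => w _.
  by rewrite -EFinM mulrC.
Unshelve. all: by end_near. Qed.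

Let integrable_sigma : P.-integrable D (EFin \o sigma).
Proof.
apply/integrableP; split; first exact/measurable_EFinP/measurable_sigma.
apply: le_lt_trans (ltry (delta * beta / 4 / rate)); apply: le_trans integral_sigma_le.
rewrite le_eqVlt; apply/orP; left; apply/eqP; apply: eq_integral => w /set_mem Dw /=.
by rewrite ger0_norm // sigma0.
Qed.

Let penalty := 2 * beta * (delta ^+ 2 + delta * beta / 4) / (delta * rate).

Let P_D : P D = 1%E.
Proof. by rewrite probability_setC // N0 sube0. Qed.

(** Bounded convergence as [y -> 0]. The choice [c = M y^2] turns the cutoff of [G] into
    [M / (M + (G - 1) / y^2)], whose limit keeps the truncation at level [M]. *)
Lemma sigma_cutoff_lower M eta : 0 < M -> 0 < eta ->
  - (penalty * eta) <= \int[P]_(w in D)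
    balance (rate * M) ((4 * delta + beta / (4 * eta)) * M) (delta * beta / 4)
      (M / (M + sigma w)).
Proof.
move=> M0 eta0.
set c2 := 4 * delta + beta / (4 * eta).
have c20 : 0 <= c2 by rewrite addr_ge0 ?mulr_ge0 ?invr_ge0 ?mulr_ge0 // ltW.
pose h := balance (rate * M) (c2 * M) (delta * beta / 4).
have ch : continuous h by exact: continuous_balance.
pose C := rate * M + c2 * M + delta * beta / 4.
have rM : 0 <= rate * M by exact: mulr_ge0 (ltW r0) (ltW M0).
have cM : 0 <= c2 * M by exact: mulr_ge0 c20 (ltW M0).
have db : 0 <= delta * beta / 4.
  exact: divr_ge0 (mulr_ge0 (ltW delta0) (ltW beta0)) (ler0n R 4).
have hC q : 0 <= q <= 1 -> `|h q| <= C by exact: abs_balance_le.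
pose c k : R := M * harmonic k ^+ 2.
have c0 k : 0 < c k by rewrite mulr_gt0 // exprn_gt0 // harmonic_gt0.
pose f (k : nat) (w : Omega) : R := h (cutoff (c k) (G (harmonic k) w)).
have mf k : measurable_fun setT (f k).
  exact: (measurable_cutoff_xi (hp_random_entire hp) (z (harmonic k)) (c0 k) ch).
have fC k w : `|f k w| <= C by apply: hC; exact: cutoff_itv.
have iC : P.-integrable D (EFin \o cst C).
  apply: measurable_bounded_integrable => //.
    by rewrite [X in (X < _)%E]P_D ltry.
  by exists C; split; [exact: num_real|move=> K /ltW CK w _ /=; rewrite (le_trans _ CK) // ger0_norm // (le_trans _ (hC 0 _)) // lexx ler01].
have flim w : D w -> f ^~ w @ \oo --> h (M / (M + sigma w)).
  move=> Dw; have s0 := sigma0 Dw.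
  suff hc : (fun k => cutoff (c k) (G (harmonic k) w)) @ \oo --> M / (M + sigma w).
    by apply: (cvg_comp _ _ hc); exact: ch.
  have hl : (fun k => M / (M + (G (harmonic k) w - 1) / harmonic k ^+ 2)) @ \oo
      --> M / (M + sigma w).
    apply: cvgM; first exact: cvg_cst.
    apply: cvgV; first by rewrite gt_eqF // ltr_pwDl.
    by apply: cvgD; [exact: cvg_cst|exact: cvg_quotient].
  apply: cvg_trans hl; apply: near_eq_cvg; near=> k.
  rewrite /cutoff maxG // /c.
  have g1 : 1 <= G (harmonic k) w.
    have /andP[h1 _] := G_sigma Dw (harmonic k); apply: le_trans h1.
    by rewrite lerDl mulr_ge0 ?sqr_ge0.
  have h0 : 0 < (harmonic k : R) by exact: harmonic_gt0.
  move: (G (harmonic k) w) g1 => g g1; move: (harmonic k : R) h0 => h' h0.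
  have h20 : 0 < h' ^+ 2 by rewrite exprn_gt0.
  have d1 : 0 < M * h' ^+ 2 + (g - 1) by rewrite ltr_pwDl ?mulr_gt0 // subr_ge0.
  have -> : M + (g - 1) / h' ^+ 2 = (M * h' ^+ 2 + (g - 1)) / h' ^+ 2.
    by rewrite [RHS]mulrDl mulfK // gt_eqF.
  by rewrite invf_div mulrA.
have [_ cint] := @cvg_Rintegral_dominated _ _ _ P D f (fun w => h (M / (M + sigma w)))
  (cst C) mD (fun k => measurable_funTS (mf k)) flim iC (fun k w _ => fC k w).
have ccst : (fun _ : nat => - (penalty * eta)) @ \oo --> - (penalty * eta) by exact: cvg_cst.
apply: (ler_cvgr ccst cint) => k.
have ifk : P.-integrable setT (EFin \o f k) by exact: (bounded_integrable_prob P (mf k) (fC k)).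
have -> : \int[P]_(w in D) f k w = \int[P]_w f k w.
  by rewrite /Rintegral (negligible_integral mN measurableT ifk N0) setTD.
exact: (law_lower (hp_random_entire hp) (hp_cvg_in_law hp) beta0 delta_gt
  (harmonic_gt0 k) M0 eta0).
Unshelve. all: by end_near. Qed.

(** Let [M -> oo]. With [p = M / (M + sigma)], [M (1 - p) = p sigma] tends to [sigma] and
    [M (1 - p)^2 = p sigma (1 - p)] to 0, both dominated by [sigma], integrable by the upper bound.
    So the coefficient of order [1 / eta] disappears before [eta] is made small. *)
Lemma sigma_lower eta : 0 < eta ->
  - (penalty * eta) <= rate * (\int[P]_(w in D) sigma w) - delta * beta / 4.
Proof.
move=> eta0; set c2 := 4 * delta + beta / (4 * eta).
have c20 : 0 <= c2 by rewrite addr_ge0 ?mulr_ge0 ?invr_ge0 ?mulr_ge0 // ltW.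
pose p (k : nat) w := k.+1%:R / (k.+1%:R + sigma w).
pose f (k : nat) (w : Omega) : R :=
  rate * (p k w * sigma w) + c2 * (p k w * sigma w * (1 - p k w)) - delta * beta / 4 * p k w.
have p01 k w : D w -> 0 <= p k w <= 1.
  move=> Dw; have s0 := sigma0 Dw; have k0 : 0 < k.+1%:R :> R by [].
  rewrite /p divr_ge0 ?addr_ge0 //= ler_pdivrMr ?mul1r ?lerDl //.
  by rewrite ltr_pwDl.
have mp k : measurable_fun D (p k).
  apply: measurable_funM => //.
  apply: (@eq_measurable_fun _ _ _ _ D (fun w => (k.+1%:R + sigma w) `^ (-1))).
    move=> w /set_mem Dw; rewrite powR_inv1 // addr_ge0 // sigma0 //.
  apply: (measurableT_comp (measurable_powR _)).
  by apply: measurable_funD => //; exact: measurable_sigma.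
have mf k : measurable_fun D (f k).
  have ms := measurable_sigma.
  apply: measurable_funB; last by apply: measurable_funM.
  apply: measurable_funD; apply: measurable_funM => //; apply: measurable_funM => //.
    exact: measurable_funM.
  exact: measurable_funB.
have cp w : D w -> p ^~ w @ \oo --> (1 : R).
  move=> Dw; have s0 := sigma0 Dw.
  have -> : p ^~ w = (fun k => (1 + harmonic k * sigma w)^-1).
    apply/funext => k; rewrite /p /=.
    have k0 : k.+1%:R != 0 :> R by rewrite pnatr_eq0.
    have -> : 1 + k.+1%:R^-1 * sigma w = (k.+1%:R + sigma w) / k.+1%:R.
      by rewrite mulrDl divff // mulrC.
    by rewrite invf_div.
  rewrite -[X in _ --> X]invr1; apply: cvgV; first exact: oner_neq0.
  rewrite -[X in _ --> X]addr0; apply: cvgD; first exact: cvg_cst.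
  by rewrite -[X in _ --> X](mul0r (sigma w)); apply: cvgM; [exact: cvg_harmonic|exact: cvg_cst].
have flim w : D w -> f ^~ w @ \oo --> rate * sigma w - delta * beta / 4.
  move=> Dw.
  have cps : (fun k => p k w * sigma w) @ \oo --> 1 * sigma w.
    by apply: cvgM; [exact: cp|exact: cvg_cst].
  have -> : rate * sigma w - delta * beta / 4 =
    rate * (1 * sigma w) + c2 * (1 * sigma w * (1 - 1)) - delta * beta / 4 * 1.
    by rewrite subrr !(mulr0, mul1r, mulr1, addr0).
  apply: cvgB; last by apply: cvgM; [exact: cvg_cst|exact: cp].
  apply: cvgD; apply: cvgM; try exact: cvg_cst; first exact: cps.
  by apply: cvgM; [exact: cps|apply: cvgB; [exact: cvg_cst|exact: cp]].
pose g w := (rate + c2) * sigma w + delta * beta / 4.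
have k3 : 0 <= delta * beta / 4 by rewrite mulr_ge0 ?mulr_ge0 ?invr_ge0 // ltW.
have icst (a : R) : P.-integrable D (EFin \o cst a).
  apply: measurable_bounded_integrable => //.
    by rewrite [X in (X < _)%E]P_D ltry.
  by exists `|a|; split; [exact: num_real|move=> K /ltW aK w _ /=].
have iZ (a : R) : P.-integrable D (EFin \o (fun w => a * sigma w)).
  rewrite (_ : _ \o _ = (fun w => a%:E * (sigma w)%:E)%E); first exact: integrableZl.
  by apply/funext => w /=; rewrite EFinM.
have ig : P.-integrable D (EFin \o g).
  have := integrableD mD (iZ (rate + c2)) (icst (delta * beta / 4)).
  by apply: eq_integrable; [exact: mD|move=> w _ /=; rewrite EFinD].
have fg k w : D w -> `|f k w| <= g w.
  move=> Dw; have s0 := sigma0 Dw; have /andP[p0 p1] := p01 k w Dw.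
  rewrite /f /g (mulrDl rate c2 (sigma w)) ler_norml.
  have w0 : 0 <= p k w * sigma w <= sigma w by rewrite mulr_ge0 //= ler_piMl.
  move: w0 => /andP[w0 w0'].
  have w1 : 0 <= rate * (p k w * sigma w) <= rate * sigma w.
    by rewrite mulr_ge0 ?(ltW r0) //= ler_pM2l.
  have w2 : 0 <= c2 * (p k w * sigma w * (1 - p k w)) <= c2 * sigma w.
    rewrite mulr_ge0 ?(mulr_ge0 w0) ?subr_ge0 //= ler_wpM2l //.
    by apply: le_trans w0'; rewrite ler_piMr // gerBl.
  have w3 : 0 <= delta * beta / 4 * p k w <= delta * beta / 4.
    by rewrite mulr_ge0 //= ler_piMr.
  move: w1 w2 w3 => /andP[? ?] /andP[? ?] /andP[? ?].
  by apply/andP; split; lra.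
have [_ cint] := @cvg_Rintegral_dominated _ _ _ P D f
  (fun w => rate * sigma w - delta * beta / 4) g mD mf flim ig fg.
have -> : rate * (\int[P]_(w in D) sigma w) - delta * beta / 4 =
    \int[P]_(w in D) (rate * sigma w - delta * beta / 4).
  rewrite (RintegralB mD (iZ rate) (icst _)) (RintegralZl rate mD integrable_sigma).
  rewrite (Rintegral_cst P mD).
  by rewrite [X in fine X]P_D mulr1.
have ccst : (fun _ : nat => - (penalty * eta)) @ \oo --> - (penalty * eta) by exact: cvg_cst.
apply: (ler_cvgr ccst cint) => k.
apply: (le_trans (sigma_cutoff_lower (ltr0Sn R k) eta0)).
rewrite le_eqVlt; apply/orP; left; apply/eqP; apply: eq_Rintegral => w /set_mem Dw.
have s0 := sigma0 Dw; rewrite /= /balance /f /p -/c2.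
have d0 : 0 < k.+1%:R + sigma w by rewrite ltr_pwDl.
move: k.+1%:R d0 => K d0.
by field; rewrite gt_eqF.
Qed.

Lemma integral_sigma : (\int[P]_(w in D) (sigma w)%:E = (delta * beta / 4 / rate)%:E)%E.
Proof.
have pen0 : 0 <= penalty.
  apply: divr_ge0; last by rewrite mulr_ge0 // ltW.
  apply: mulr_ge0; first by rewrite mulr_ge0 // ltW.
  by rewrite addr_ge0 ?sqr_ge0 // mulr_ge0 ?mulr_ge0 // ltW.
apply/eqP; rewrite eq_le integral_sigma_le /=.
rewrite -[leRHS]fineK; last exact: integrable_fin_num integrable_sigma.
rewrite lee_fin ler_pdivrMr // mulrC.
apply/ler_addgt0Pr => e e0.
(* The [+ 1] keeps the denominator positive; then [penalty * eta <= e]. *)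
have eta0 : 0 < e / (penalty + 1) by rewrite divr_gt0 // ltr_wpDl.
have := sigma_lower eta0.
have : penalty * (e / (penalty + 1)) <= e.
  by rewrite mulrA ler_pdivrMr ?ltr_wpDl // mulrC ler_pM2l // lerDl.
by rewrite /Rintegral; lra.
Qed.

End assembly.

Lemma hua_pickrell_esum (R : realType) (d : measure_display) (Omega : measurableType d)
    (P : probability Omega R) (beta delta : R) (xi : Omega -> @cfun R) :
  0 < beta -> 1 < 2 * delta -> hua_pickrell_zeta P beta delta xi ->
  (\int[P]_w (\esum_(x in zeros (xi w)) (1 / x ^+ 2)%:E) =
   (delta * beta / 4 / rate beta delta)%:E)%E.
Proof.
move=> beta0 delta_gt hp.
have [N [mN PN sub]] := filterI (hp_at0 hp) (hp_product hp).
pose sigma w := fine (\esum_(x in zeros (xi w)) (1 / x ^+ 2)%:E)%E.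
have good w : (~` N) w -> exists s : R, [/\ 0 <= s,
  (\esum_(x in zeros (xi w)) (1 / x ^+ 2)%:E = s%:E)%E &
  forall y : R, 1 + y ^+ 2 * s <= sqrabs (xi w ('i%R * y%:C%C)) <= expR (y ^+ 2 * s)].
  move=> nNw; have [f0 fprod] : (fun w => xi w 0 = 1) w /\ _ := contrapT (fun h => nNw (sub w h)).
  exact: zeta_esum.
have sE w : (~` N) w -> (\esum_(x in zeros (xi w)) (1 / x ^+ 2)%:E = (sigma w)%:E)%E.
  by move=> /good[s [_ E _]]; rewrite /sigma E.
rewrite (ge0_integral_setC_null mN PN); last first.
  by move=> w; apply: esum_ge0 => x _; rewrite lee_fin divr_ge0 // sqr_ge0.
rewrite (eq_integral (fun w => (sigma w)%:E)); last by move=> w /set_mem /sE.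
apply: (integral_sigma beta0 delta_gt hp mN PN) => w /good[s [s0 E h]].
  by rewrite /sigma E.
by move=> y; rewrite /sigma E; exact: h.
Qed.

Theorem theorem1p3 (R : realType) (d : measure_display)
    (Omega : measurableType d) (P : probability Omega R)
    (beta : R) (m : nat) (xi : Omega -> @cfun R) :
  0 < beta -> (2 <= m)%N -> 1 < m%:R * beta ->
  hua_pickrell_zeta P beta (m%:R * beta / 2) xi ->
  (\int[P]_w (\esum_(x in zeros (xi w)) (1 / x ^+ 2)%:E))%E
  = (m%:R * beta / (4 * (m%:R * beta - 1) * (2 * m%:R + 1)))%:E.
Proof.
move=> beta0 _ mb1 hp.
have delta_gt : 1 < 2 * (m%:R * beta / 2) by rewrite mulrC divfK.
rewrite (hua_pickrell_esum beta0 delta_gt hp) /rate; congr _%:E.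
have m0 : 0 < 2 * m%:R + 1 :> R by rewrite ltr_wpDl.
have mb0 : m%:R * beta - 1 != 0 by rewrite gt_eqF // subr_gt0.
move: (m%:R : R) mb1 m0 mb0 {hp delta_gt} => q qb q0 qb0.
(* Here the factor [2 delta + beta / 2] of [rate] is [beta (2 m + 1) / 2], which cancels one [beta]
   of the numerator. *)
field.
have b1 : 2 * q + 1 != 0 by rewrite gt_eqF.
have b2 : q * beta * 2 + beta != 0 by rewrite gt_eqF //; lra.
by rewrite b1 b2 qb0.
Qed.
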